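(* Let $m\ge 1$ and $d\ge 3$. The $\mathbb{C}$-algebra $\mathcal{C}^{(d)}$ is minimally generated by the $\frac{m(m+3)}{2}$ elements $t_1^{(d)},\dots,t_m^{(d)}$ and $u_{ij}^{(d)}I_d$ $(1\le i\le j\le m)$; that is, these elements generate $\mathcal{C}^{(d)}$ as a $\mathbb{C}$-algebra and no proper subset of them does.
   Context: $\mathfrak{sl}_2(\mathbb{C})$ is the Lie algebra of traceless $2\times 2$ complex matrices, on which $\mathrm{SL}_2(\mathbb{C})$ acts by $\mathrm{Ad}(g)(X)=gXg^{-1}$; $\mathrm{SL}_2(\mathbb{C})$ acts on $\mathfrak{sl}_2(\mathbb{C})^{\oplus m}$ (direct sum of $m$ copies) by $\mathrm{Ad}^{\oplus m}$. $\Psi^{(d)}:\mathrm{SL}_2(\mathbb{C})\to\mathrm{GL}(\mathbb{C}^d)$ is the (unique up to isomorphism) $d$-dimensional irreducible representation of the complex Lie group $\mathrm{SL}_2(\mathbb{C})$, and $\rho^{(d)}:\mathfrak{sl}_2(\mathbb{C})\to\mathbb{C}^{d\times d}$ is its tangent representation (differential at the identity), i.e. the $d$-dimensional irreducible representation of $\mathfrak{sl}_2(\mathbb{C})$. $\mathrm{SL}_2(\mathbb{C})$ acts on $\mathbb{C}^{d\times d}$ by $M\mapsto\Psi^{(d)}(g)M\Psi^{(d)}(g)^{-1}$. $\mathcal{C}^{(d)}$ is the associative unital $\mathbb{C}$-algebra (pointwise operations) of all $\mathrm{SL}_2(\mathbb{C})$-equivariant polynomial maps $\mathfrak{sl}_2(\mathbb{C})^{\oplus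 m}\to\mathbb{C}^{d\times d}$ (polynomial means that the coordinate functions are polynomial functions). The elements are defined by $t_i^{(d)}(X_1,\dots,X_m)=\rho^{(d)}(X_i)$ and $u_{ij}^{(d)}(X_1,\dots,X_m)=\mathrm{Tr}(\rho^{(d)}(X_i)\rho^{(d)}(X_j))\in\mathbb{C}$. $I_d$ is the $d\times d$ identity matrix, and $fI_d$ denotes the map $X\mapsto f(X)I_d$. *)

(* Defs.v *)
From HB Require Import structures.
From mathcomp Require Import all_boot all_order all_fingroup all_algebra.
From mathcomp Require Import complex.
From mathcomp Require Import all_classical all_reals all_analysis.
(* [mpoly] is deliberately not imported: its notations clash with those of
   MathComp-Analysis. *)
From mathcomp Require mpoly.

Set Implicit Arguments.
Unset Strict Implicit.
Unset Printing Implicit Defensive.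

Import Order.TTheory GRing.Theory Num.Theory.
Import numFieldNormedType.Exports.

Local Open Scope classical_set_scope.
Local Open Scope ring_scope.

(* Everything is defined over an abstract [numClosedFieldType] K, on which
   MathComp-Analysis has its topology; the intended instance is K = R[i] with
   R : realType, i.e. the field of complex numbers. *)

Definition sl2 (K : numClosedFieldType) := {X : 'M[K]_2 | \tr X == 0}.

Definition SL2 (K : numClosedFieldType) := {g : 'M[K]_2 | \det g == 1}.
HB.instance Definition _ (K : numClosedFieldType) := Choice.on (SL2 K).

Section SL2Group.
Variable K : numClosedFieldType.
Implicit Types g h k : SL2 K.

Lemma SL2_unitmx g : val g \in unitmx.
Proof. by rewrite unitmxE (eqP (valP g)) unitr1. Qed.

Lemma SL2_one_subproof : \det (1%:M : 'M[K]_2) == 1.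
Proof. by rewrite det1. Qed.

Lemma SL2_mul_subproof g h : \det (val g *m val h) == 1.
Proof. by rewrite det_mulmx (eqP (valP g)) (eqP (valP h)) mulr1. Qed.

Lemma SL2_inv_subproof g : \det (invmx (val g)) == 1.
Proof. by rewrite det_inv (eqP (valP g)) invr1. Qed.

Definition SL2_one : SL2 K := exist _ 1%:M SL2_one_subproof.
Definition SL2_mul g h : SL2 K := exist _ (val g *m val h) (SL2_mul_subproof g h).
Definition SL2_inv g : SL2 K := exist _ (invmx (val g)) (SL2_inv_subproof g).

Lemma SL2_mulA : associative SL2_mul.
Proof. by move=> g h k; apply/val_inj; rewrite /= mulmxA. Qed.

Lemma SL2_mul1 : left_id SL2_one SL2_mul.
Proof. by move=> g; apply/val_inj; rewrite /= mul1mx. Qed.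

Lemma SL2_mulr1 : right_id SL2_one SL2_mul.
Proof. by move=> g; apply/val_inj; rewrite /= mulmx1. Qed.

Lemma SL2_mulV : left_inverse SL2_one SL2_inv SL2_mul.
Proof. by move=> g; apply/val_inj; rewrite /= mulVmx ?SL2_unitmx. Qed.

Lemma SL2_mulrV : right_inverse SL2_one SL2_inv SL2_mul.
Proof. by move=> g; apply/val_inj; rewrite /= mulmxV ?SL2_unitmx. Qed.

HB.instance Definition _ := isGroup.Build (SL2 K)
  SL2_mulA SL2_mul1 SL2_mulr1 SL2_mulV SL2_mulrV.

Lemma Ad_subproof g (X : sl2 K) : \tr (val g *m val X *m invmx (val g)) == 0.
Proof.
by rewrite mxtrace_mulC mulmxA mulVmx ?SL2_unitmx // mul1mx (valP X).
Qed.

Definition Ad g (X : sl2 K) : sl2 K :=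
  exist _ (val g *m val X *m invmx (val g)) (Ad_subproof g X).

End SL2Group.

Section Representations.
Variables (K : numClosedFieldType) (d : nat).
Implicit Types (Psi : SL2 K -> 'M[K]_d) (rho : sl2 K -> 'M[K]_d).

Definition is_representation Psi :=
  Psi 1%g = 1%:M /\ forall g h, Psi (g * h)%g = Psi g *m Psi h.

(* SL_2 is a closed complex submanifold of the space of 2 x 2 matrices, so
   the holomorphic maps on it are those that extend, locally around each of its
   points, to maps that are K-differentiable on an open set of matrices. *)
Definition local_extension Psi (g0 : SL2 K) (Phi : 'M[K]_2 -> 'M[K]_d) :=
  (\forall x \near val g0, differentiable Phi x) /\
  (\forall x \near val g0, forall g : SL2 K, val g = x -> Psi g = Phi x).

Definition holomorphic Psi := forall g0, exists Phi, local_extension Psi g0 Phi.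

Definition irreducible Psi :=
  (0 < d)%N /\
  forall U : {vspace 'cV[K]_d},
    (forall g (v : 'cV[K]_d), v \in U -> Psi g *m v \in U) ->
    U = 0%VS \/ U = fullv.

(* The differential of Psi at the identity; sl_2 is the tangent space there,
   so the right-hand side does not depend on the local extension chosen. *)
Definition is_tangent_representation Psi rho :=
  exists Phi, local_extension Psi 1%g Phi /\
    forall X : sl2 K, rho X = 'd Phi (1%:M : 'M[K]_2) (val X).

End Representations.

Section Covariants.
Variables (K : numClosedFieldType) (m d : nat).

Definition mxmap := ('I_m -> sl2 K) -> 'M[K]_d.

(* The entries of X_1, ..., X_m span the linear forms on the m-fold sum of sl_2
   (two of the four entries of each X_i being opposite), so the polynomial
   functions are the polynomials in these entries. *)
Definition entries (X : 'I_m -> sl2 K) : 'I_#|{: 'I_m * 'I_2 * 'I_2}| -> K :=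
  fun k => let: (i, a, b) := enum_val k in val (X i) a b.

Definition polynomial_function (f : ('I_m -> sl2 K) -> K) :=
  exists p : mpoly.mpoly #|{: 'I_m * 'I_2 * 'I_2}| K,
    forall X, f X = mpoly.meval (entries X) p.

Definition polynomial_map (F : mxmap) :=
  forall a b, polynomial_function (fun X => F X a b).

Definition equivariant (Psi : SL2 K -> 'M[K]_d) (F : mxmap) :=
  forall g X, F (fun i => Ad g (X i)) = Psi g *m F X *m invmx (Psi g).

Definition covariants (Psi : SL2 K -> 'M[K]_d) : set mxmap :=
  [set F | polynomial_map F /\ equivariant Psi F].

Definition unital_subalgebra (A : set mxmap) :=
  [/\ A (fun=> 1%:M),
      forall c F, A F -> A (fun X => c *: F X),
      forall F G, A F -> A G -> A (fun X => F X + G X) &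
      forall F G, A F -> A G -> A (fun X => F X *m G X)].

Definition generated_algebra (S : set mxmap) : set mxmap :=
  smallest unital_subalgebra S.

Definition minimally_generated (A S : set mxmap) :=
  generated_algebra S = A /\
  forall S', S' `<` S -> generated_algebra S' <> A.

Definition scalar_map (f : ('I_m -> sl2 K) -> K) : mxmap := fun X => (f X)%:M.

Definition t_elt (rho : sl2 K -> 'M[K]_d) (i : 'I_m) : mxmap :=
  fun X => rho (X i).

Definition u_elt (rho : sl2 K -> 'M[K]_d) (i j : 'I_m) :
    ('I_m -> sl2 K) -> K :=
  fun X => \tr (rho (X i) *m rho (X j)).

Definition generators (rho : sl2 K -> 'M[K]_d) : set mxmap :=
  [set t_elt rho i | i in [set: 'I_m]] `|`
  [set scalar_map (u_elt rho p.1 p.2) |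
    p in [set p : 'I_m * 'I_m | (p.1 <= p.2)%N]].

End Covariants.

Arguments covariants {K} m {d} Psi.
Arguments generators {K} m {d} rho.

(* Main.v *)
Require Import Defs.
From mathcomp Require Import all_boot all_order all_algebra complex.
From mathcomp Require Import all_classical all_reals all_analysis.
From mathcomp Require Import all_fingroup ring.
From mathcomp Require mpoly.

Set Implicit Arguments.
Unset Strict Implicit.
Unset Printing Implicit Defensive.

Import Order.TTheory GRing.Theory Num.Theory.
Import numFieldNormedType.Exports.

(** Write t_i and u_ij for the generators, L for the derivative of the representation,
    with kernel the scalars when it is extended to all 2 x 2 matrices, and
    [v, w] = v_0 w_1 - v_1 w_0 for the invariant form on K^2.

    Representation theory. The holomorphic representation Psi has first-order expansions
    along the unipotents 1 + t X with X^2 = 0; they make L equivariant and a morphism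
    of Lie algebras ([lie_equivariant], [lie_bracket]), and Psi (1 + t X) y is given by
    the exponential series of t L(X) whenever L(X) is nilpotent on y ([one_param_exp]).
    A highest weight argument then identifies the irreducible representation with the
    n-th symmetric power of K^2, n = d - 1: there are equivariant n-linear maps psi and
    phi from K^2 to the representation and to its dual, with
    phi (v, ..., v) psi (w, ..., w) = [v, w]^n ([exists_sym_model]). A matrix-valued map
    G is determined by the scalars phi (v, ..., v) G psi (w, ..., w).

    Generation. Let A be a subalgebra containing the generators. The traces of the
    products of two X_i are proportional to the u_ij, by proportionality of trace forms,
    and the trace of X_i X_j X_k is an alternating sum of products of t's divided by the
    Casimir value n (n + 2). Hence the 2 x 2 matrices spanned by 1, X_i and X_i X_j over
    the scalars f with f I in A form an algebra, the algebra of words ([word_mul]), with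
    traces in these scalars ([word_tr]) and with L(W) in A for each word W ([word_lie]).
    By polarization a covariant may be taken multilinear in N matrices, which are
    replaced by matrices of rank one made of two vectors each; pairing with phi and psi
    gives a multilinear SL_2-invariant of 2 N + 2 n vectors. By the first fundamental
    theorem for SL_2, proved by polarization as well ([SL2_first_fundamental]), it is a
    combination of products of brackets. Contracting the pairs of vectors back to the
    X_i produces brackets [x, W y] with words W, with coefficients which are scalars of
    A ([contract_class]). On setting the arguments of phi to v and those of psi to w,
    the Pluecker relation leaves only products of n brackets [v, W w]
    ([pair_class_mixed]), and such a product is the pairing of an element of A, built
    from 1 by multiplications by the L(W) and the Leibniz rule ([realize_product]).
    So the covariant lies in A ([covariant_in_algebra]).

    Minimality. For each generator there is a subalgebra which misses it and contains
    the other ones ([gen_avoidable]), defined by the coefficients of the powers of s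
    along a curve X_k = q_k(s) h in the Cartan subalgebra. For t_i take X_i = s h and
    X_k = 0 otherwise, with scalar coefficients of 1 and s. For u_ij take X_i = s^3 h and
    X_j = s^4 h: the other generators produce only multiples of L(h)^2 in degree 7, while
    u_ij I produces a nonzero scalar there, and L(h)^2 is not scalar as d >= 3. In
    particular the generators are distinct, and their number is
    m + m (m + 1) / 2. *)

Local Open Scope ring_scope.

(** * Multilinear maps and polarization *)

Section Multilinear.
Variables (K : fieldType) (I : finType).

(** [upd v i x] replaces the [i]-th entry of the family [v] by [x]. *)
Definition upd (T : Type) (v : I -> T) (i : I) (x : T) : I -> T :=
  fun j => if j == i then x else v j.

Lemma upd_same T (v : I -> T) i x : upd v i x i = x.
Proof. by rewrite /upd eqxx. Qed.

Lemma upd_other T (v : I -> T) i j x : j != i -> upd v i x j = v j.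
Proof. by rewrite /upd => /negbTE->. Qed.

Lemma upd_id T (v : I -> T) i : upd v i (v i) = v.
Proof. by apply/funext => j; rewrite /upd; case: eqP => [->|]. Qed.

Lemma upd_comm T (v : I -> T) i j x y :
  i != j -> upd (upd v i x) j y = upd (upd v j y) i x.
Proof.
move=> nij; apply/funext => k; rewrite /upd; case: eqP => [->|] //.
by rewrite eq_sym (negbTE nij).
Qed.

Lemma upd_map T T' (f : T -> T') (v : I -> T) i x :
  (fun k => f (upd v i x k)) = upd (fun k => f (v k)) i (f x).
Proof. by apply/funext => k; rewrite /upd; case: eqP. Qed.

Variables (V V' : lmodType K).

(** [h] is linear in each of its arguments. *)
Definition multilinear (h : (I -> V) -> V') :=
  forall v i (c : K) x y,
    h (upd v i (c *: x + y)) = c *: h (upd v i x) + h (upd v i y).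

Variable h : (I -> V) -> V'.
Hypothesis hml : multilinear h.

Lemma multilinearD v i x y : h (upd v i (x + y)) = h (upd v i x) + h (upd v i y).
Proof. by have := hml v i 1 x y; rewrite !scale1r. Qed.

Lemma multilinear0 v i : h (upd v i 0) = 0.
Proof.
by apply: (addIr (h (upd v i 0))); rewrite -multilinearD !add0r.
Qed.

Lemma multilinearZ v i c x : h (upd v i (c *: x)) = c *: h (upd v i x).
Proof. by rewrite -[c *: x]addr0 hml multilinear0 addr0. Qed.

Lemma multilinear_sum v i (B : Type) (r : seq B) (P : pred B) (F : B -> V) :
  h (upd v i (\sum_(b <- r | P b) F b)) = \sum_(b <- r | P b) h (upd v i (F b)).
Proof.
elim/big_rec2: _ => [|b y1 y2 _ <-]; first exact: multilinear0.
exact: multilinearD.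
Qed.

(** Distributivity: a multilinear map of sums is the sum over all the choices of one
    term in each argument. *)
Lemma multilinear_expand (A : finType) (x : I -> A -> V) :
  h (fun k => \sum_a x k a) = \sum_(f : {ffun I -> A}) h (fun k => x k (f k)).
Proof.
case: (pickP (fun _ : A => true)) => [a0 _ | noA]; last first.
  case: (pickP (fun _ : I => true)) => [i0 _ | noI].
    rewrite [RHS]big1 => [|f _]; last by move: (noA (f i0)).
    rewrite -[X in h X](upd_id _ i0) big_pred0 ?multilinear0 // => a.
  have noI' (i : I) : False by move: (noI i).
  pose f0 : {ffun I -> A} := [ffun i => False_rect A (noI' i)].
  rewrite (big_pred1 f0) => [|f]; last first.
    by apply/esym/eqP/ffunP => i; case: (noI' i).
  by congr h; apply/funext => i; case: (noI' i).
have supp (r : seq I) (f : {ffun I -> A}) :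
    reflect (forall k, k \notin r -> f k = a0) (f \in pffun_on a0 (mem r) predT).
  apply: (iffP pffun_onP) => [[/supportP fr _] //|fr].
  by split; [apply/supportP|move=> k _].
(* The sums are expanded in the arguments listed in r; the choice function is a0
   outside of r. *)
have key (r : seq I) (y : I -> V) : uniq r ->
  h (fun k => if k \in r then \sum_a x k a else y k) =
  \sum_(f in pffun_on a0 (mem r) predT) h (fun k => if k \in r then x k (f k) else y k).
  elim: r y => [|i r IHr] y /=.
    move=> _; rewrite (big_pred1 [ffun=> a0]) //= => f.
    apply/supp/eqP => [fr|-> k _]; last by rewrite ffunE.
    by apply/ffunP => k; rewrite ffunE fr.
  case/andP => nir Ur.
  transitivity (\sum_a \sum_(f in pffun_on a0 (mem r) predT)
      h (upd (fun k => if k \in r then x k (f k) else y k) i (x i a))).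
    rewrite [LHS](_ : _ = h (upd (fun k => if k \in r then \sum_a x k a else y k)
       i (\sum_a x i a))); last first.
      congr h; apply/funext => k; rewrite /upd inE.
      by case: eqP => // ->.
    rewrite multilinear_sum; apply: eq_bigr => a _.
    rewrite [LHS](_ : _ = h (fun k => if k \in r then \sum_a x k a
        else upd y i (x i a) k)); last first.
      congr h; apply/funext => k; rewrite /upd.
      by case: (eqVneq k i) => // ->; rewrite (negbTE nir).
    rewrite IHr //; apply: eq_bigr => f _; congr h; apply/funext => k.
    by rewrite /upd; case: (eqVneq k i) => // ->; rewrite (negbTE nir).
  rewrite [RHS](partition_big (fun f : {ffun I -> A} => f i) predT) //=.
  apply: eq_bigr => a _.
  pose seti b (f : {ffun I -> A}) := [ffun k => if k == i then b else f k].
  rewrite [RHS](reindex_onto (seti a) (seti a0)); last first.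
    move=> f /andP[_ /eqP fi]; apply/ffunP => k; rewrite !ffunE.
    by case: eqP => // ->.
  apply: eq_big => [f | f _].
    rewrite !ffunE !eqxx andbT.
    apply/supp/andP => [fr|[/supp fr /eqP ff] k nk].
      split.
        apply/supp => k; rewrite inE negb_or ffunE => /andP[/negbTE-> nk].
        by rewrite fr.
      by apply/eqP/ffunP => k; rewrite !ffunE; case: eqP => // ->; rewrite fr.
    have [->|nki] := eqVneq k i; first by rewrite -ff !ffunE eqxx.
    by have := fr k; rewrite inE negb_or nki nk ffunE (negbTE nki); apply.
  congr h; apply/funext => k; rewrite /upd inE ffunE.
  by case: eqP => // ->.
have -> : (fun k => \sum_a x k a) =
   (fun k => if k \in enum I then \sum_a x k a else 0).
  by apply/funext => k; rewrite mem_enum.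
rewrite key ?enum_uniq //; apply: eq_big => f.
  by apply/supp => k; rewrite mem_enum.
by move=> _; congr h; apply/funext => k; rewrite mem_enum.
Qed.

Lemma multilinear_scale (c : I -> K) (u : I -> V) :
  h (fun k => c k *: u k) = (\prod_k c k) *: h u.
Proof.
have key (r : seq I) (y : I -> V) : uniq r ->
  h (fun k => if k \in r then c k *: u k else y k) =
  (\prod_(k <- r) c k) *: h (fun k => if k \in r then u k else y k).
  elim: r y => [|i r IHr] y /=; first by rewrite big_nil scale1r.
  case/andP => nir Ur; rewrite big_cons -scalerA.
  have E (w : I -> V) (z : V) : (fun k => if k \in i :: r then (if k == i then z
      else w k) else y k) = upd (fun k => if k \in r then w k else y k) i z.
    by apply/funext => k; rewrite /upd inE; case: eqP.
  have E2 (w : I -> V) : (fun k => if k \in i :: r then w k else y k) =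
      upd (fun k => if k \in r then w k else y k) i (w i).
    by rewrite -E; apply/funext => k; case: eqP => // ->.
  rewrite [in LHS]E2 multilinearZ; congr (_ *: _); rewrite E2.
  have E3 (w : I -> V) : upd (fun k => if k \in r then w k else y k) i (u i) =
     (fun k => if k \in r then w k else upd y i (u i) k).
    apply/funext => k; rewrite /upd; case: (eqVneq k i) => // ->.
    by rewrite (negbTE nir).
  by rewrite !E3 IHr.
rewrite /index_enum -enumT.
have E (w : I -> V) : w = (fun k => if k \in enum I then w k else 0).
  by apply/funext => k; rewrite mem_enum.
by rewrite [in LHS](E (fun k => c k *: u k)) key ?enum_uniq // -E.
Qed.

(** Polarization: the alternating sum of the diagonal values of [h] over partial
    sums of [u] is the sum of the values of [h] at the rearrangements of [u]. *)
Lemma polarization (u : I -> V) :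
  \sum_(A : {set I}) (-1) ^+ #|~: A| *: h (fun=> \sum_(a in A) u a) =
  \sum_(f : {ffun I -> I} | injectiveb f) h (fun k => u (f k)).
Proof.
under eq_bigr => A _.
  rewrite [X in h X](_ : _ = fun=> \sum_a (a \in A)%:R *: u a); last first.
    apply/funext => _; rewrite big_mkcond; apply: eq_bigr => a _.
    by case: (a \in A); rewrite ?scale1r ?scale0r.
  rewrite multilinear_expand scaler_sumr.
  under eq_bigr => f _ do rewrite (multilinear_scale (fun k => (f k \in A)%:R)
     (fun k => u (f k))) scalerA.
  over.
rewrite exchange_big [RHS]big_mkcond; apply: eq_bigr => f _ /=.
rewrite -scaler_suml.
(* Inclusion-exclusion: the coefficient of h (u \o f) is the product over k of
   1 - (k is not a value of f), which vanishes unless f is onto. *)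
have -> : \sum_(A : {set I}) (-1) ^+ #|~: A| * \prod_k (f k \in A)%:R =
   \sum_(A : {set I}) \prod_k (if k \in A then 1 else - (k \notin codom f)%:R) :> K.
  apply: eq_bigr => A _.
  rewrite -prodr_const [X in X * _](big_mkcond (mem (~: A))) /=.
  have [fA|] := boolP [forall k, f k \in A].
    rewrite [X in _ * X]big1 ?mulr1 => [|k _]; last by rewrite (forallP fA).
    apply: eq_bigr => k _; rewrite inE; case kA: (k \in A) => //=.
    rewrite (_ : k \notin codom f) //; apply: contraFN kA => /codomP[l ->].
    exact: (forallP fA).
  rewrite negb_forall => /existsP[k nk].
  rewrite [X in _ * X](bigD1 k) //= (negbTE nk) mul0r mulr0.
  rewrite (bigD1 (f k)) //= (negbTE nk) codom_f /= oppr0 mul0r //.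
rewrite -bigA_distr.
have [inj_f|ninj] := boolP (injectiveb f).
  rewrite big1 ?scale1r // => k _; move/injectiveP: inj_f => inj_f.
  have /= := inj_card_bij inj_f (leqnn _) => bij_f.
  have -> : k \in codom f.
    by have [g _ gK] := bij_f; rewrite -[k]gK codom_f.
  by rewrite subr0.
have [k nk] : exists k, k \notin codom f.
  apply/existsP; apply: contraR ninj; rewrite negb_exists => /forallP onto.
  apply/injectiveP => a b fab.
  have /eqP/image_injP inj_f : #|codom f| = #|I|.
    by apply/eq_card => k; have /negbNE-> := onto k.
  exact: inj_f.
by rewrite (bigD1 k) //= nk subrr mul0r scale0r.
Qed.

(** The expansion of h (w + s z) in powers of s. *)
Lemma multilinear_subsets (w z : I -> V) (s : K) :
  h (fun k => w k + s *: z k) =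
  \sum_(A : {set I}) s ^+ #|A| *: h (fun k => if k \in A then z k else w k).
Proof.
have -> : (fun k => w k + s *: z k) =
   (fun k => \sum_(b : bool) (if b then s else 1) *: (if b then z k else w k)).
  by apply/funext => k; rewrite big_bool /= scale1r addrC.
rewrite multilinear_expand (reindex (fun A : {set I} => [ffun k => k \in A])); last first.
  exists (fun f : {ffun I -> bool} => finset (fun k => f k)).
    by move=> A _; apply/setP => k; rewrite !inE ffunE.
  by move=> f _; apply/ffunP => k; rewrite ffunE inE.
apply: eq_bigr => A _ /=.
under [X in h X]eq_fun => k do rewrite ffunE.
rewrite (multilinear_scale (fun k => if k \in A then s else 1)).
congr (_ *: _); by rewrite -big_mkcond prodr_const.
Qed.

End Multilinear.

(** * First-order calculus and one-parameter groups *)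

Section FirstOrder.
Variable K : numFieldType.

Lemma norm_near0 (e : K) : 0 < e -> \forall h \near (0 : K), `|h| <= e.
Proof.
move=> e0; apply/nbhs_ballP; exists e => // h.
by rewrite /ball /= sub0r normrN => /ltW.
Qed.

(** [negligible f]: the matrix [f h] is o(h) as h tends to 0, entry by entry. *)
Definition negligible p q (f : K -> 'M[K]_(p, q)) :=
  forall eps : K, 0 < eps -> \forall h \near (0 : K),
    forall i j, `|f h i j| <= eps * `|h|.

Lemma negligibleD p q (f g : K -> 'M[K]_(p, q)) :
  negligible f -> negligible g -> negligible (fun h => f h + g h).
Proof.
move=> nf ng eps eps0; have e2 : 0 < eps / 2 by rewrite divr_gt0.
near=> h => i j; rewrite mxE (le_trans (ler_normD _ _)) //.
rewrite [eps](splitr) mulrDl lerD //; move: i j; near: h; [exact: nf|exact: ng].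
Unshelve. all: by end_near. Qed.

Lemma negligibleMl p q r (A : 'M[K]_(p, q)) (f : K -> 'M[K]_(q, r)) :
  negligible f -> negligible (fun h => A *m f h).
Proof.
move=> nf eps eps0; pose c := \sum_i \sum_j `|A i j| + 1.
have c0 : 0 < c by rewrite ltr_wpDl // sumr_ge0 // => i _; apply: sumr_ge0.
have e2 : 0 < eps / c by rewrite divr_gt0.
have := nf _ e2; apply: filterS => h fh i j.
rewrite mxE (le_trans (ler_norm_sum _ _ _)) //.
apply: (@le_trans _ _ (\sum_k `|A i k| * (eps / c * `|h|))).
  by apply: ler_sum => k _; rewrite normrM ler_wpM2l.
rewrite -mulr_suml mulrA ler_wpM2r // mulrCA ger_pMr // ler_pdivrMr // mul1r.
rewrite /c (bigD1 i) //= -addrA lerDl addr_ge0 //.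
by apply: sumr_ge0 => l _; apply: sumr_ge0.
Qed.

Lemma negligible_trmx p q (f : K -> 'M[K]_(p, q)) :
  negligible f -> negligible (fun h => (f h)^T).
Proof.
move=> nf eps eps0; have := nf _ eps0; apply: filterS => h fh i j.
by rewrite mxE.
Qed.

Lemma negligibleMr p q r (A : 'M[K]_(q, r)) (f : K -> 'M[K]_(p, q)) :
  negligible f -> negligible (fun h => f h *m A).
Proof.
move=> nf; have := negligible_trmx (negligibleMl A^T (negligible_trmx nf)).
by under [X in negligible X -> _]eq_fun do rewrite trmx_mul !trmxK.
Qed.

Lemma negligible_pow p q (A : 'M[K]_(p, q)) k :
  negligible (fun h => h ^+ k.+2 *: A).
Proof.
move=> eps eps0; pose c := \sum_i \sum_j `|A i j| + 1.
have c0 : 0 < c by rewrite ltr_wpDl // sumr_ge0 // => i _; apply: sumr_ge0.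
have e2 : 0 < eps / c by rewrite divr_gt0.
near=> h => i j.
have h1 : `|h| <= 1 by near: h; exact: norm_near0.
have h2 : `|h| <= eps / c by near: h; exact: norm_near0.
rewrite mxE normrM normrX exprS exprS.
have Ac : `|A i j| <= c.
  rewrite /c (bigD1 i) //= (bigD1 j) //= -!addrA lerDl !addr_ge0 //.
    exact: sumr_ge0.
  by apply: sumr_ge0 => l _; apply: sumr_ge0.
have hk : `|h| ^+ k <= 1 by rewrite exprn_ile1.
rewrite -!mulrA mulrC ler_wpM2r //.
apply: (@le_trans _ _ (eps / c * (1 * c))); last first.
  by rewrite mul1r divfK // gt_eqF.
by rewrite ler_pM // ?mulr_ge0 ?exprn_ge0 // ler_pM ?exprn_ge0.
Unshelve. all: by end_near. Qed.

Lemma negligible0 p q : negligible (fun=> 0 : 'M[K]_(p, q)).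
Proof.
by move=> eps eps0; near=> h => i j; rewrite mxE normr0 mulr_ge0 // ltW.
Unshelve. all: by end_near. Qed.

Lemma negligibleZ p q (f : K -> 'M[K]_(p, q)) :
  negligible f -> negligible (fun h => h *: f h).
Proof.
move=> nf eps eps0; have nfe := nf _ eps0.
near=> h => i j; rewrite mxE normrM (@le_trans _ _ (1 * `|f h i j|)) //.
  by rewrite ler_wpM2r //; near: h; exact: norm_near0.
by rewrite mul1r; move: i j; near: h.
Unshelve. all: by end_near. Qed.

Lemma negligible_sum p q n (f : nat -> K -> 'M[K]_(p, q)) :
  (forall k, (k < n)%N -> negligible (f k)) ->
  negligible (fun h => \sum_(k < n) f k h).
Proof.
elim: n => [|n IHn] nf.
  under eq_fun do rewrite big_ord0; exact: negligible0.
under eq_fun do rewrite big_ord_recr /=.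
apply: negligibleD; last exact: nf.
by apply: IHn => k kn; apply: nf; apply: ltnW.
Qed.

(** The first-order coefficient is unique. *)
Lemma negligible_linear p q (A : 'M[K]_(p, q)) :
  negligible (fun h => h *: A) -> A = 0.
Proof.
move=> nA; apply/matrixP => i j; rewrite [RHS]mxE.
apply/eqP; rewrite -normr_eq0; apply/negPn/negP => A0.
have A1 : 0 < `|A i j| by rewrite lt_neqAle eq_sym A0 /=.
have e0 : 0 < `|A i j| / 2 by rewrite divr_gt0.
have /nbhs_ballP[r /= r0] := nA _ e0.
move/(_ (r / 2)) => /=; rewrite /ball /= sub0r normrN ger0_norm ?divr_ge0 ?ltW //.
have r2 : r / 2 < r by rewrite ltr_pdivrMr // ltr_pMr // ltr1n.
move=> /(_ r2)/(_ i j) H.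
have rr : 0 < r / 2 by rewrite divr_gt0.
move: H; rewrite mxE normrM (ger0_norm (ltW rr)) [X in X <= _]mulrC (ler_pM2r rr).
by rewrite ler_pdivlMr // ger_pMr // => /(le_lt_trans)/(_ (ltr1n _ 2))/=; rewrite ltxx.
Qed.

(** A one-parameter group of matrices phi, differentiable at 0 with derivative E. *)
Section OneParameterGroup.
Variable d : nat.
Hypothesis archi : forall x : K, exists n : nat, `|x| < n%:R.
Variables (phi : K -> 'M[K]_d) (E : 'M[K]_d).
Hypothesis phi0 : phi 0 = 1%:M.
Hypothesis phiD : forall s t, phi (s + t) = phi s *m phi t.
Hypothesis phiE : negligible (fun h => phi h - 1%:M - h *: E).

(** What holds near 0 holds at t / (M + 1) for some M. *)
Lemma archi_near (t : K) (P : K -> Prop) :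
  (\forall h \near (0 : K), P h) -> exists M : nat, P (t / M.+1%:R).
Proof.
move=> /nbhs_ballP[r /= r0 Pr]; have [n nr] := archi (t / r).
exists n; apply: Pr; rewrite /ball /= sub0r normrN normrM normfV.
rewrite [`|n.+1%:R|]ger0_norm // ltr_pdivrMr ?ltr0n //.
move: nr; rewrite normrM normfV (ger0_norm (ltW r0)) ltr_pdivrMr // => /lt_le_trans; apply.
by rewrite mulrC ler_wpM2l ?(ltW r0) // ler_nat.
Qed.

(** A one-parameter group is bounded on every disc. *)
Lemma one_param_bounded (t : K) :
  exists2 B : K, 0 <= B & forall s, `|s| <= `|t| -> forall i j, `|phi s i j| <= B.
Proof.
pose c := \sum_i \sum_j `|E i j| + 2.
have cE i j : `|E i j| + 2 <= c.
  rewrite /c (bigD1 i) //= (bigD1 j) //= lerD2r -addrA lerDl addr_ge0 //.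
    exact: sumr_ge0.
  by apply: sumr_ge0 => l _; apply: sumr_ge0.
have c0 : 0 <= c.
  by rewrite addr_ge0 // sumr_ge0 // => i _; apply: sumr_ge0.
have near_bd : \forall h \near (0 : K), forall i j, `|phi h i j| <= c.
  have := phiE ltr01 => phE1.
  near=> h => i j.
  have h1 : `|h| <= 1 by near: h; exact: norm_near0.
  have -> : phi h = (phi h - 1%:M - h *: E) + 1%:M + h *: E.
    by rewrite addrAC subrK subrK.
  rewrite mxE (le_trans (ler_normD _ _)) // (le_trans _ (cE i j)) // mxE.
  rewrite [leLHS]addrC lerD //; first by rewrite mxE normrM ler_piMl.
  rewrite (le_trans (ler_normD _ _)) // [leRHS](_ : 2 = 1 + 1) // lerD //.
    apply: (@le_trans _ _ (1 * `|h|)); last by rewrite mul1r.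
    by move: i j; near: h.
  by rewrite mxE; case: eqP; rewrite ?normr1 ?normr0.
move/nbhs_ballP: near_bd => [r /= r0 Pr].
have [n nt] := archi (t / r).
have tn : `|t| < n%:R * r.
  by move: nt; rewrite normrM normfV (ger0_norm (ltW r0)) ltr_pdivrMr.
suff [B B0 PB] : exists2 B : K, 0 <= B &
    forall s, `|s| < n.+1%:R * r -> forall i j, `|phi s i j| <= B.
  exists B => // s st; apply: PB; apply: le_lt_trans st _; apply: lt_trans tn _.
  by rewrite ltr_pM2r // ltr_nat.
elim: n {nt tn} => [|n [B B0 PB]].
  exists c => // s; rewrite mul1r => sr; apply: Pr.
  by rewrite /ball /= sub0r normrN.
(* phi s is the product of its values at s (n + 1) / (n + 2) and s / (n + 2). *)
exists (d%:R * (B * c)); first by rewrite !mulr_ge0.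
move=> s sn i j.
have n2 : n.+2%:R != 0 :> K by rewrite pnatr_eq0.
have -> : s = s * (n.+1%:R / n.+2%:R) + s / n.+2%:R.
  by rewrite -mulrDr -{2}[n.+2%:R^-1]mul1r -mulrDl natr1 divff ?mulr1.
rewrite phiD mxE (le_trans (ler_norm_sum _ _ _)) //.
have -> : d%:R * (B * c) = \sum_(k < d) B * c by rewrite sumr_const card_ord mulr_natl.
have nn (m : nat) : `|m%:R| = m%:R :> K by rewrite ger0_norm.
apply: ler_sum => k _; rewrite normrM ler_pM //.
  apply: PB; rewrite !normrM normfV !nn mulrA ltr_pdivrMr ?ltr0n // mulrC -mulrA.
  by rewrite ltr_pM2l ?ltr0n // mulrC.
apply: Pr; rewrite /ball /= sub0r normrN normrM normfV nn ltr_pdivrMr ?ltr0n //.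
by rewrite mulrC.
Unshelve. all: by end_near. Qed.

(** Truncated exponential series of [t E] applied to [y]. *)
Definition exp_trunc D (t : K) (y : 'cV[K]_d) : 'cV[K]_d :=
  \sum_(k < D) (t ^+ k / k`!%:R) *: iter k (mulmx E) y.

Lemma iter_mulmx_sum k n (c : 'I_n -> K) (y : 'I_n -> 'cV[K]_d) :
  iter k (mulmx E) (\sum_(i < n) c i *: y i) =
  \sum_(i < n) c i *: iter k (mulmx E) (y i).
Proof.
elim: k => [|k IHk] //=; rewrite IHk mulmx_sumr.
by apply: eq_bigr => i _; rewrite -scalemxAr.
Qed.

(** The functional equation of the exponential, exact on the vectors killed by the
    D-th power of E. *)
Lemma exp_truncD D s h (y : 'cV[K]_d) : iter D (mulmx E) y = 0 ->
  exp_trunc D (s + h) y = exp_trunc D h (exp_trunc D s y).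
Proof.
move=> yD; have yk k : (D <= k)%N -> iter k (mulmx E) y = 0.
  move=> /subnK <-; rewrite iterD yD; elim: (k - D)%N => //= l ->.
  by rewrite mulmx0.
rewrite /exp_trunc.
under [RHS]eq_bigr => k _ do rewrite iter_mulmx_sum scaler_sumr.
pose G i k := (h ^+ i / i`!%:R * (s ^+ (k - i) / (k - i)`!%:R)) *: iter k (mulmx E) y.
have fn0 k : k`!%:R != 0 :> K by rewrite pnatr_eq0 -lt0n fact_gt0.
transitivity (\sum_(0 <= k < D) \sum_(0 <= i < D | (i <= k)%N) G i k).
  rewrite big_mkord; apply: eq_bigr => k _.
  rewrite exprDn mulr_suml scaler_suml.
  rewrite -(big_mkord xpredT (fun i => (s ^+ (k - i) * h ^+ i *+ 'C(k, i) / k`!%:R) *: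
     iter k (mulmx E) y)) (big_nat_widen _ _ D) ?ltn_ord //.
  apply: eq_bigr => i; rewrite /= ltnS => ik.
  rewrite /G; congr (_ *: _).
  rewrite -mulr_natr -(bin_fact ik) !natrM.
  have bk : 'C(k, i)%:R != 0 :> K by rewrite pnatr_eq0 -lt0n bin_gt0.
  by field; rewrite bk !fn0.
rewrite (exchange_big_dep_nat xpredT) //= big_mkord; apply: eq_bigr => i _.
rewrite [RHS](_ : _ = \sum_(0 <= j < D) G i (j + i)%N); last first.
  rewrite big_mkord; apply: eq_bigr => j _; rewrite /G addnK scalerA; congr (_ *: _).
  by rewrite addnC iterD.
rewrite [RHS](big_cat_nat (n := D - i)) //= ?leq_subr // [X in _ = _ + X]big_nat_cond.
rewrite [X in _ = _ + X]big1 ?addr0.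
  rewrite -(big_addn 0 D i xpredT (fun k => G i k)) add0n.
  rewrite [LHS](big_cat_nat (n := i)) //= ?(ltnW (ltn_ord i)) //.
  rewrite big_nat_cond big1 ?add0r => [|k]; last first.
    move=> /andP[/= ki ik]; by have := leq_ltn_trans ik ki; rewrite ltnn.
  by apply: congr_big_nat => // k /andP[-> _].
move=> j; rewrite andbT => /andP[Dj _]; rewrite /G yk ?scaler0 //.
by rewrite addnC -leq_subLR.
Qed.

Lemma exp_trunc_bounded D (y : 'cV[K]_d) (t : K) :
  exists2 C : K, 0 <= C & forall s, `|s| <= `|t| -> forall i j,
    `|exp_trunc D s y i j| <= C.
Proof.
pose C := \sum_(k < D) \sum_i \sum_j
  `|t| ^+ k / k`!%:R * `|iter k (mulmx E) y i j|.
have pos (k : nat) i j : 0 <= `|t| ^+ k / k`!%:R * `|iter k (mulmx E) y i j|.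
  by rewrite mulr_ge0 // divr_ge0 // exprn_ge0.
exists C.
  by apply: sumr_ge0 => k _; apply: sumr_ge0 => i _; apply: sumr_ge0.
move=> s st i j; rewrite /exp_trunc summxE (le_trans (ler_norm_sum _ _ _)) //.
apply: ler_sum => k _; rewrite (bigD1 i) //= (bigD1 j) //= -addrA ler_wpDr //.
  by rewrite addr_ge0 ?sumr_ge0 // => l _; apply: sumr_ge0.
rewrite mxE normrM ler_wpM2r // normrM normfV normrX normr_nat.
by rewrite ler_wpM2r ?invr_ge0 // lerXn2r.
Qed.

(** On a vector y killed by a power of E, the group is the exponential series of E.
    The difference c t - phi t y, with c s the series at s, is cut into M + 1 steps
    of length h = t / (M + 1); each of them is o(h), since phi and the series agree
    to first order at 0 and are bounded up to t. *)
Lemma one_param_exp D (y : 'cV[K]_d) (t : K) : iter D.+2 (mulmx E) y = 0 ->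
  phi t *m y = exp_trunc D.+2 t y.
Proof.
move=> yD; set c := fun s => exp_trunc D.+2 s y.
have [B B0 PB] := one_param_bounded t.
have [C C0 PC] := exp_trunc_bounded D.+2 y t.
(* S h is the matrix of the truncated series. *)
pose S h := \sum_(k < D.+2) (h ^+ k / k`!%:R) *: iter k (mulmx E) 1%:M.
have SE h z : S h *m z = exp_trunc D.+2 h z.
  rewrite /S mulmx_suml; apply: eq_bigr => k _; rewrite -scalemxAl; congr (_ *: _).
  elim: (nat_of_ord k) => [|l IHl] /=; first by rewrite mul1mx.
  by rewrite -mulmxA IHl.
have nS : negligible (fun h => S h - phi h).
  have -> : (fun h => S h - phi h) = (fun h => (\sum_(k < D) h ^+ k.+2 *:
      (k.+2`!%:R^-1 *: iter k.+2 (mulmx E) 1%:M)) + (-1)%:M *m (phi h - 1%:M - h *: E)).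
    apply/funext => h; rewrite /S !big_ord_recl /= expr0 expr1 !divr1 scale1r.
    rewrite mulmx1 mul_scalar_mx scaleN1r !opprB.
    under [X in _ + (_ + X) - _ = _]eq_bigr => k _ do
      rewrite -[_ / _]/(h ^+ k.+2 * _) -scalerA.
    by rewrite -!addrA addrCA [RHS]addrCA; congr (_ + _); rewrite addrCA.
  apply: negligibleD (negligibleMl _ phiE).
  apply: (@negligible_sum _ _ _ (fun k h => h ^+ k.+2 *:
      (k.+2`!%:R^-1 *: iter k.+2 (mulmx E) 1%:M))) => k _.
  exact: negligible_pow.
suff small (eps : K) : 0 < eps -> forall i, `|(c t - phi t *m y) i 0| <= eps.
  apply/esym/eqP; rewrite -subr_eq0; apply/eqP/matrixP => i j; rewrite ord1 [RHS]mxE.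
  apply/eqP; rewrite -normr_eq0; apply/negPn/negP => n0.
  have n1 : 0 < `|(c t - phi t *m y) i 0| by rewrite lt_neqAle eq_sym n0 /=.
  have /small/(_ i) : 0 < `|(c t - phi t *m y) i 0| / 2 by rewrite divr_gt0.
  by rewrite ler_pdivlMr // ger_pMr // => /(le_lt_trans)/(_ (ltr1n _ 2)); rewrite ltxx.
move=> eps0 i.
pose Q := d%:R * (B * (d%:R * C)) * `|t| + 1.
have Q0 : 0 < Q by rewrite ltr_wpDl // !mulr_ge0.
have eQ : 0 < eps / Q by rewrite divr_gt0.
have [M] := archi_near t (nS _ eQ); set h := t / M.+1%:R => PM.
have tE : t = M.+1%:R * h by rewrite /h mulrCA divff ?mulr1 // pnatr_eq0.
have jh (j : nat) : (j <= M.+1)%N -> `|j%:R * h| <= `|t|.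
  by move=> jM; rewrite tE !normrM ler_wpM2r // !ger0_norm // ler_nat.
(* Telescoping of phi ((M + 1 - j) h) c (j h). *)
have -> : c t - phi t *m y = \sum_(0 <= j < M.+1)
    phi ((M - j)%:R * h) *m ((S h - phi h) *m c (j%:R * h)).
  pose g j := phi ((M.+1 - j)%:R * h) *m c (j%:R * h).
  have -> : c t - phi t *m y = g M.+1 - g 0%N.
    rewrite /g subnn subn0 mul0r phi0 mul1mx -tE; congr (_ - _ *m _).
    rewrite /c /exp_trunc big_ord_recl /= big1 ?addr0 => [|k _].
      by rewrite expr0 divr1 scale1r.
    by rewrite exprS !mul0r scale0r.
  rewrite -telescope_sumr //; apply: eq_big_nat => j; rewrite ltnS => /= jM.
  rewrite /g subSS subSn // -[in X in _ - X]natr1 mulrDl mul1r phiD -mulmxA -mulmxBr.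
  by congr (_ *m _); rewrite mulmxBl SE -exp_truncD // -natr1 mulrDl mul1r.
rewrite summxE (le_trans (ler_norm_sum _ _ _)) //.
apply: (@le_trans _ _ (\sum_(0 <= j < M.+1) d%:R * (B * (d%:R * (eps / Q * `|h| * C))))).
  rewrite !big_mkord; apply: ler_sum => j _.
  have jM : (j <= M)%N by rewrite -ltnS.
  have bsum (F : 'I_d -> K) b : (forall k, `|F k| <= b) -> `|\sum_k F k| <= d%:R * b.
    move=> Fb; rewrite (le_trans (ler_norm_sum _ _ _)) //.
    apply: le_trans (ler_sum _ (fun k _ => Fb k)) _.
    by rewrite sumr_const card_ord mulr_natl.
  rewrite mxE; apply: (bsum) => k; rewrite normrM ler_pM //.
    by apply: PB; apply: jh; rewrite (leq_trans (leq_subr _ _)).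
  rewrite mxE; apply: (bsum) => l; rewrite normrM ler_pM //.
  by apply: PC; apply: jh; rewrite ltnW // ltnS.
rewrite sumr_const_nat subn0 -(mulr_natl _ M.+1).
have -> : M.+1%:R * (d%:R * (B * (d%:R * (eps / Q * `|h| * C)))) =
   eps / Q * (d%:R * (B * (d%:R * C)) * `|t|).
  have -> : `|t| = M.+1%:R * `|h| by rewrite {1}tE normrM normr_nat.
  ring.
by rewrite -mulrA ger_pMr // mulrC ler_pdivrMr // mul1r lerDl.
Qed.

End OneParameterGroup.
End FirstOrder.

(** * Two-by-two matrices, sl_2 and SL_2 *)

Section TwoByTwo.
Variable K : numClosedFieldType.
Implicit Types (A B C X Y Z : 'M[K]_2) (v w : 'cV[K]_2) (g h : SL2 K).

(** The two indices of a 2 x 2 matrix. *)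
Definition o0 : 'I_2 := ord0.
Definition o1 : 'I_2 := lift ord0 ord0.

Lemma o2P (P : 'I_2 -> Prop) : P o0 -> P o1 -> forall i, P i.
Proof.
move=> P0 P1 i; case: (unliftP ord0 i) => [j ->|->] //.
by rewrite [j]ord1.
Qed.

Lemma mx2P A B : A o0 o0 = B o0 o0 -> A o0 o1 = B o0 o1 -> A o1 o0 = B o1 o0 ->
  A o1 o1 = B o1 o1 -> A = B.
Proof.
by move=> *; apply/matrixP; apply: o2P; apply: o2P.
Qed.

Lemma cv2P v w : v o0 ord0 = w o0 ord0 -> v o1 ord0 = w o1 ord0 -> v = w.
Proof. by move=> *; apply/colP; apply: o2P. Qed.

Lemma sum2 (V : nmodType) (F : 'I_2 -> V) : \sum_i F i = F o0 + F o1.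
Proof. by rewrite !big_ord_recl big_ord0 addr0. Qed.

Lemma mulmx2E p q (M : 'M[K]_(p, 2)) (N : 'M[K]_(2, q)) i j :
  (M *m N) i j = M i o0 * N o0 j + M i o1 * N o1 j.
Proof. by rewrite mxE sum2. Qed.

Lemma mxtrace2E A : \tr A = A o0 o0 + A o1 o1.
Proof. by rewrite /mxtrace sum2. Qed.

Lemma det2E A : \det A = A o0 o0 * A o1 o1 - A o0 o1 * A o1 o0.
Proof.
rewrite (expand_det_row _ ord0) sum2 /cofactor !det_mx11 !mxE /=.
rewrite expr0 mul1r /= expr1 mulN1r mulrN; congr (_ * A _ _ - _ * A _ _);
  by apply/val_inj.
Qed.

(** The 2 x 2 matrix with rows (a, b) and (c, d). *)
Definition mat2 (a b c d : K) : 'M[K]_2 :=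
  \matrix_(i, j) if i == o0 then if j == o0 then a else b
                 else if j == o0 then c else d.

Lemma mat2E a b c d : ((mat2 a b c d o0 o0 = a) * (mat2 a b c d o0 o1 = b) *
  (mat2 a b c d o1 o0 = c) * (mat2 a b c d o1 o1 = d))%type.
Proof. by rewrite !mxE. Qed.

(** The traceless part of a 2 x 2 matrix. *)
Definition traceless A : 'M[K]_2 := A - (\tr A / 2)%:M.

Lemma traceless_tr A : \tr (traceless A) = 0.
Proof.
rewrite /traceless mxtrace2E !mxE /= mulr1n mxtrace2E; by field.
Qed.

Lemma traceless_id A : \tr A = 0 -> traceless A = A.
Proof. by rewrite /traceless => ->; rewrite mul0r raddf0 subr0. Qed.

Lemma traceless_scalar (a : K) : traceless a%:M = 0.
Proof. by rewrite /traceless mxtrace_scalar -(mulr_natr a) mulfK ?subrr // pnatr_eq0. Qed.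

Lemma traceless_linear (c : K) A B :
  traceless (c *: A + B) = c *: traceless A + traceless B.
Proof.
by apply: mx2P; rewrite /traceless !mxE /= ?mulr1n ?mulr0n ?mxtrace2E ?mxE; field.
Qed.

(** The element of sl_2 given by the traceless part; on traceless matrices this is a
    total inverse of the inclusion. *)
Definition sl2_of A : sl2 K := exist _ (traceless A) (introT eqP (traceless_tr A)).

Lemma sl2_of_val (X : sl2 K) : sl2_of (val X) = X.
Proof. by apply/val_inj; rewrite /= traceless_id //; apply/eqP/(valP X). Qed.

Lemma val_sl2_tr (X : sl2 K) : \tr (val X) = 0.
Proof. exact/eqP/(valP X). Qed.

Lemma Ad_sl2_of g A : Ad g (sl2_of A) = sl2_of (val g *m A *m invmx (val g)).
Proof.
apply/val_inj; rewrite /= /traceless mulmxBr mulmxBl; congr (_ - _).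
rewrite mul_mx_scalar -scalemxAl mulmxV ?SL2_unitmx //.
by rewrite mxtrace_mulC mulmxA mulVmx ?SL2_unitmx // mul1mx scalemx1.
Qed.

(** The square-zero matrices of size 2 are traceless and singular. *)
Lemma sqr0_tr_det A : A *m A = 0 -> \tr A = 0 /\ \det A = 0.
Proof.
move=> A2; have d0 : \det A = 0.
  by apply/eqP; rewrite -sqrf_eq0 expr2 -det_mulmx A2 det0.
split=> //; move: (d0); rewrite det2E mxtrace2E => /eqP; rewrite subr_eq0 => /eqP dA.
move/matrixP: A2 => A2.
have := A2 o0 o0; have := A2 o1 o1; rewrite !mulmx2E !mxE => e11 e00.
apply/eqP; rewrite -sqrf_eq0; apply/eqP.
rewrite (_ : _ ^+ 2 = (A o0 o0 * A o0 o0 + A o0 o1 * A o1 o0) +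
   (A o1 o0 * A o0 o1 + A o1 o1 * A o1 o1) + 2 * (A o0 o0 * A o1 o1 - A o0 o1 * A o1 o0));
  last by ring.
by rewrite e00 e11 dA subrr mulr0 !addr0.
Qed.

(** The one-parameter group 1 + t X of a square-zero matrix X (with the default value
    1 when the determinant of 1 + t X is not 1). *)
Definition unip X (t : K) : SL2 K := insubd (1%g : SL2 K) (1%:M + t *: X).

Lemma val_unip X t : X *m X = 0 -> val (unip X t) = 1%:M + t *: X.
Proof.
move=> X2; rewrite insubdK // -topredE /=.
have [] := sqr0_tr_det X2; rewrite det2E mxtrace2E => tX dX.
rewrite det2E !mxE /= mulr1n mulr0n.
rewrite (_ : _ - _ = 1 + t * (X o0 o0 + X o1 o1) +
   t ^+ 2 * (X o0 o0 * X o1 o1 - X o0 o1 * X o1 o0)); last by ring.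
by rewrite tX dX !mulr0 !addr0.
Qed.

Lemma unip0 X : X *m X = 0 -> unip X 0 = 1%g.
Proof. by move=> X2; apply/val_inj; rewrite val_unip // scale0r addr0. Qed.

Lemma unipD X s t : X *m X = 0 -> unip X (s + t) = (unip X s * unip X t)%g.
Proof.
move=> X2; apply/val_inj; rewrite /= !val_unip //.
rewrite mulmxDl mul1mx mulmxDr mulmx1 -scalemxAr -scalemxAl X2 !scaler0 addr0.
by rewrite scalerDl addrAC addrA.
Qed.

(** The standard basis e, f, h of sl_2. *)
Definition sl2e : 'M[K]_2 := mat2 0 1 0 0.
Definition sl2f : 'M[K]_2 := mat2 0 0 1 0.
Definition sl2h : 'M[K]_2 := mat2 1 0 0 (-1).

Lemma sl2e_sqr : sl2e *m sl2e = 0.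
Proof. by apply: mx2P; rewrite mulmx2E !mat2E !mxE; ring. Qed.

Lemma sl2f_sqr : sl2f *m sl2f = 0.
Proof. by apply: mx2P; rewrite mulmx2E !mat2E !mxE; ring. Qed.

Lemma sl2h_tr : \tr sl2h = 0.
Proof. by rewrite mxtrace2E !mat2E subrr. Qed.

Lemma sl2_basis X : \tr X = 0 -> X = X o0 o1 *: sl2e + (X o1 o0 *: sl2f + X o0 o0 *: sl2h).
Proof.
move=> X0; have X11 : X o1 o1 = - X o0 o0.
  by apply/eqP; rewrite -addr_eq0 addrC -mxtrace2E X0.
by apply: mx2P; rewrite !mxE /= ?X11; ring.
Qed.

(** SL_2 is generated by its elementary matrices. *)
Lemma SL2_elementary_ind (P : SL2 K -> Prop) :
  (forall t, P (unip sl2e t)) -> (forall t, P (unip sl2f t)) ->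
  (forall g h, P g -> P h -> P (g * h)%g) -> forall g, P g.
Proof.
move=> Pe Pf PM.
have main g : val g o1 o0 != 0 -> P g.
  move=> c0; have := valP g; rewrite det2E => /eqP dg.
  have -> : g = (unip sl2e ((val g o0 o0 - 1) / val g o1 o0) *
      (unip sl2f (val g o1 o0) * unip sl2e ((val g o1 o1 - 1) / val g o1 o0)))%g.
    apply/val_inj; rewrite /= !val_unip ?sl2e_sqr ?sl2f_sqr //.
    have bE : val g o0 o1 = (val g o0 o0 * val g o1 o1 - 1) / val g o1 o0.
      move/eqP: dg; rewrite subr_eq => /eqP ->.
      by rewrite addrAC subrr add0r mulfK.
    apply: mx2P; rewrite !mulmx2E !mxE /= ?mulr1n ?mulr0n ?bE; by field.
  by apply: (PM) => //; apply: (PM).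
(* If the lower left entry vanishes, g is first multiplied by unip f 1. *)
move=> g; have [c0|/main //] := eqVneq (val g o1 o0) 0.
have -> : g = (unip sl2f (-1) * (unip sl2f 1 * g))%g.
  by rewrite mulgA -unipD ?sl2f_sqr // addNr unip0 ?sl2f_sqr // mul1g.
apply: (PM) => //; apply: main; rewrite /= val_unip ?sl2f_sqr //.
rewrite mulmx2E !mxE /= mulr0n mulr1n c0.
have := valP g; rewrite det2E c0 mulr0 subr0 => /eqP ad.
rewrite mulr0 addr0 add0r mulr1 mul1r; apply: contra_eq_neq ad => ->.
by rewrite mul0r eq_sym oner_eq0.
Qed.

End TwoByTwo.

(** * The derivative of a representation of SL_2 *)

Section RepresentationCalculus.
Variables (K : numClosedFieldType) (d : nat).
Hypothesis archi : forall x : K, exists n : nat, `|x| < n%:R.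
Variables (Psi : SL2 K -> 'M[K]_d) (L : 'M[K]_2 -> 'M[K]_d).

(** A matrix representation [Psi] of SL_2, together with its derivative [L],
    extended to all 2 x 2 matrices by ignoring the scalar part; it is enough to
    know the derivative along one-parameter unipotent groups. *)
Record differentiated : Prop := Differentiated {
  diff_repr : is_representation Psi;
  diff_linear : forall c A B, L (c *: A + B) = c *: L A + L B;
  diff_scalar : forall a, L a%:M = 0;
  diff_first_order : forall X, X *m X = 0 ->
    negligible (fun h => Psi (unip X h) - 1%:M - h *: L X) }.

Hypothesis D : differentiated.
Let Psi1 : Psi 1%g = 1%:M := (diff_repr D).1.
Let PsiM g h : Psi (g * h)%g = Psi g *m Psi h := (diff_repr D).2 g h.

Lemma lieD A B : L (A + B) = L A + L B.
Proof. by have := diff_linear D 1 A B; rewrite !scale1r. Qed.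

Lemma lie0 : L 0 = 0.
Proof. by apply: (addIr (L 0)); rewrite -lieD !add0r. Qed.

Lemma lieZ c A : L (c *: A) = c *: L A.
Proof. by have := diff_linear D c A 0; rewrite lie0 !addr0. Qed.

Lemma lieN A : L (- A) = - L A.
Proof. by rewrite -scaleN1r lieZ scaleN1r. Qed.

Lemma lieB A B : L (A - B) = L A - L B.
Proof. by rewrite lieD lieN. Qed.

Lemma lie_traceless A : L (traceless A) = L A.
Proof. by rewrite /traceless lieB (diff_scalar D) subr0. Qed.

Lemma lie_sum (I : Type) (r : seq I) (P : pred I) (F : I -> 'M[K]_2) :
  L (\sum_(i <- r | P i) F i) = \sum_(i <- r | P i) L (F i).
Proof. by elim/big_rec2: _ => [|i y1 y2 _ <-]; [exact: lie0|exact: lieD]. Qed.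

Lemma PsiV (g : SL2 K) : Psi g *m Psi g^-1%g = 1%:M.
Proof. by rewrite -PsiM mulgV Psi1. Qed.

Lemma Psi_unitmx (g : SL2 K) : Psi g \in unitmx.
Proof. by case/mulmx1_unit: (PsiV g). Qed.

Lemma invmx_Psi (g : SL2 K) : invmx (Psi g) = Psi g^-1%g.
Proof. by rewrite -[LHS]mulmx1 -(PsiV g) mulKmx // Psi_unitmx. Qed.

(** Square-zero matrices span sl_2: a linear statement about L need only be
    checked on them. *)
Lemma nilpotent_ind (P : 'M[K]_2 -> Prop) :
  (forall X, X *m X = 0 -> P X) -> (forall c A B, P A -> P B -> P (c *: A + B)) ->
  forall A, P (traceless A).
Proof.
move=> Pn Pl A.
pose n3 : 'M[K]_2 := mat2 1 (-1) 1 (-1).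
have n32 : n3 *m n3 = 0 by apply: mx2P; rewrite mulmx2E !mat2E !mxE; ring.
pose z := (A o0 o0 - A o1 o1) / 2.
have -> : traceless A = z *: n3 + ((A o0 o1 + z) *: sl2e K + ((A o1 o0 - z) *: sl2f K + 0)).
  apply: mx2P; rewrite /traceless !mxE /= ?mulr1n ?mulr0n ?mxtrace2E /z; by field.
apply: (Pl); first exact: Pn.
apply: (Pl); first by apply: Pn; exact: sl2e_sqr.
apply: (Pl); first by apply: Pn; exact: sl2f_sqr.
by apply: Pn; rewrite mulmx0.
Qed.

Lemma unipV (X : 'M[K]_2) (t : K) : X *m X = 0 -> ((unip X t)^-1)%g = unip X (- t).
Proof.
by move=> X2; apply: (mulgI (unip X t)); rewrite mulgV -unipD // subrr unip0.
Qed.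

Lemma unip_conj (g : SL2 K) X t : X *m X = 0 ->
  (g * unip X t = unip (val g *m X *m invmx (val g)) t * g)%g.
Proof.
move=> X2; have Y2 : val g *m X *m invmx (val g) *m (val g *m X *m invmx (val g)) = 0.
  by rewrite !mulmxA mulmxKV ?SL2_unitmx // -(mulmxA (val g)) X2 mulmx0 mul0mx.
apply/val_inj; rewrite /= !val_unip // mulmxDr mulmxDl mulmx1 mul1mx.
by congr (_ + _); rewrite -scalemxAr -scalemxAl mulmxKV ?SL2_unitmx.
Qed.

(** Comparison of the first-order terms of both sides of
    Psi(g) Psi(1 + t X) = Psi(1 + t g X g^-1) Psi(g), for X of square zero. *)
Lemma lie_equivariant (g : SL2 K) A :
  Psi g *m L A = L (val g *m A *m invmx (val g)) *m Psi g.
Proof.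
pose conj A := val g *m A *m invmx (val g).
have conjE (a : K) : conj a%:M = a%:M.
  by rewrite /conj mul_mx_scalar -scalemxAl mulmxV ?SL2_unitmx // scalemx1.
have -> : L (val g *m A *m invmx (val g)) = L (conj (traceless A)).
  rewrite /traceless /conj mulmxBr mulmxBl -!/(conj _) conjE lieB (diff_scalar D).
  by rewrite subr0.
rewrite -(lie_traceless A); move: A.
apply: (nilpotent_ind (P := fun Z => Psi g *m L Z = L (conj Z) *m Psi g))
  => [X X2|c A B HA HB]; last first.
  rewrite /conj mulmxDr mulmxDl -scalemxAr -scalemxAl !(diff_linear D).
  by rewrite mulmxDl mulmxDr -scalemxAl -scalemxAr HA HB.
have Y2 : conj X *m conj X = 0.
  by rewrite /conj !mulmxA mulmxKV ?SL2_unitmx // -(mulmxA (val g)) X2 mulmx0 mul0mx.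
have n1 := negligibleMl (- Psi g) (diff_first_order D X2).
have n2 := negligibleMr (Psi g) (diff_first_order D Y2).
have := negligibleD n1 n2.
rewrite (_ : (fun h => _) = (fun h => h *: (Psi g *m L X - L (conj X) *m Psi g))).
  by move/negligible_linear/eqP; rewrite subr_eq0 => /eqP.
apply/funext => h; rewrite mulNmx !mulmxBr !mulmxBl -PsiM unip_conj // PsiM.
rewrite mulmx1 mul1mx -scalemxAr -scalemxAl scalerBr.
rewrite -/(conj X).
move: (Psi (unip _ h) *m Psi g) (h *: (Psi g *m L X)) (h *: (L (conj X) *m Psi g)).
move: (Psi g) => A1 A2 A3 A4.
by apply/matrixP => i j; rewrite !mxE; ring.
Qed.

(** L is a morphism of Lie algebras: first-order terms of its equivariance under
    g = 1 + t Y, for Y of square zero. *)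
Lemma lie_bracket A B : L A *m L B - L B *m L A = L (A *m B - B *m A).
Proof.
have -> : L (A *m B - B *m A) = L (traceless A *m B - B *m traceless A).
  congr L; rewrite /traceless mulmxBl mulmxBr mul_scalar_mx mul_mx_scalar.
  by rewrite opprB addrA subrK.
rewrite -(lie_traceless A); move: A.
apply: (nilpotent_ind (P := fun Z => L Z *m L B - L B *m L Z = L (Z *m B - B *m Z)))
  => [Y Y2|c A1 A2 H1 H2]; last first.
  rewrite mulmxDl mulmxDr -scalemxAl -scalemxAr !(diff_linear D).
  rewrite mulmxDl mulmxDr -scalemxAl -scalemxAr opprD addrACA -scalerBr H1 H2.
  by rewrite -(diff_linear D) scalerBr opprD addrACA.
apply/eqP; rewrite -subr_eq0; apply/eqP/negligible_linear.
pose o h := Psi (unip Y h) - 1%:M - h *: L Y.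
have no : negligible o := diff_first_order D Y2.
have key h : h *: (L Y *m L B - L B *m L Y - L (Y *m B - B *m Y)) =
    (- o h *m L B + L B *m o h) + (h *: (L (Y *m B - B *m Y) *m o h) +
     (h ^+ 2 *: (L (Y *m B - B *m Y) *m L Y - L (Y *m B *m Y)) +
     (h ^+ 2 *: - (L (Y *m B *m Y) *m o h) + h ^+ 3 *: - (L (Y *m B *m Y) *m L Y)))).
  have := lie_equivariant (unip Y h) B.
  have -> : val (unip Y h) *m B *m invmx (val (unip Y h)) =
      B + h *: (Y *m B - B *m Y) - h ^+ 2 *: (Y *m B *m Y).
    have -> : invmx (val (unip Y h)) = val ((unip Y h)^-1)%g by [].
    rewrite unipV // !val_unip // scaleNr mulmxDl mul1mx mulmxBr mulmx1 !mulmxDl.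
    rewrite -!scalemxAl -!scalemxAr scalerA -expr2 scalerBr opprD !addrA.
    by congr (_ - _); rewrite addrAC.
  have PE : Psi (unip Y h) = 1%:M + h *: L Y + o h.
    by rewrite /o -(addrA (Psi _)) -opprD [RHS]addrC subrK.
  rewrite PE lieB lieD !lieZ.
  move: (o h) (L Y) (L B) (L (Y *m B - B *m Y)) (L (Y *m B *m Y)) => O E U C Q.
  rewrite !(mulmxDl, mulmxDr, mulmxBl, mulmxBr, mulNmx, mul1mx, mulmx1).
  rewrite -!(scalemxAl, scalemxAr).
  move: (E *m U) (U *m E) (O *m U) (U *m O) (C *m E) (C *m O) (Q *m E) (Q *m O).
  move=> EU UE OU UO CE CO QE QO /matrixP H; apply/matrixP => i j; move: (H i j).
  rewrite !mxE => Hij; apply/eqP; rewrite -subr_eq0; apply/eqP.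
  move/eqP: Hij; rewrite -subr_eq0 => /eqP <-; ring.
rewrite [X in negligible X](funext key).
have noN : negligible (fun h => - o h).
  by move=> eps e0; have := no eps e0; apply: filterS => h oh i j; rewrite mxE normrN.
apply: negligibleD.
  by apply: negligibleD; [apply: (negligibleMr _ noN)|apply: negligibleMl].
apply: negligibleD; first by apply: negligibleZ; apply: negligibleMl.
apply: negligibleD; first exact: negligible_pow.
apply: negligibleD; last exact: negligible_pow.
have -> : (fun h => h ^+ 2 *: - (L (Y *m B *m Y) *m o h)) =
    (fun h => h *: (h *: (- L (Y *m B *m Y) *m o h))).
  by apply/funext => h; rewrite scalerA mulNmx.
by apply: negligibleZ; apply: negligibleZ; apply: negligibleMl.
Qed.

(** On vectors killed by a power of L X, the unipotent 1 + t X acts by the exponential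
    series of t L X. *)
Lemma Psi_unip_exp D0 X (y : 'cV[K]_d) (t : K) : X *m X = 0 ->
  iter D0.+2 (mulmx (L X)) y = 0 ->
  Psi (unip X t) *m y = exp_trunc (L X) D0.+2 t y.
Proof.
move=> X2; apply: (@one_param_exp _ _ archi (fun h => Psi (unip X h))).
- by rewrite unip0.
- by move=> s h; rewrite unipD.
- exact: diff_first_order.
Qed.

End RepresentationCalculus.

(** * Holomorphic representations *)

Section TangentDifferentiated.
Variable K : numClosedFieldType.
Local Open Scope classical_set_scope.
Local Open Scope ring_scope.

Lemma mx_norm_entry m n (A : 'M[K]_(m, n)) i j : `|A i j| <= `|A|.
Proof.
rewrite [leRHS]/Num.norm /= mx_normE.
rewrite [leLHS](_ : _ = (`|A i j|%:nng)%:num) // num_le.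
exact: (le_bigmax _ (fun ij => `|A ij.1 ij.2|%:nng) (i, j)).
Qed.

(** The tangent representation in the sense of differentials of local extensions
    supplies the first-order expansions along unipotents: 1 + t X stays in SL_2 when
    X has square zero. *)
Lemma tangent_differentiated d (Psi : SL2 K -> 'M[K]_d) (rho : sl2 K -> 'M[K]_d) :
  is_representation Psi -> is_tangent_representation Psi rho ->
  differentiated Psi (fun Z => rho (sl2_of Z)).
Proof.
move=> hPsi [Phi [[dPhi ePhi] rhoE]]; split => //.
- move=> c A B; rewrite !rhoE.
  have -> : val (sl2_of (c *: A + B)) = c *: val (sl2_of A) + val (sl2_of B).
    by rewrite /= traceless_linear.
  by rewrite linearP.
- move=> a; rewrite rhoE.
  have -> : val (sl2_of (a%:M : 'M[K]_2)) = 0 by rewrite /= traceless_scalar.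
  by rewrite linear0.
move=> X X2; have [tX _] := sqr0_tr_det X2.
have d1 : differentiable Phi (1%:M : 'M[K]_2) by exact: (nbhs_singleton dPhi).
have E1 : Phi 1%:M = 1%:M.
  have /(_ 1%g) <- // := nbhs_singleton ePhi.
  by case: hPsi.
have ext : \forall h \near (0 : K), forall g : SL2 K, val g = h *: X + 1%:M ->
    Psi g = Phi (h *: X + 1%:M).
  have /nbhs_ballP[e /= e0 Pe] := ePhi.
  pose c := \sum_i \sum_j `|X i j| + 1.
  have c0 : 0 < c by rewrite ltr_wpDl // sumr_ge0 // => i _; apply: sumr_ge0.
  apply/nbhs_ballP; exists (e / c); first by rewrite /= divr_gt0.
  move=> h; rewrite /ball /= sub0r normrN ltr_pdivlMr // => hc.
  apply: Pe.
  split => // i j.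
  rewrite /ball /= !mxE opprD addrCA subrr addr0 normrN normrM.
  apply: le_lt_trans hc; rewrite ler_wpM2l // /c (bigD1 i) //= (bigD1 j) //= -!addrA.
  rewrite lerDl !addr_ge0 ?sumr_ge0 // => l _; exact: sumr_ge0.
have := derivable_nbhs (diff_derivable (v := X) d1) => /eqaddoP H.
move=> eps eps0; have Heps := H _ eps0.
near=> h => i j.
have -> : Psi (unip X h) = Phi (h *: X + 1%:M).
  have eh : forall g : SL2 K, val g = h *: X + 1%:M -> Psi g = Phi (h *: X + 1%:M).
    by near: h.
  by apply: eh; rewrite val_unip // addrC.
have : `|Phi (h *: X + 1%:M) - (1%:M + h *: 'd Phi (1%:M : 'M[K]_2) X)| <= eps * `|h|.
  rewrite -(deriveE _ d1) -[in X in _ - (X + _)]E1.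
  by near: h; exact: Heps.
have -> : rho (sl2_of X) = 'd Phi (1%:M : 'M[K]_2) X.
  by rewrite rhoE /= traceless_id.
rewrite opprD addrA; apply: le_trans; exact: mx_norm_entry.
Unshelve. all: by end_near. Qed.

End TangentDifferentiated.

Section ComplexCase.
Variable R : realType.
Local Notation C := R[i].

Lemma complex_archi (x : C) : exists n : nat, `|x| < n%:R.
Proof.
exists (Num.Def.archi_bound (Num.sqrt ((complex.Re x) ^+ 2 + (complex.Im x) ^+ 2))).
rewrite normc_def -(rmorph_nat (real_complex R)) ltcR.
exact/archi_boundP/sqrtr_ge0.
Qed.

End ComplexCase.

(** * Weight strings *)

Section HighestWeight.
Variables (K : numClosedFieldType) (d : nat).
Hypothesis archi : forall x : K, exists n : nat, `|x| < n%:R.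
Variables (Psi : SL2 K -> 'M[K]_d) (L : 'M[K]_2 -> 'M[K]_d).
Hypothesis D : differentiated Psi L.
Hypothesis irrPsi : irreducible Psi.

Let E := L (sl2e K).
Let F := L (sl2f K).
Let H := L (sl2h K).

Lemma bracket_ef : E *m F - F *m E = H.
Proof.
rewrite (lie_bracket D); congr L.
by apply: mx2P; rewrite !mxE !sum2 !mxE /=; ring.
Qed.

Lemma bracket_he : H *m E - E *m H = 2 *: E.
Proof.
rewrite (lie_bracket D) -(lieZ D); congr L.
by apply: mx2P; rewrite !mxE !sum2 !mxE /=; ring.
Qed.

Lemma bracket_hf : H *m F - F *m H = - 2 *: F.
Proof.
rewrite (lie_bracket D) -(lieZ D); congr L.
by apply: mx2P; rewrite !mxE !sum2 !mxE /=; ring.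
Qed.

Lemma weight_shift (A : 'M[K]_d) c (v : 'cV[K]_d) lam :
  H *m A - A *m H = c *: A -> H *m v = lam *: v ->
  H *m (A *m v) = (lam + c) *: (A *m v).
Proof.
move=> HA Hv; rewrite mulmxA -(subrK (A *m H) (H *m A)) HA mulmxDl -mulmxA Hv.
by rewrite -scalemxAl -scalemxAr -scalerDl addrC.
Qed.

(** A vector whose iterates have pairwise distinct weights is eventually killed. *)
Lemma weight_nilpotent (A : 'M[K]_d) c (v : 'cV[K]_d) lam : c != 0 ->
  H *m A - A *m H = c *: A -> H *m v = lam *: v -> v != 0 ->
  exists n, iter n.+1 (mulmx A) v = 0 /\ iter n (mulmx A) v != 0.
Proof.
move=> c0 HA Hv v0.
have Hk k : H *m iter k (mulmx A) v = (lam + c *+ k) *: iter k (mulmx A) v.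
  elim: k => [|k IHk] /=; first by rewrite addr0.
  by rewrite (weight_shift HA IHk) mulrSr addrA.
have [k kP] : exists k, iter k (mulmx A) v == 0.
  suff /hasP[k _ kP] : has (fun k => iter k (mulmx A) v == 0) (iota 0 d.+1) by exists k.
  apply: contraT => /hasPn nz.
  have : (size [seq (lam + c *+ k)%R | k <- iota 0 d.+1] < size (char_poly H^T))%N.
    apply: max_poly_roots; first by rewrite -size_poly_eq0 size_char_poly.
      apply/allP => a /mapP[k ki ->]; rewrite -eigenvalue_root_char.
      apply/eigenvalueP; exists (iter k (mulmx A) v)^T.
        by rewrite -trmx_mul Hk linearZ.
      by rewrite trmx_eq0; apply: nz.
    rewrite map_inj_uniq ?iota_uniq // => k l /addrI/eqP.
    by rewrite -(mulr_natr c k) -(mulr_natr c l) (inj_eq (mulfI c0)) eqr_nat => /eqP.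
  by rewrite size_map size_iota size_char_poly ltnn.
have [n nP nmin] := ex_minnP (ex_intro (fun k => iter k (mulmx A) v == 0) k kP).
case: n nP nmin => [|n] nP nmin; first by rewrite /= (negbTE v0) in nP.
exists n; split; first exact/eqP.
by apply/negP => /nmin; rewrite ltnn.
Qed.

Lemma highest_weight_vector : exists mu (x : 'cV[K]_d),
  [/\ x != 0, E *m x = 0 & H *m x = mu *: x].
Proof.
have [a /eigenvalueP[u uH u0]] := eigenvalue_closed H^T irrPsi.1.
have Hv : H *m u^T = a *: u^T by rewrite -[H]trmxK -trmx_mul uH linearZ.
have v0 : u^T != 0 by rewrite trmx_eq0.
have two : (2 : K) != 0 by rewrite pnatr_eq0.
have [n [En nz]] := weight_nilpotent two bracket_he Hv v0.
have Hk : exists mu, H *m iter n (mulmx E) u^T = mu *: iter n (mulmx E) u^T.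
  elim: n {En nz} => [|n [mu IHn]]; first by exists a.
  by exists (mu + 2); rewrite /= (weight_shift bracket_he IHn).
by case: Hk => mu Hmu; exists mu, (iter n (mulmx E) u^T).
Qed.

(** The weight strings spanning an irreducible representation, normalized so that
    [e] and [f] act with integral coefficients. *)
Lemma weight_string : exists n (b : nat -> 'cV[K]_d),
  [/\ b 0%N != 0,
      forall j, (j <= n)%N -> E *m b j = j%:R *: b j.-1 &
      forall j, (j <= n)%N -> F *m b j = (n - j)%:R *: b j.+1].
Proof.
have [mu [x [x0 Ex Hx]]] := highest_weight_vector.
have two : - (2 : K) != 0 by rewrite oppr_eq0 pnatr_eq0.
have [n [Fn nz]] := weight_nilpotent two bracket_hf Hx x0.
pose y j := iter j (mulmx F) x.
have Hy j : H *m y j = (mu - 2 *+ j) *: y j.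
  elim: j => [|j IHj]; first by rewrite mulr0n subr0.
  rewrite /y /= (weight_shift bracket_hf IHj); congr (_ *: _).
  by rewrite -(mulr_natr 2 j) -(mulr_natr 2 j.+1) -natr1; ring.
have Ey j : E *m y j.+1 = (j.+1%:R * (mu - j%:R)) *: y j.
  elim: j => [|j IHj].
    rewrite /y /= mulmxA -(subrK (F *m E) (E *m F)) bracket_ef mulmxDl Hx.
    by rewrite -mulmxA Ex mulmx0 addr0 subr0 mul1r.
  rewrite [y _]/(F *m y j.+1) mulmxA -(subrK (F *m E) (E *m F)) bracket_ef mulmxDl Hy.
  rewrite -mulmxA IHj -scalemxAr -[F *m y j]/(y j.+1) -scalerDl; congr (_ *: _).
  by rewrite -(mulr_natr 2 j.+1) -!natr1; ring.
(* E F^(n+1) x = 0 determines the highest weight. *)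
have mun : mu = n%:R.
  have := Ey n; rewrite [y n.+1]Fn mulmx0 => /esym/eqP.
  by rewrite scaler_eq0 (negbTE nz) orbF mulf_eq0 pnatr_eq0 subr_eq0 => /eqP.
have fn k : (k`!%:R : K) != 0 by rewrite pnatr_eq0 -lt0n fact_gt0.
(* With y_j = F^j x, the vector b_j is (n - j)! / n! times y_j. *)
exists n, (fun j => ((n - j)`!%:R / n`!%:R) *: y j); split.
- by rewrite subn0 divff // scale1r.
- case=> [|j] jn /=; first by rewrite -scalemxAr Ex scale0r scaler0.
  rewrite -scalemxAr Ey !scalerA; congr (_ *: _).
  rewrite mun -(subnSK jn) factS natrM -natrB ?(ltnW jn) // -(subnSK jn).
  by ring.
move=> j; rewrite leq_eqVlt => /orP[/eqP->|jn].
  by rewrite subnn scale0r -scalemxAr [F *m _]Fn scaler0.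
rewrite -scalemxAr -[F *m y j]/(y j.+1) scalerA; congr (_ *: _).
by rewrite -(subnSK jn) factS natrM mulrA.
Qed.

(** The vectors of a weight string are independent: E^j kills all those before b_j
    and maps b_j to a nonzero multiple of b_0. *)
Lemma string_injective n (b : nat -> 'cV[K]_d) : b 0%N != 0 ->
  (forall j, (j <= n)%N -> E *m b j = j%:R *: b j.-1) ->
  forall c : 'cV[K]_n.+1, (\sum_(j < n.+1) c j 0 *: b j) = 0 -> c = 0.
Proof.
move=> b0 bE c c0.
have iterE k j : (j <= n)%N -> iter k (mulmx E) (b j) = (j ^_ k)%:R *: b (j - k)%N.
  move=> jn; elim: k => [|k IHk] /=; first by rewrite ffactn0 scale1r subn0.
  rewrite IHk -scalemxAr bE ?(leq_trans (leq_subr _ _)) // scalerA -natrM -ffactnSr.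
  by rewrite subnS.
apply/eqP; apply: contraT => /matrix0Pn[j0 [k0 cj0]].
rewrite ord1 in cj0; pose j := [arg max_(j > j0 | c j 0 != 0) (j : nat)].
have [cj jmax] : c j 0 != 0 /\ forall i, c i 0 != 0 -> (i <= j)%N.
  by rewrite /j; case: arg_maxnP => // i ci ih; split.
have := congr1 (iter j (mulmx E)) c0.
rewrite -[iter j _ 0](_ : 0 = _); last by elim: (nat_of_ord j) => //= k <-; rewrite mulmx0.
rewrite iter_mulmx_sum (bigD1 j) //= big1 => [|i ij].
  rewrite addr0 iterE ?leq_ord // subnn ffactnn => /eqP.
  rewrite !scaler_eq0 (negbTE cj) (negbTE b0) pnatr_eq0.
  by rewrite eqn0Ngt fact_gt0.
have [->|ci] := eqVneq (c i 0) 0; first by rewrite scale0r.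
by rewrite iterE ?leq_ord // ffact_small ?scale0r ?scaler0 // ltn_neqAle ij jmax.
Qed.

End HighestWeight.

(** * Symmetric powers *)

Section SymmetricPower.
Variables (K : numClosedFieldType) (d : nat).
Hypothesis archi : forall x : K, exists n : nat, `|x| < n%:R.
Variables (Psi : SL2 K -> 'M[K]_d) (L : 'M[K]_2 -> 'M[K]_d).
Hypothesis D : differentiated Psi L.
Variables (n : nat) (b : nat -> 'cV[K]_d).
Hypothesis bE : forall j, (j <= n)%N -> L (sl2e K) *m b j = j%:R *: b j.-1.
Hypothesis bF : forall j, (j <= n)%N -> L (sl2f K) *m b j = (n - j)%:R *: b j.+1.

(** The product of the coordinates of the [w k], the second ones for [k] in [A]
    and the first ones for the other indices. *)
Definition monomial_at (w : 'I_n -> 'cV[K]_2) (A : {set 'I_n}) : K :=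
  \prod_k w k (if k \in A then o1 else o0) 0.

(** The n-linear symmetric map from the n-th tensor power of K^2 whose value at a
    tuple of standard basis vectors, j of them being the second one, is [b j]. *)
Definition sym_map (w : 'I_n -> 'cV[K]_2) : 'cV[K]_d :=
  \sum_(A : {set 'I_n}) monomial_at w A *: b #|A|.

Lemma monomial_upd w k x (A : {set 'I_n}) :
  monomial_at (upd w k x) A = x (if k \in A then o1 else o0) 0 *
    \prod_(l | l != k) w l (if l \in A then o1 else o0) 0.
Proof.
rewrite /monomial_at (bigD1 k) //= upd_same; congr (_ * _).
by apply: eq_bigr => l lk; rewrite upd_other.
Qed.

Lemma monomialD1 w k (A : {set 'I_n}) :
  monomial_at w A = w k (if k \in A then o1 else o0) 0 *
    \prod_(l | l != k) w l (if l \in A then o1 else o0) 0.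
Proof. by rewrite -monomial_upd upd_id. Qed.

Lemma sym_map_multilinear : multilinear sym_map.
Proof.
move=> v i c x y; rewrite /sym_map scaler_sumr -big_split /=.
apply: eq_bigr => A _; rewrite scalerA -scalerDl; congr (_ *: _).
by rewrite !monomial_upd !mxE mulrDl mulrA.
Qed.

Lemma sum_set_remove (V : nmodType) (G : 'I_n -> {set 'I_n} -> V) :
  \sum_l \sum_(A : {set 'I_n} | l \notin A) G l A =
  \sum_(B : {set 'I_n}) \sum_(l in B) G l (B :\ l).
Proof.
rewrite [RHS](exchange_big_dep xpredT) //=; apply: eq_bigr => l _.
rewrite (reindex_onto (fun B : {set 'I_n} => B :\ l) (fun A => l |: A)); last first.
  by move=> A lA; rewrite setU1K.
apply: eq_bigl => B; rewrite !inE eqxx /=.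
apply/eqP/idP => [<-|lB]; first by rewrite !inE eqxx.
by rewrite finset.setD1K.
Qed.

Lemma monomial_setD1 (w : 'I_n -> 'cV[K]_2) l (B : {set 'I_n}) : l \in B ->
  w l o0 0 * \prod_(i | i != l) w i (if i \in B then o1 else o0) 0 =
  monomial_at w (B :\ l).
Proof.
move=> lB; rewrite (monomialD1 _ l) !inE eqxx /=; congr (_ * _).
by apply: eq_bigr => i il; rewrite !inE il.
Qed.

Lemma monomial_setU1 (w : 'I_n -> 'cV[K]_2) l (B : {set 'I_n}) : l \notin B ->
  w l o1 0 * \prod_(i | i != l) w i (if i \in B then o1 else o0) 0 =
  monomial_at w (l |: B).
Proof.
move=> lB; rewrite (monomialD1 _ l) !inE eqxx /=; congr (_ * _).
by apply: eq_bigr => i il; rewrite !inE (negbTE il).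
Qed.

Lemma card_set_le (A : {set 'I_n}) : (#|A| <= n)%N.
Proof. by rewrite -[X in (_ <= X)%N]card_ord max_card. Qed.

Lemma sym_map_e w :
  L (sl2e K) *m sym_map w = \sum_k sym_map (upd w k (sl2e K *m w k)).
Proof.
transitivity (\sum_(l < n) \sum_(A : {set 'I_n} | l \notin A)
    monomial_at w (l |: A) *: b #|A|); last first.
  apply: eq_bigr => l _; rewrite /sym_map big_mkcond /=; apply: eq_bigr => A _.
  rewrite monomial_upd !mulmx2E; case: ifP => lA.
    by rewrite -(monomial_setU1 w lA) (negbTE lA) !mat2E mul0r mul1r add0r.
  by move/negbFE: lA => ->; rewrite !mat2E !mul0r addr0 mul0r scale0r.
rewrite sum_set_remove /sym_map mulmx_sumr; apply: eq_bigr => A _.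
rewrite -scalemxAr bE ?card_set_le // scalerA.
transitivity (\sum_(l in A) monomial_at w A *: b #|A|.-1).
  by rewrite sumr_const scalerMnl mulr_natr.
by apply: eq_bigr => l lA; rewrite finset.setD1K // [in LHS](cardsD1 l A) lA.
Qed.

Lemma sym_map_f w :
  L (sl2f K) *m sym_map w = \sum_k sym_map (upd w k (sl2f K *m w k)).
Proof.
transitivity (\sum_(A : {set 'I_n}) \sum_(l in A) monomial_at w (A :\ l) *: b #|A|).
  transitivity (\sum_(A : {set 'I_n}) \sum_(l in A)
      monomial_at w (A :\ l) *: b #|A :\ l|.+1); last first.
    by apply: eq_bigr => A _; apply: eq_bigr => l lA; rewrite [in RHS](cardsD1 l A) lA.
  rewrite -(sum_set_remove (fun l A => monomial_at w A *: b #|A|.+1)).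
  rewrite (exchange_big_dep xpredT) //= /sym_map mulmx_sumr; apply: eq_bigr => A _.
  rewrite sumr_const -scalemxAr bF ?card_set_le // scalerA.
  rewrite scalerMnl -(mulr_natr (monomial_at w A)); congr ((_ * _%:R) *: _).
  have nA : (#|A| + #|~: A|)%N = n by rewrite cardsC card_ord.
  rewrite -[LHS](_ : #|~: A| = _); last by rewrite -[X in (X - _)%N]nA addKn.
  by apply: eq_card => l; rewrite !inE.
rewrite (exchange_big_dep xpredT) //=; apply: eq_bigr => l _.
rewrite /sym_map big_mkcond /=; apply: eq_bigr => A _.
rewrite monomial_upd !mulmx2E; case: ifP => lA.
  by rewrite -(monomial_setD1 w lA) !mat2E mul0r mul1r addr0.
by rewrite !mat2E !mul0r addr0 mul0r scale0r.
Qed.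

Lemma string_weight j : (j <= n)%N -> L (sl2h K) *m b j = (n%:R - j%:R - j%:R) *: b j.
Proof.
move=> jn; rewrite -(bracket_ef D) mulmxBl -!mulmxA bF // bE // -!scalemxAr.
rewrite -natrB //; move: jn; case: j => [|j] jn.
  rewrite scale0r !subr0 subn0; case: (n) bE => [|m] bEm; first by rewrite !scale0r.
  by rewrite bEm // scalerA mulr1.
rewrite bF ?(ltnW jn) //= scalerA.
move: jn; rewrite leq_eqVlt => /orP[/eqP <-|jn].
  by rewrite subnn !scale0r subSnn mulr1 !sub0r scaleNr.
rewrite bE // scalerA -scalerBl -natrM -natrM; congr (_ *: _).
rewrite -(subnSK (ltnW jn)); move: (n - j.+1)%N => m; rewrite !natrM -!natr1; ring.
Qed.

Lemma sym_map_h w :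
  L (sl2h K) *m sym_map w = \sum_k sym_map (upd w k (sl2h K *m w k)).
Proof.
under [RHS]eq_bigr => k _ do rewrite /sym_map.
rewrite exchange_big /sym_map mulmx_sumr; apply: eq_bigr => A _.
rewrite -scalemxAr string_weight ?card_set_le // scalerA -scaler_suml; congr (_ *: _).
rewrite (bigID (mem A)) /=.
rewrite (eq_bigr (fun=> - monomial_at w A)); last first.
  move=> k kA; rewrite monomial_upd (monomialD1 w k) kA mulmx2E !mat2E mul0r add0r.
  by rewrite mulN1r mulNr.
rewrite [X in _ = _ + X](eq_bigr (fun=> monomial_at w A)); last first.
  move=> k /negbTE kA; rewrite monomial_upd (monomialD1 w k) kA mulmx2E !mat2E.
  by rewrite mul0r addr0 mul1r.
rewrite !sumr_const mulNrn -!(mulr_natr (monomial_at w A)).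
have -> : #|[predC A]| = (n - #|A|)%N.
  have nA : (#|A| + #|[predC A]|)%N = n by rewrite cardC card_ord.
  by rewrite -[X in (X - _)%N]nA addKn.
rewrite natrB ?card_set_le //; ring.
Qed.

(** Infinitesimal equivariance. *)
Lemma sym_map_lie w (Z : 'M[K]_2) : \tr Z = 0 ->
  L Z *m sym_map w = \sum_k sym_map (upd w k (Z *m w k)).
Proof.
move=> Z0; rewrite (sl2_basis Z0).
move: (Z o0 o1) (Z o1 o0) (Z o0 o0) => x y z.
rewrite !(lieD D) !(lieZ D) !mulmxDl -!scalemxAl sym_map_e sym_map_f sym_map_h.
rewrite !scaler_sumr -!big_split /=; apply: eq_bigr => k _.
have ml := sym_map_multilinear.
rewrite !mulmxDl -!scalemxAl !(multilinearD ml) !(multilinearZ ml) //.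
Qed.

(** Since X has square zero, it acts at most once in each slot; the k! orders in which
    it reaches k given slots contribute equally. *)
Lemma sym_map_iter w (X : 'M[K]_2) k : X *m X = 0 ->
  iter k (mulmx (L X)) (sym_map w) = k`!%:R *: \sum_(A : {set 'I_n} | #|A| == k)
     sym_map (fun l => if l \in A then X *m w l else w l).
Proof.
move=> X2; have [tX _] := sqr0_tr_det X2.
elim: k => [|k IHk] /=.
  rewrite (big_pred1 finset.set0) => [|A]; last by rewrite cards_eq0.
  by rewrite scale1r; congr sym_map; apply/funext => l; rewrite inE.
rewrite IHk -scalemxAr mulmx_sumr factS mulnC natrM -scalerA; congr (_ *: _).
pose S (A : {set 'I_n}) := sym_map (fun l => if l \in A then X *m w l else w l).
transitivity (\sum_(l < n) \sum_(A : {set 'I_n} | l \notin A)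
   (if #|A| == k then S (l |: A) else 0)).
  rewrite [RHS](exchange_big_dep xpredT) //= big_mkcond; apply: eq_bigr => A _.
  case Ak: (#|A| == k); last by rewrite big1.
  rewrite sym_map_lie // [RHS]big_mkcond /=; apply: eq_bigr => l _.
  case lA: (l \in A).
    by rewrite mulmxA X2 mul0mx (multilinear0 sym_map_multilinear).
  rewrite /S; congr sym_map; apply/funext => i; rewrite /upd !inE.
  by case: eqP => [->|] //.
rewrite sum_set_remove scaler_sumr [RHS]big_mkcond /=; apply: eq_bigr => B _.
transitivity (\sum_(l in B) if #|B| == k.+1 then S B else 0).
  apply: eq_bigr => l lB; rewrite finset.setD1K // (cardsD1 l B) lB //.
rewrite sumr_const; case: eqP => [->|_]; last by rewrite mul0rn.
by rewrite scaler_nat.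
Qed.

(** Equivariance under the group, by exponentiation along the elementary unipotents,
    which generate SL_2. *)
Lemma sym_map_equivariant (g : SL2 K) w :
  Psi g *m sym_map w = sym_map (fun k => val g *m w k).
Proof.
have unipP (X : 'M[K]_2) t v : X *m X = 0 ->
    Psi (unip X t) *m sym_map v = sym_map (fun k => val (unip X t) *m v k).
  move=> X2; have big_k (A : {set 'I_n}) : (#|A| < n.+2)%N.
    by rewrite ltnS (leq_trans (card_set_le A)).
  rewrite (Psi_unip_exp archi D (D0 := n)) //; last first.
    rewrite sym_map_iter // big_pred0 ?scaler0 // => A.
    by apply/negbTE; rewrite neq_ltn big_k.
  rewrite /exp_trunc val_unip //.
  have -> : (fun k => (1%:M + t *: X) *m v k) = (fun k => v k + t *: (X *m v k)).
    by apply/funext => k; rewrite mulmxDl mul1mx scalemxAl.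
  rewrite (multilinear_subsets sym_map_multilinear).
  rewrite [RHS](partition_big (fun A : {set 'I_n} => Ordinal (big_k A)) xpredT) //=.
  apply: eq_bigr => k _; rewrite sym_map_iter // scalerA divfK ?pnatr_eq0 -?lt0n ?fact_gt0 //.
  by rewrite scaler_sumr; apply: eq_big => [A|A /eqP ->].
elim/SL2_elementary_ind: g w => [t|t|g h IHg IHh] w.
- exact/unipP/sl2e_sqr.
- exact/unipP/sl2f_sqr.
rewrite (diff_repr D).2 -mulmxA IHh IHg; congr sym_map.
by apply/funext => k; rewrite /= mulmxA.
Qed.

End SymmetricPower.

(** * Polynomial identities along the diagonal *)

Section PolynomialIdentity.
Variable K : numFieldType.

Lemma poly_eval0 (p : {poly K}) : (forall s, p.[s] = 0) -> p = 0.
Proof.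
move=> p0; apply/eqP; apply: contraT => nz.
have := @max_poly_roots _ p [seq (k%:R : K) | k <- iota 0 (size p)] nz.
rewrite size_map size_iota ltnn => -> //.
  by apply/allP => x _; rewrite rootE p0.
rewrite map_inj_uniq ?iota_uniq // => i j /eqP.
by rewrite eqr_nat => /eqP.
Qed.

Lemma poly_eval_inj (p q : {poly K}) : (forall s, p.[s] = q.[s]) -> p = q.
Proof.
move=> pq; apply/eqP; rewrite -subr_eq0; apply/eqP/poly_eval0 => s.
by rewrite hornerD hornerN pq subrr.
Qed.

(** Two multilinear forms with the same diagonal have the same first derivative
    along the diagonal. *)
Lemma diagonal_derivative (I : finType) (V : lmodType K) (h h' : (I -> V) -> K^o) :
  multilinear h -> multilinear h' -> (forall w, h (fun=> w) = h' (fun=> w)) ->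
  forall w z, \sum_k h (upd (fun=> w) k z) = \sum_k h' (upd (fun=> w) k z).
Proof.
move=> hml hml' hh w z.
pose P (g : (I -> V) -> K^o) : {poly K} := \sum_(A : {set I})
  (g (fun k => if k \in A then z else w) : K) *: 'X^#|A|.
have PE g s : multilinear g -> (P g).[s] = g (fun=> w + s *: z).
  move=> gml; rewrite (multilinear_subsets gml (fun=> w) (fun=> z)) horner_sum.
  by apply: eq_bigr => A _; rewrite hornerZ hornerXn mulrC.
have P1 g : (P g)`_1 = \sum_k g (upd (fun=> w) k z).
  rewrite coef_sum (bigID (fun A : {set I} => #|A| == 1%N)) /= [X in _ + X]big1.
    rewrite addr0 big_cards1; apply: eq_bigr => k _.
    rewrite coefZ coefXn cards1 mulr1; congr g; apply/funext => l.
    by rewrite /upd inE.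
  by move=> A /negbTE nA; rewrite coefZ coefXn eq_sym nA mulr0.
have E : P h = P h' by apply: poly_eval_inj => s; rewrite !PE // hh.
by rewrite -P1 -P1 E.
Qed.

End PolynomialIdentity.

(** * Irreducible representations are symmetric powers *)

Section DualRepresentation.
Variables (K : numClosedFieldType) (d : nat).
Variables (Psi : SL2 K -> 'M[K]_d) (L : 'M[K]_2 -> 'M[K]_d).

(** The dual representation. *)
Lemma differentiated_dual : differentiated Psi L ->
  differentiated (fun g => (Psi g^-1%g)^T) (fun Z => - (L Z)^T).
Proof.
move=> D; split.
- split; first by rewrite invg1 (diff_repr D).1 trmx1.
  by move=> g h; rewrite invgM (diff_repr D).2 trmx_mul.
- move=> c A B; rewrite (diff_linear D) linearD linearZ /= opprD scalerN.
  by [].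
- by move=> a; rewrite (diff_scalar D) trmx0 oppr0.
move=> X X2; have NX2 : (- X) *m (- X) = 0 by rewrite mulNmx mulmxN opprK.
have := negligible_trmx (diff_first_order D NX2).
rewrite (_ : (fun h => _) = (fun h => (Psi (unip X h)^-1%g)^T - 1%:M - h *: - (L X)^T)) //.
apply/funext => h; rewrite unipV // !linearB /= trmx1 linearZ /= (lieN D) linearN /=.
congr (_^T - _ - _); congr Psi; apply/val_inj.
by rewrite !val_unip // scalerN scaleNr.
Qed.

End DualRepresentation.

Section Model.
Variable K : numClosedFieldType.

(** The invariant symplectic form on K^2. *)
Definition br (v w : 'cV[K]_2) : K := v o0 0 * w o1 0 - v o1 0 * w o0 0.

Section SymMapDiagonal.
Variables (n d : nat) (b : nat -> 'cV[K]_d).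

Lemma monomial_diag (w : 'cV[K]_2) (A : {set 'I_n}) :
  monomial_at (fun=> w) A = w o1 0 ^+ #|A| * w o0 0 ^+ (n - #|A|).
Proof.
rewrite /monomial_at (bigID (mem A)) /=; congr (_ * _).
  rewrite (eq_bigr (fun=> w o1 0)) ?prodr_const // => k kA.
  by rewrite kA.
rewrite (eq_bigr (fun=> w o0 0)) ?prodr_const => [|k /negbTE-> //].
congr (_ ^+ _); have nA : (#|A| + #|[predC A]|)%N = n by rewrite cardC card_ord.
by rewrite -[X in (X - _)%N]nA addKn.
Qed.

(** The diagonal values of [sym_map] span the same space as the [b j]. *)
Lemma sym_map_span p (M : 'M[K]_(p, d)) :
  (forall w, M *m sym_map b (fun _ : 'I_n => w) = 0) ->
  forall j, (j <= n)%N -> M *m b j = 0.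
Proof.
move=> M0 j jn; apply/matrixP => i k; rewrite ord1 [RHS]mxE {k}.
pose P : {poly K} := \sum_(A : {set 'I_n}) (M *m b #|A|) i 0 *: 'X^#|A|.
have /(congr1 (fun p : {poly K} => p`_j)) : P = 0.
  apply: poly_eval0 => s; pose w : 'cV[K]_2 := \col_k (if k == o0 then 1 else s).
  have /matrixP/(_ i 0) := M0 w.
  rewrite /sym_map mulmx_sumr summxE [X in _ = X]mxE => <-; rewrite horner_sum.
  apply: eq_bigr => A _; rewrite hornerZ hornerXn -scalemxAr !mxE monomial_diag !mxE /=.
  by rewrite expr1n mulr1 mulrC.
rewrite coef0 coef_sum (bigID (fun A : {set 'I_n} => #|A| == j)) /= [X in _ + X]big1.
  rewrite addr0 (eq_bigr (fun=> (M *m b j) i 0)) => [|A /eqP ->].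
    rewrite sumr_const -(mulr_natr ((M *m b j) i 0)) -cardsE card_draws card_ord.
    by move/eqP; rewrite mulf_eq0 pnatr_eq0 eqn0Ngt bin_gt0 jn orbF => /eqP.
  by rewrite coefZ coefXn eqxx mulr1.
by move=> A /negbTE nA; rewrite coefZ coefXn eq_sym nA mulr0.
Qed.

End SymMapDiagonal.

Section IrreducibleModel.
Variable d : nat.
Hypothesis archi : forall x : K, exists n : nat, `|x| < n%:R.
Variables (Psi : SL2 K -> 'M[K]_d) (L : 'M[K]_2 -> 'M[K]_d).
Hypothesis D : differentiated Psi L.
Hypothesis irrPsi : irreducible Psi.

(** An irreducible representation is a symmetric power of the standard one: [psi]
    and [phi] are the equivariant n-linear maps from K^2 to the representation and to
    its dual, normalized so that the pairing of their diagonal values is the n-th power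
    of the bracket. Their diagonal values separate matrices. The last fields record
    the value of the Casimir operator, the fact that the square of h is not scalar
    when n > 1 (the weights n and n - 2 have distinct squares), and a bound on d. *)
Record sym_model n (psi : ('I_n -> 'cV[K]_2) -> 'cV[K]_d)
    (phi : ('I_n -> 'cV[K]_2) -> 'rV[K]_d) : Prop := SymModel {
  psi_multilinear : multilinear psi;
  phi_multilinear : multilinear phi;
  psi_equivariant : forall g w, Psi g *m psi w = psi (fun k => val g *m w k);
  phi_equivariant : forall g v, phi v *m Psi g^-1%g = phi (fun k => val g *m v k);
  psi_lie : forall Z w, \tr Z = 0 ->
    L Z *m psi w = \sum_k psi (upd w k (Z *m w k));
  phi_psi : forall v w, phi (fun=> v) *m psi (fun=> w) = ((br v w) ^+ n)%:M;
  phi_psi_separating : forall A, (forall v w,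
    phi (fun=> v) *m A *m psi (fun=> w) = 0) -> A = 0;
  model_casimir : L (sl2h K) *m L (sl2h K) + 2 *: (L (sl2e K) *m L (sl2f K))
    + 2 *: (L (sl2f K) *m L (sl2e K)) = (n * n.+2)%:R%:M;
  model_weights : (1 < n)%N -> forall a, L (sl2h K) *m L (sl2h K) <> a%:M;
  model_dim : (d <= n.+1)%N }.

(** The model is built on a weight string b_0, ..., b_n: its span is stable under the
    group, hence everything, and [psi] is the symmetric map with values b_j on the
    standard basis of K^2. The dual representation has a weight string g_j as well,
    and [phi] is the symmetric map attached to it. *)
Lemma exists_sym_model : exists n psi phi, @sym_model n psi phi.
Proof.
have [n [b [b0 bE bF]]] := weight_string D irrPsi.
(* B has the columns b_j, and Bi is a left inverse; U is the span of the b_j. *)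
pose B : 'M[K]_(d, n.+1) := \matrix_(i, j) b j i 0.
have colB (c : 'cV[K]_n.+1) : B *m c = \sum_(j < n.+1) c j 0 *: b j.
  apply/colP => i; rewrite mxE summxE; apply: eq_bigr => j _.
  by rewrite !mxE mulrC.
have Binj (c : 'cV[K]_n.+1) : B *m c = 0 -> c = 0.
  by rewrite colB; apply: (string_injective b0 bE).
have [Bi BiB] : exists Bi : 'M[K]_(n.+1, d), Bi *m B = 1%:M.
  have /row_freeP[C CB] : row_free B^T.
    apply: inj_row_free => v /(congr1 trmx); rewrite trmx_mul trmxK trmx0.
    by move=> /Binj/(congr1 trmx); rewrite trmxK trmx0.
  by exists C^T; rewrite -[B]trmxK -trmx_mul CB trmx1.
have bB (j : 'I_n.+1) : b j = B *m delta_mx j 0.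
  rewrite colB (bigD1 j) //= mxE !eqxx scale1r big1 ?addr0 // => i /negbTE ij.
  by rewrite mxE ij scale0r.
pose U := limg (linfun (mulmx B : 'cV[K]_n.+1 -> 'cV[K]_d)).
have UP v : reflect (exists c, v = B *m c) (v \in U).
  by apply: (iffP memv_imgP) => [[c _ ->]|[c ->]]; exists c; rewrite ?lfunE ?memvf.
have Ub j : (j <= n)%N -> b j \in U.
  move=> jn; apply/UP; exists (delta_mx (inord j) 0).
  by rewrite -bB inordK.
have iterU (A : 'M[K]_d) k : (forall j, (j <= n)%N -> A *m b j \in U)
   -> forall v, v \in U -> iter k (mulmx A) v \in U.
  move=> Ab; elim: k => [|k IHk] v vU //=.
  have /UP[c ->] := IHk v vU; rewrite colB mulmx_sumr; apply: memv_suml => j _.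
  by rewrite -scalemxAr; apply: memvZ; apply: Ab; rewrite leq_ord.
have EU j : (j <= n)%N -> L (sl2e K) *m b j \in U.
  by move=> jn; rewrite bE // memvZ // Ub // (leq_trans (leq_pred _)).
have FU j : (j <= n)%N -> L (sl2f K) *m b j \in U.
  rewrite leq_eqVlt => /orP[/eqP ->|jn]; first by rewrite bF // subnn scale0r mem0v.
  by rewrite bF ?(ltnW jn) // memvZ // Ub.
have E0 k : forall j, (j <= n)%N -> (j < k)%N -> iter k (mulmx (L (sl2e K))) (b j) = 0.
  elim: k => [//|k IHk] j jn jk; rewrite iterSr bE //.
  have Z c v : iter k (mulmx (L (sl2e K))) (c *: v) = c *: iter k (mulmx (L (sl2e K))) v.
    by elim: (k) => //= l ->; rewrite scalemxAr.
  rewrite Z; case: j jn jk => [|j] jn jk; first by rewrite scale0r.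
  by rewrite IHk ?scaler0 // ltnW.
have F0 k : forall j, (j <= n)%N -> (n < j + k)%N -> iter k (mulmx (L (sl2f K))) (b j) = 0.
  elim: k => [|k IHk] j jn jk; first by move: jk; rewrite addn0 ltnNge jn.
  rewrite iterSr bF //.
  have Z c v : iter k (mulmx (L (sl2f K))) (c *: v) = c *: iter k (mulmx (L (sl2f K))) v.
    by elim: (k) => //= l ->; rewrite scalemxAr.
  rewrite Z; move: jn; rewrite leq_eqVlt => /orP[/eqP ->|jn]; first by rewrite subnn scale0r.
  by rewrite IHk ?scaler0 // addSnnS.
have lin0 (A : 'M[K]_d) k : (forall j, (j <= n)%N -> iter k (mulmx A) (b j) = 0) ->
    forall v, v \in U -> iter k (mulmx A) v = 0.
  move=> A0 v /UP[c ->]; rewrite colB iter_mulmx_sum big1 // => j _.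
  by rewrite A0 ?leq_ord // scaler0.
have expU X t v : X *m X = 0 -> (forall j, (j <= n)%N -> L X *m b j \in U) ->
    (forall j, (j <= n)%N -> iter n.+2 (mulmx (L X)) (b j) = 0) ->
    v \in U -> Psi (unip X t) *m v \in U.
  move=> X2 XU X0 vU; rewrite (Psi_unip_exp archi D (D0 := n)) //; last exact: (lin0 _ _ X0).
  by apply: memv_suml => k _; apply: memvZ; apply: iterU.
(* U is stable under the elementary unipotents, by their exponential series. *)
have Ufull : U = fullv.
  have := irrPsi.2 U; case=> //.
    move=> g; elim/SL2_elementary_ind: g => [t|t|g h IHg IHh] v vU.
    - apply: expU => //; first exact: sl2e_sqr.
      by move=> j jn; apply: E0 => //; rewrite ltnS (leq_trans jn).
    - apply: expU => //; first exact: sl2f_sqr.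
      by move=> j jn; apply: F0 => //; rewrite addnS ltnS (leq_trans _ (leq_addl _ _)).
    - by rewrite (diff_repr D).2 -mulmxA; apply: IHg; apply: IHh.
  by move=> U0; have := Ub 0%N isT; rewrite U0 memv0 (negbTE b0).
have BBi : B *m Bi = 1%:M.
  apply/row_matrixP => i; apply: trmx_inj; apply: (can_inj trmxK).
  apply/rowP => j; rewrite !mxE.
  have /UP[c cE] : (delta_mx j 0 : 'cV[K]_d) \in U by rewrite Ufull memvf.
  have : B *m Bi *m delta_mx j 0 = delta_mx j 0 :> 'cV[K]_d.
    by rewrite cE -mulmxA (mulmxA Bi) BiB mul1mx.
  by rewrite -colE => /colP/(_ i); rewrite !mxE eqxx andbT.
have bsep p (M : 'M[K]_(p, d)) : (forall j, (j <= n)%N -> M *m b j = 0) -> M = 0.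
  move=> Mb; rewrite -[M]mulmx1 -BBi mulmxA.
  suff -> : M *m B = 0 by rewrite mul0mx.
  apply/matrixP => i j; have := Mb j (leq_ord j); rewrite bB mulmxA -colE => /colP/(_ i).
  by rewrite !mxE.
(* With l_j the dual basis of b_j, the string g_j = (-1)^j (j! (n - j)! / n!) l_(n-j)
   of the dual representation is the one for which the pairing is [v, w]^n. *)
pose c_ j : K := j`!%:R * (n - j)`!%:R / n`!%:R.
pose g_ j : 'rV[K]_d := ((-1) ^+ j * c_ j) *: row (inord (n - j)) Bi.
have gb i j : (i <= n)%N -> (j <= n)%N ->
    g_ i *m b j = (if (i + j == n)%N then (-1) ^+ i * c_ i else 0)%:M.
  move=> iN jn; have -> : b j = B *m delta_mx (inord j) 0 by rewrite -bB inordK.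
  rewrite mulmxA /g_ -scalemxAl -row_mul BiB -scalemxAl row1 mul_delta_mx_cond.
  have -> : (inord (n - i) == inord j :> 'I_n.+1) = (i + j == n)%N.
    by rewrite -(inj_eq val_inj) /= !inordK ?ltnS ?leq_subr // -(eqn_add2l i) subnKC // eq_sym.
  by case: eqP => _; apply/matrixP => r s; rewrite !ord1 !mxE ?eqxx ?mulr1 ?mulr0 ?mulr0n ?mulr1n.
have cn j : c_ j != 0.
  by rewrite /c_ mulf_neq0 ?invr_eq0 ?mulf_neq0 // pnatr_eq0 -lt0n fact_gt0.
have gsep p (M : 'M[K]_(d, p)) : (forall j, (j <= n)%N -> g_ j *m M = 0) -> M = 0.
  move=> gM; rewrite -[M]mul1mx -BBi -mulmxA.
  suff -> : Bi *m M = 0 by rewrite mulmx0.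
  apply/row_matrixP => i; rewrite row_mul row0.
  have := gM (n - i)%N (leq_subr _ _); rewrite /g_ -scalemxAl subKn ?leq_ord // inord_val.
  by move/eqP; rewrite scaler_eq0 mulf_eq0 signr_eq0 (negbTE (cn _)) => /eqP.
move: g_ gb gsep => g_ gb gsep.
have fn k : (k`!%:R : K) != 0 by rewrite pnatr_eq0 -lt0n fact_gt0.
have cS j : (j < n)%N -> (n - j)%:R * c_ j.+1 = j.+1%:R * c_ j.
  by move=> jn; rewrite /c_ -(subnSK jn) !factS !natrM; ring.
have rsep (r s : 'rV[K]_d) : (forall j, (j <= n)%N -> r *m b j = s *m b j) -> r = s.
  move=> rs; apply/eqP; rewrite -subr_eq0; apply/eqP/bsep => j jn.
  by rewrite mulmxBl rs // subrr.
have gE j : (j <= n)%N -> g_ j *m L (sl2e K) = - (j%:R *: g_ j.-1).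
  move=> jn; apply: rsep => i iN; rewrite -mulmxA bE // -scalemxAr mulNmx -scalemxAl.
  rewrite !gb ?(leq_trans (leq_pred _)) //.
  case: i j iN jn => [|i] [|j] iN jn; rewrite ?scale0r ?oppr0 //=.
  - rewrite addn0 ifF; first by rewrite raddf0 scaler0 oppr0.
    by apply/negbTE; rewrite neq_ltn jn.
  - rewrite add0n ifF; first by rewrite raddf0 scaler0.
    by apply/negbTE; rewrite neq_ltn iN.
  rewrite addSnnS; case: eqP => ij; last by rewrite raddf0 !scaler0 oppr0.
  have := cS j jn; rewrite -[X in (X - j)%N]ij addKn => cSj.
  by rewrite !scale_scalar_mx -raddfN /= exprS -!mulrA mulN1r mulrN mulrCA cSj; congr (_%:M); ring.
have gF j : (j <= n)%N -> g_ j *m L (sl2f K) = - ((n - j)%:R *: g_ j.+1).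
  move=> jn; apply: rsep => i iN; rewrite -mulmxA bF // -scalemxAr mulNmx -scalemxAl.
  move: iN jn; rewrite leq_eqVlt => /orP[/eqP ->|iN]; rewrite leq_eqVlt => /orP[/eqP ->|jn].
  - by rewrite subnn !scale0r oppr0.
  - rewrite subnn scale0r gb // ifF; first by rewrite raddf0 scaler0 oppr0.
    by apply/negbTE; rewrite neq_ltn orbC addSn ltnS leq_addl.
  - rewrite subnn scale0r oppr0 gb // ifF; first by rewrite raddf0 scaler0.
    by apply/negbTE; rewrite neq_ltn orbC addnS ltnS leq_addr.
  rewrite !gb ?(ltnW jn) ?(ltnW iN) // addnS addSn; case: eqP => ij; last by rewrite raddf0 !scaler0 oppr0.
  rewrite !scale_scalar_mx -raddfN /= exprS -[X in (X - i)%N]ij -addSn addnK.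
  congr (_%:M); transitivity ((-1) ^+ j * ((n - j)%:R * c_ j.+1)); last by ring.
  by rewrite cS //; ring.
pose D' := differentiated_dual D.
pose gt j := (g_ j)^T.
have gtE j : (j <= n)%N -> - (L (sl2e K))^T *m gt j = j%:R *: gt j.-1.
  by move=> jn; rewrite mulNmx -trmx_mul gE // linearN linearZ /= opprK.
have gtF j : (j <= n)%N -> - (L (sl2f K))^T *m gt j = (n - j)%:R *: gt j.+1.
  by move=> jn; rewrite mulNmx -trmx_mul gF // linearN linearZ /= opprK.
exists n, (sym_map b), (fun v => (sym_map gt v)^T); split.
- exact: sym_map_multilinear.
- by move=> v i c x y; rewrite sym_map_multilinear linearD linearZ.
- exact: (sym_map_equivariant archi D bE bF).
- move=> g v; have := sym_map_equivariant archi D' gtE gtF g v => <-.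
  by rewrite trmx_mul trmxK.
- move=> Z w; exact: (sym_map_lie D bE bF).
- move=> v w; rewrite /sym_map [(\sum_A _ *: gt _)^T]linear_sum mulmx_suml.
  have pair_A (A : {set 'I_n}) : (monomial_at (fun=> v) A *: gt #|A|)^T *m
      (\sum_(A' : {set 'I_n}) monomial_at (fun=> w) A' *: b #|A'|) =
      (monomial_at (fun=> v) A * (-1) ^+ #|A| * w o1 0 ^+ (n - #|A|) * w o0 0 ^+ #|A|)%:M.
    have An := card_set_le A.
    rewrite linearZ /= trmxK -scalemxAl mulmx_sumr.
    rewrite (eq_bigr (fun A' : {set 'I_n} => (if #|A'| == (n - #|A|)%N then
        w o1 0 ^+ (n - #|A|) * w o0 0 ^+ #|A| * ((-1) ^+ #|A| * c_ #|A|) else 0)%:M)).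
      rewrite -raddf_sum /= -big_mkcond /= sumr_const -cardsE card_draws card_ord.
      rewrite scale_scalar_mx; congr (_%:M).
      have := bin_fact An => /(congr1 (fun k => k%:R : K)).
      rewrite !natrM bin_sub // /c_ => <-.
      have bk : 'C(n, #|A|)%:R != 0 :> K by rewrite pnatr_eq0 -lt0n bin_gt0.
      by rewrite -(mulr_natr (_ * _) 'C(n, #|A|)); field; rewrite bk !fn.
    move=> A' _; rewrite -scalemxAr gb ?card_set_le //.
    rewrite -[X in _ == X](subnKC An) eqn_add2l; case: eqP => A'n; last by rewrite raddf0 scaler0.
    by rewrite scale_scalar_mx monomial_diag A'n subKn.
  under eq_bigr => A _ do rewrite pair_A.
  rewrite -raddf_sum /=; congr (_%:M).
  rewrite -[X in _ = _ ^+ X]card_ord -prodr_const /br.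
  under [RHS]eq_bigr => k _ do rewrite addrC.
  rewrite bigA_distr; apply: eq_bigr => A _.
  rewrite monomial_diag [RHS](bigID (mem A)) /=.
  have nA : (#|A| + #|[predC A]|)%N = n by rewrite cardC card_ord.
  rewrite (eq_bigr (fun=> - (v o1 0 * w o0 0))) => [|k -> //].
  rewrite [X in _ = _ * X](eq_bigr (fun=> v o0 0 * w o1 0)) => [|k /negbTE -> //].
  rewrite !prodr_const [X in _ = _ * _ ^+ X](_ : _ = (n - #|A|)%N); last first.
    by rewrite -[X in (X - _)%N]nA addKn.
  by rewrite -(mulN1r (v o1 0 * w o0 0)) !exprMn; ring.
- move=> A A0; apply: gsep => j jn; apply: trmx_inj; rewrite trmx_mul trmx0.
  apply: (sym_map_span (n := n) (b := gt)) jn => v; apply: trmx_inj.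
  rewrite trmx_mul trmxK trmx0; apply: bsep => i; apply: sym_map_span => w.
  exact: A0.
- apply/eqP; rewrite -subr_eq0; apply/eqP/bsep => j jn.
  have EFb : L (sl2e K) *m L (sl2f K) *m b j = ((n - j)%:R * j.+1%:R) *: b j.
    rewrite -mulmxA bF // -scalemxAr; move: jn; rewrite leq_eqVlt => /orP[/eqP ->|jn].
      by rewrite subnn mul0r !scale0r.
    by rewrite bE // scalerA.
  have FEb : L (sl2f K) *m L (sl2e K) *m b j = (j%:R * (n - j).+1%:R) *: b j.
    rewrite -mulmxA bE // -scalemxAr; case: j jn {EFb} => [|j] jn; first by rewrite mul0r !scale0r.
    by rewrite bF ?(ltnW jn) // scalerA subnSK.
  have HHb : L (sl2h K) *m L (sl2h K) *m b j = ((n%:R - j%:R - j%:R) ^+ 2) *: b j.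
    by rewrite -mulmxA !(string_weight D bE bF) // -scalemxAr (string_weight D bE bF) // scalerA.
  rewrite mulmxBl !mulmxDl -!scalemxAl EFb FEb HHb mul_scalar_mx !scalerA -!scalerDl -scalerBl.
  rewrite -[X in _ = X](scale0r (b j)); congr (_ *: _).
  rewrite natrM -!natr1 natrB //; ring.
- move=> n1 a HH; have n0 := ltnW n1.
  have b1 : b 1%N != 0.
    by apply: contra_neq b0 => b1; have := bE 1%N n0; rewrite b1 mulmx0 scale1r.
  have Hb j : (j <= n)%N -> b j != 0 -> (n%:R - j%:R - j%:R) ^+ 2 = a.
    move=> jn bj; have : L (sl2h K) *m L (sl2h K) *m b j = a *: b j by rewrite HH mul_scalar_mx.
    rewrite -mulmxA !(string_weight D bE bF) // -scalemxAr (string_weight D bE bF) // scalerA.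
    by move/eqP; rewrite -subr_eq0 -scalerBl scaler_eq0 (negbTE bj) orbF subr_eq0 => /eqP.
  have := Hb 1%N n0 b1; rewrite -(Hb 0%N isT b0) !subr0 => /eqP.
  rewrite eqf_sqr => /orP[]; rewrite -subr_eq0.
    rewrite (_ : _ - _ = - 2); last by ring.
    by rewrite oppr_eq0 pnatr_eq0.
  rewrite (_ : _ - _ = 2 * (n.-1)%:R); last by rewrite -[in LHS](prednK n0) -natr1; ring.
  by rewrite mulf_eq0 !pnatr_eq0 /= -subn1 subn_eq0 leqNgt n1.
- exact: mulmx1_min BBi.
Qed.

End IrreducibleModel.
End Model.

(** * The first fundamental theorem for SL_2 *)

Section BracketClass.
Variables (K : numClosedFieldType) (I : finType) (T : Type).
Variables (Inv : (T -> K) -> Prop) (Word : (T -> 'M[K]_2) -> Prop).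

(** The functions of a point [X] and of the vectors [v i], i in J, spanned by the
    products of an element of [Inv] and of brackets [v i, W v j] with [W] in
    [Word], in which every index of J occurs exactly once. *)
Inductive bracket_class : {set I} -> (T -> (I -> 'cV[K]_2) -> K) -> Prop :=
| BC_inv f : Inv f -> bracket_class finset.set0 (fun X _ => f X)
| BC_zero J : bracket_class J (fun _ _ => 0)
| BC_add J p q : bracket_class J p -> bracket_class J q ->
    bracket_class J (fun X v => p X v + q X v)
| BC_edge (i j : I) (J : {set I}) W p : i != j -> i \notin J -> j \notin J -> Word W ->
    bracket_class J p ->
    bracket_class (i |: (j |: J)) (fun X v => br (v i) (W X *m v j) * p X v).

Hypothesis InvC : forall c, Inv (fun=> c).
Hypothesis InvM : forall f g, Inv f -> Inv g -> Inv (fun X => f X * g X).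
Hypothesis Word1 : Word (fun=> 1%:M).

Lemma bracket_class_ext J p q : bracket_class J p -> (forall X v, p X v = q X v) ->
  bracket_class J q.
Proof.
move=> cp pq; suff -> : q = p by [].
by apply/funext => X; apply/funext => v; rewrite pq.
Qed.

Lemma bracket_class_scale J f p : Inv f -> bracket_class J p ->
  bracket_class J (fun X v => f X * p X v).
Proof.
move=> If; elim => {J p} [g Ig|J|J p q _ IHp _ IHq|i j J W p ij iJ jJ WW _ IHp].
- exact: (BC_inv (InvM If Ig)).
- by apply: (bracket_class_ext (BC_zero J)) => X v; rewrite mulr0.
- by apply: (bracket_class_ext (BC_add IHp IHq)) => X v; rewrite mulrDr.
- by apply: (bracket_class_ext (BC_edge ij iJ jJ WW IHp)) => X v; rewrite mulrCA.
Qed.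

Lemma bracket_class_sum J (A : finType) (P : pred A) (F : A -> T -> (I -> 'cV[K]_2) -> K) :
  (forall a, P a -> bracket_class J (F a)) ->
  bracket_class J (fun X v => \sum_(a | P a) F a X v).
Proof.
move=> cF; have key (r : seq A) : bracket_class J (fun X v => \sum_(a <- r | P a) F a X v).
  elim: r => [|a r IHr].
    by apply: (bracket_class_ext (BC_zero J)) => X v; rewrite big_nil.
  case Pa: (P a).
    by apply: (bracket_class_ext (BC_add (cF a Pa) IHr)) => X v; rewrite big_cons Pa.
  by apply: (bracket_class_ext IHr) => X v; rewrite big_cons Pa.
exact: key.
Qed.

(** [f] depends only on the vectors [v i] with i in J, and linearly on each. *)
Definition multilinear_on (J : {set I}) (f : (I -> 'cV[K]_2) -> K) :=
  (forall v i c x y, i \in J -> f (upd v i (c *: x + y)) =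
     c * f (upd v i x) + f (upd v i y)) /\
  (forall v v', (forall i, i \in J -> v i = v' i) -> f v = f v').

Definition SL2_invariant (f : (I -> 'cV[K]_2) -> K) :=
  forall (g : SL2 K) v, f (fun k => val g *m v k) = f v.

(** The standard basis of K^2. *)
Definition e0 : 'cV[K]_2 := delta_mx o0 0.
Definition e1 : 'cV[K]_2 := delta_mx o1 0.

Lemma cv2E (x : 'cV[K]_2) : x = x o0 0 *: e0 + (x o1 0 *: e1 + 0).
Proof. by apply: cv2P; rewrite !mxE /= ?mulr1 ?mulr0 !addr0 ?add0r. Qed.

Lemma br_antisym x y : br y x = - br x y :> K.
Proof. by rewrite /br; ring. Qed.

Lemma br_SL2 (g : SL2 K) x y : br (val g *m x) (val g *m y) = br x y.
Proof.
have := valP g; rewrite det2E => /eqP dg.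
rewrite -[RHS]mul1r -[X in X * _]dg /br !mulmx2E; ring.
Qed.

(** On K^2, antisymmetrizing a bilinear form gives a multiple of the bracket. *)
Lemma bilinear_antisym (B : 'cV[K]_2 -> 'cV[K]_2 -> K) :
  (forall c x y z, B (c *: x + y) z = c * B x z + B y z) ->
  (forall c x y z, B z (c *: x + y) = c * B z x + B z y) ->
  forall x y, B x y - B y x = br x y * (B e0 e1 - B e1 e0).
Proof.
move=> Bl Br x y.
have B0l z : B 0 z = 0.
  by have := Bl 1 0 0 z; rewrite scaler0 addr0 mul1r => /eqP; rewrite -subr_eq subrr eq_sym => /eqP.
have B0r z : B z 0 = 0.
  by have := Br 1 0 0 z; rewrite scaler0 addr0 mul1r => /eqP; rewrite -subr_eq subrr eq_sym => /eqP.
rewrite {1 2}(cv2E x) {1 2}(cv2E y) !(Bl, Br, B0l, B0r) /br; ring.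
Qed.

Lemma upd_funmul (M : 'M[K]_2) (v : I -> 'cV[K]_2) i x :
  (fun k => M *m upd v i x k) = upd (fun k => M *m v k) i (M *m x).
Proof. exact: upd_map. Qed.

Section Swap.
Variables (J : {set I}) (f : (I -> 'cV[K]_2) -> K) (i j : I).
Hypotheses (fml : multilinear_on J f) (finv : SL2_invariant f).
Hypotheses (iJ : i \in J) (jJ : j \in J) (ij : i != j).

(** The effect on [f] of exchanging the arguments i and j is the bracket of these
    arguments times this form in the others, again multilinear and invariant. *)
Definition swap_coef (v : I -> 'cV[K]_2) : K :=
  f (upd (upd v i e0) j e1) - f (upd (upd v i e1) j e0).

Let bl v c x y z : f (upd (upd v i (c *: x + y)) j z) =
  c * f (upd (upd v i x) j z) + f (upd (upd v i y) j z).
Proof. by rewrite !(upd_comm _ _ _ ij) fml.1. Qed.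

Let br' v c x y z : f (upd (upd v i z) j (c *: x + y)) =
  c * f (upd (upd v i z) j x) + f (upd (upd v i z) j y).
Proof. by rewrite fml.1. Qed.

Lemma swap_diff v : f v - f (fun k => v (tperm i j k)) = br (v i) (v j) * swap_coef v.
Proof.
rewrite /swap_coef -(bilinear_antisym (bl v) (br' v)); congr (_ - _); congr f.
  by rewrite upd_comm // upd_id upd_id.
apply/funext => k; rewrite /upd; case: eqP => [->|/eqP kj]; first by rewrite tpermR.
by case: eqP => [->|/eqP ki]; rewrite ?tpermL // tpermD // eq_sym.
Qed.

Lemma swap_coef_multilinear : multilinear_on (J :\ i :\ j) swap_coef.
Proof.
split=> [v k c x y|v v' vv'].
  rewrite !inE => /and3P[kj ki kJ]; rewrite /swap_coef.
  have E a b z : upd (upd (upd v k z) i a) j b = upd (upd (upd v i a) j b) k z.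
    by rewrite (upd_comm v z a ki) (upd_comm _ z b kj).
  by rewrite !E !fml.1 //; ring.
have E a b : f (upd (upd v i a) j b) = f (upd (upd v' i a) j b).
  apply: fml.2 => k kJ; rewrite /upd; case: eqP => // /eqP kj; case: eqP => // /eqP ki.
  by apply: vv'; rewrite !inE kj ki kJ.
by rewrite /swap_coef !E.
Qed.

Lemma swap_coef_invariant : SL2_invariant swap_coef.
Proof.
move=> g v; have B := bilinear_antisym (bl (fun k => val g *m v k)) (br' (fun k => val g *m v k)).
have := B (val g *m e0) (val g *m e1); rewrite br_SL2 -/(swap_coef _).
rewrite -!upd_funmul !finv -/(swap_coef v) => ->.
by rewrite /br !mxE /= mulr1 mulr0 subr0 mul1r.
Qed.

End Swap.

Section OnSubset.
Variables (J : {set I}) (f : (I -> 'cV[K]_2) -> K).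
Hypotheses (fml : multilinear_on J f) (finv : SL2_invariant f).
Let IJ : finType := {x : I | x \in J}.

(** The family extended by 0 outside of J. *)
Definition extend (u : IJ -> 'cV[K]_2) : I -> 'cV[K]_2 :=
  fun i => if insub i is Some k then u k else 0.

Lemma extend_multilinear : multilinear (fun u : IJ -> 'cV[K]_2 => f (extend u) : K^o).
Proof.
move=> u k c x y.
have E z : extend (upd u k z) = upd (extend u) (val k) z.
  apply/funext => i; rewrite /extend /upd; case: insubP => [l lJ lE|iJ].
    by rewrite -(inj_eq val_inj) lE.
  by case: eqP => // ik; rewrite ik (valP k) in iJ.
by rewrite !E fml.1 // (valP k).
Qed.

(** A multilinear invariant of at least one vector vanishes on the diagonal: if
    [x, y] = 1, some element of SL_2 maps x to 2 x and y to y / 2, so that the value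
    at x is equal to itself times a positive power of 2. *)
Lemma diagonal_zero x : J != finset.set0 -> f (fun=> x) = 0.
Proof.
move=> /set0Pn[i iJ].
have f0 : f (fun=> 0) = 0.
  have := fml.1 (fun=> 0) i 1 0 0 iJ; rewrite scaler0 addr0 mul1r upd_id.
  by move/eqP; rewrite -subr_eq subrr eq_sym => /eqP.
have [->//|x0] := eqVneq x 0.
have [y xy] : exists y, br x y = 1.
  have [x00|x00] := eqVneq (x o0 0) 0.
    have x10 : x o1 0 != 0.
      by apply: contra_neq x0 => x10; apply: cv2P; rewrite mxE.
    exists (- (x o1 0)^-1 *: e0); rewrite /br !mxE /= x00 mulr1 mul0r sub0r mulrN opprK.
    by rewrite mulfV.
  by exists ((x o0 0)^-1 *: e1); rewrite /br !mxE /= mulr1 mulr0 mulr0 subr0 mulfV.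
pose M := mat2 (2 * y o1 0 * x o0 0 - x o1 0 * y o0 0 / 2)
   (- 2 * y o0 0 * x o0 0 + x o0 0 * y o0 0 / 2)
   (2 * y o1 0 * x o1 0 - x o1 0 * y o1 0 / 2)
   (- 2 * y o0 0 * x o1 0 + x o0 0 * y o1 0 / 2).
have dM : \det M == 1.
  rewrite -(expr1n _ 2) -[X in _ == X ^+ _]xy; apply/eqP.
  by rewrite det2E !mat2E /br; field.
have Mx : M *m x = 2 *: x.
  rewrite -[in RHS](mul1r 2) -[X in X * 2]xy /br.
  by apply: cv2P; rewrite mulmx2E !mat2E !mxE; field.
have := finv (exist _ M dM) (fun=> x); rewrite /= Mx.
have fE z : f (fun=> z) = f (extend (fun=> z)).
  by apply: fml.2 => k kJ; rewrite /extend insubT.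
rewrite !fE (multilinear_scale extend_multilinear (fun=> 2) (fun=> x)) prodr_const.
move/eqP; rewrite -subr_eq0 -[X in _ - X]mul1r -mulrBl mulf_eq0 => /orP[|/eqP//].
have cJ : (0 < #|IJ|)%N by apply/card_gt0P; exists (exist _ i iJ).
rewrite -(prednK cJ) -natrX subr_eq0 -[X in _ == X]/(1%:R) eqr_nat.
by rewrite expnS gtn_eqF // (leq_trans _ (leq_pmulr 2 _)) // expn_gt0.
Qed.

(** [f] with its arguments permuted by [s]. *)
Definition permute (s : {perm IJ}) (v : I -> 'cV[K]_2) : K :=
  f (extend (fun k => v (val (s k)))).

Lemma permute_multilinear s : multilinear_on J (permute s).
Proof.
split=> [v i c x y iJ|v v' vv'].
  pose k := (s^-1)%g (exist (fun x => x \in J) i iJ).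
  have E z : (fun l => upd v i z (val (s l))) = upd (fun l => v (val (s l))) k z.
    apply/funext => l; rewrite /upd /k.
    rewrite -(inj_eq (@perm_inj _ s)) permKV -(inj_eq val_inj) /=.
    by [].
  by rewrite /permute !E; apply: extend_multilinear.
rewrite /permute; congr (f (extend _)); apply/funext => k; apply: vv'; exact: valP.
Qed.

Lemma permute_invariant s : SL2_invariant (permute s).
Proof.
move=> g v; rewrite /permute -[RHS](finv g); apply: fml.2 => i iJ.
by rewrite /extend insubT.
Qed.

End OnSubset.

(** First fundamental theorem for SL_2: a multilinear invariant of vectors of K^2
    is a combination of products of brackets. By induction, exchanging two arguments
    of [f], hence permuting them, changes [f] by such a combination; and the sum of [f]
    over all the permutations is 0 by polarization, since [f] vanishes on the diagonal. *)
Theorem SL2_first_fundamental (J : {set I}) (f : (I -> 'cV[K]_2) -> K) :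
  multilinear_on J f -> SL2_invariant f -> bracket_class J (fun _ v => f v).
Proof.
have [N] := ubnP #|J|; elim: N J f => // N IHN J f; rewrite ltnS => JN fml finv.
have [J0|J0] := eqVneq J finset.set0.
  rewrite J0; apply: (bracket_class_ext (BC_inv (InvC (f (fun=> 0))))) => X v.
  by apply: fml.2 => i; rewrite J0 inE.
pose IJ : finType := {x : I | x \in J}.
have swap (h : (I -> 'cV[K]_2) -> K) i j : multilinear_on J h -> SL2_invariant h ->
    i \in J -> j \in J -> bracket_class J (fun _ v => h v - h (fun k => v (tperm i j k))).
  move=> hml hinv iJ jJ; have [<-|ij] := eqVneq i j.
    apply: (bracket_class_ext (BC_zero J)) => X v; rewrite tperm1.
    by under [X in _ - h X]eq_fun do rewrite perm1; rewrite subrr.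
  have cJ : (#|J :\ i :\ j| < N)%N.
    rewrite (cardsD1 i) iJ (cardsD1 j) !inE eq_sym ij jJ in JN; exact: ltnW.
  have cc := IHN _ _ cJ (swap_coef_multilinear i j hml)
    (swap_coef_invariant hml hinv iJ jJ ij).
  have JE : J = i |: (j |: (J :\ i :\ j)).
    by rewrite !finset.setD1K // !inE eq_sym ij jJ.
  rewrite [X in bracket_class X]JE.
  apply: (bracket_class_ext (BC_edge ij _ _ Word1 cc)); rewrite ?inE ?eqxx ?andbF //.
  by move=> X v; rewrite mul1mx -(swap_diff hml iJ jJ ij).
have perms (s : {perm IJ}) : bracket_class J (fun _ v => f v - permute f s v).
  have [ts -> _] := prod_tpermP s; elim/last_ind: ts => [|ts t IHt].
    rewrite big_nil; apply: (bracket_class_ext (BC_zero J)) => X v.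
    rewrite /permute; apply/esym/eqP; rewrite subr_eq0; apply/eqP/fml.2 => i iJ.
    by rewrite /extend insubT perm1.
  rewrite -cats1 big_cat big_seq1 /=; move: (\prod_(u <- ts) _)%g IHt => s' IHt.
  have := swap (permute f s') (val t.1) (val t.2) (permute_multilinear fml s')
    (permute_invariant fml finv s') (valP _) (valP _).
  move/(BC_add IHt) => H; apply: (bracket_class_ext H) => X v.
  rewrite addrA subrK; congr (_ - _); rewrite /permute; congr (f (extend _)).
  apply/funext => k; rewrite permM.
  have -> // : val (tperm t.1 t.2 (s' k)) = tperm (val t.1) (val t.2) (val (s' k)).
  case: (tpermP t.1 t.2 (s' k)) => [->|->|/eqP n1 /eqP n2]; rewrite ?tpermL ?tpermR //.
  by rewrite tpermD // (inj_eq val_inj) eq_sym.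
pose P := [pred g : {ffun IJ -> IJ} | injectiveb g].
have sum0 v : \sum_(g : {ffun IJ -> IJ} | P g) f (@extend J (fun k => v (val (g k)))) = 0.
  rewrite -(polarization (extend_multilinear fml) (fun k => v (val k))).
  apply: big1 => A _.
  have -> : f (@extend J (fun=> \sum_(a in A) v (val a))) = 0; last by rewrite scaler0.
  transitivity (f (fun=> \sum_(a in A) v (val a))); last exact: (diagonal_zero fml).
  by apply: fml.2 => i iJ; rewrite /extend (insubT (fun x => x \in J) iJ).
have P1 : (0 < #|P|)%N.
  apply/card_gt0P; exists [ffun k => k]; rewrite inE; apply/injectiveP => a b.
  by rewrite !ffunE.
have PK : (#|P|%:R : K) != 0 by rewrite pnatr_eq0 -lt0n.
have H : bracket_class J (fun X v =>
   \sum_(g : {ffun IJ -> IJ} | P g) (f v - f (@extend J (fun k => v (val (g k)))))).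
  apply: bracket_class_sum => g /injectiveP ig.
  apply: (bracket_class_ext (perms (perm ig))) => X v; rewrite /permute.
  by under eq_fun do rewrite permE.
apply: (bracket_class_ext (bracket_class_scale (InvC (#|P|%:R^-1)) H)) => X v.
by rewrite sumrB sum0 subr0 sumr_const -(mulr_natl (f v)) mulrA mulVf // mul1r.
Qed.

End BracketClass.

(** * Scalars and 2 x 2 matrices attached to a subalgebra *)

Section InvariantsAndWords.
Variables (K : numClosedFieldType) (m d n : nat).
Variables (Psi : SL2 K -> 'M[K]_d) (L : 'M[K]_2 -> 'M[K]_d).
Hypothesis D : differentiated Psi L.
Variables (psi : ('I_n -> 'cV[K]_2) -> 'cV[K]_d) (phi : ('I_n -> 'cV[K]_2) -> 'rV[K]_d).
Hypothesis M : sym_model Psi L psi phi.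
Hypotheses (d0 : (0 < d)%N) (n0 : (0 < n)%N).
Local Notation T := ('I_m -> sl2 K).

(** The trace form of the representation is a nonzero multiple of that of sl_2: by
    invariance it is determined by its value at (e, f), and the trace of the Casimir
    operator shows that this value is not 0. *)
Lemma trace_form : exists2 kappa : K, kappa != 0 &
  forall X Y, \tr X = 0 -> \tr Y = 0 -> \tr (L X *m L Y) = kappa * \tr (X *m Y).
Proof.
pose E := L (sl2e K); pose F := L (sl2f K); pose H := L (sl2h K).
have EF : E *m F - F *m E = H := bracket_ef D.
have HE : H *m E - E *m H = 2 *: E := bracket_he D.
have HF : H *m F - F *m H = - 2 *: F := bracket_hf D.
have two : (2 : K) != 0 by rewrite pnatr_eq0.
have cyc (A B C : 'M[K]_d) : \tr ((A *m B - B *m A) *m C) = \tr (A *m (B *m C - C *m B)).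
  rewrite mulmxBl mulmxBr !linearB /= !mulmxA.
  by rewrite -[B *m A *m C]mulmxA [\tr (B *m _)]mxtrace_mulC.
have half (c t : K) : c != 0 -> c * t = 0 -> t = 0.
  by move=> c0 /eqP; rewrite mulf_eq0 (negbTE c0) => /eqP.
have Ntwo : - (2 : K) != 0 by rewrite oppr_eq0.
have tEE : \tr (E *m E) = 0.
  by apply: (half _ _ two); rewrite -mxtraceZ scalemxAl -HE cyc subrr mulmx0 raddf0.
have tFF : \tr (F *m F) = 0.
  by apply: (half _ _ Ntwo); rewrite -mxtraceZ scalemxAl -HF cyc subrr mulmx0 raddf0.
have tHE : \tr (H *m E) = 0.
  by apply: (half _ _ two); rewrite -mxtraceZ scalemxAr -HE -cyc subrr mul0mx raddf0.
have tHF : \tr (H *m F) = 0.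
  by apply: (half _ _ Ntwo); rewrite -mxtraceZ scalemxAr -HF -cyc subrr mul0mx raddf0.
have tHH : \tr (H *m H) = 2 * \tr (E *m F).
  rewrite -{1}EF cyc -[F *m H - _]opprB HF -scaleNr opprK.
  by rewrite -scalemxAr mxtraceZ.
have tFE : \tr (F *m E) = \tr (E *m F) by rewrite mxtrace_mulC.
exists (\tr (E *m F)).
  have := congr1 mxtrace (model_casimir M); rewrite -/E -/F -/H !mxtraceD !mxtraceZ tFE tHH.
  rewrite mxtrace_scalar => c; apply: contraTneq d0 => e; move/esym/eqP: c.
  rewrite e !mulr0 !addr0 mulrn_eq0 pnatr_eq0 muln_eq0 /= orbF => /orP[/eqP-> //|].
  by rewrite eqn0Ngt n0.
move=> X Y X0 Y0.
have X11 : X o1 o1 = - X o0 o0 by apply/eqP; rewrite -addr_eq0 addrC -mxtrace2E X0.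
have Y11 : Y o1 o1 = - Y o0 o0 by apply/eqP; rewrite -addr_eq0 addrC -mxtrace2E Y0.
rewrite {1}(sl2_basis X0) {1}(sl2_basis Y0) !(lieD D) !(lieZ D) -/E -/F -/H.
rewrite !(mulmxDl, mulmxDr) -!scalemxAl -!scalemxAr !mxtraceD !mxtraceZ.
rewrite tEE tFF tHE tHF tHH tFE (mxtrace_mulC E H) (mxtrace_mulC F H) tHE tHF.
by rewrite mxtrace2E !mulmx2E X11 Y11; ring.
Qed.

Variable A : set (mxmap K m d).
Hypothesis algA : unital_subalgebra A.
Hypothesis At : forall i, A (fun X => L (val (X i))).
Hypothesis Au : forall i j : 'I_m, (i <= j)%N ->
  A (scalar_map d (fun X => \tr (L (val (X i)) *m L (val (X j))))).

Let A1 : A (fun=> 1%:M). Proof. by case: algA. Qed.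
Let AZ c (F : mxmap K m d) : A F -> A (fun X => c *: F X). Proof. by case: algA => _ + _ _; apply. Qed.
Let AD (F G : mxmap K m d) : A F -> A G -> A (fun X => F X + G X).
Proof. by case: algA => _ _ + _; apply. Qed.
Let AM (F G : mxmap K m d) : A F -> A G -> A (fun X => F X *m G X).
Proof. by case: algA => _ _ _; apply. Qed.
Let Aext (F G : mxmap K m d) : A F -> (forall X, F X = G X) -> A G.
Proof. by move=> AF /funext <-. Qed.

(** The scalar functions whose associated scalar matrix lies in the algebra. *)
Definition scalar_in (f : T -> K) : Prop := A (scalar_map d f).

Lemma scalar_in_ext f g : scalar_in f -> (forall X, f X = g X) -> scalar_in g.
Proof. by move=> Af /funext <-. Qed.

Lemma scalar_inC c : scalar_in (fun=> c).
Proof. by apply: (Aext (AZ c A1)) => X; rewrite scalemx1. Qed.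

Lemma scalar_inD f g : scalar_in f -> scalar_in g -> scalar_in (fun X => f X + g X).
Proof. by move=> Af Ag; apply: (Aext (AD Af Ag)) => X; rewrite /scalar_map raddfD. Qed.

Lemma scalar_inM f g : scalar_in f -> scalar_in g -> scalar_in (fun X => f X * g X).
Proof. by move=> Af Ag; apply: (Aext (AM Af Ag)) => X; rewrite /scalar_map scalar_mxM. Qed.

Lemma scalar_inZ c f : scalar_in f -> scalar_in (fun X => c * f X).
Proof. exact/scalar_inM/scalar_inC. Qed.

Lemma scalar_mulA f (F : mxmap K m d) : scalar_in f -> A F -> A (fun X => f X *: F X).
Proof. by move=> Af AF; apply: (Aext (AM Af AF)) => X; rewrite mul_scalar_mx. Qed.

Lemma scalar_in_tr2 i j : scalar_in (fun X => \tr (val (X i) *m val (X j))).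
Proof.
have [k k0 kE] := trace_form.
have main (a b : 'I_m) : (a <= b)%N -> scalar_in (fun X => \tr (val (X a) *m val (X b))).
  move=> ab; apply: (scalar_in_ext (scalar_inZ k^-1 (Au ab))) => X.
  by rewrite kE ?val_sl2_tr // mulrA mulVf // mul1r.
have [ij|/ltnW ji] := leqP i j; first exact: main.
by apply: (scalar_in_ext (main _ _ ji)) => X; rewrite mxtrace_mulC.
Qed.

(** The alternating sum of the products of three elements of the representation is the
    Casimir value times the trace of the triple product: sl_2 has dimension 3, so it is
    enough to look at e, f, h, which give the Casimir operator. *)
Lemma triple_product X Y Z : \tr X = 0 -> \tr Y = 0 -> \tr Z = 0 ->
  L X *m (L Y *m L Z - L Z *m L Y) + L Y *m (L Z *m L X - L X *m L Z)
   + L Z *m (L X *m L Y - L Y *m L X) = ((n * n.+2)%:R * \tr (X *m Y *m Z))%:M.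
Proof.
move=> X0 Y0 Z0; rewrite !(lie_bracket D).
have br0 (B C : 'M[K]_2) : \tr (B *m C - C *m B) = 0.
  by rewrite linearB /= mxtrace_mulC subrr.
have tr11 (B : 'M[K]_2) : \tr B = 0 -> B o1 o1 = - B o0 o0.
  by move=> B0; apply/eqP; rewrite -addr_eq0 addrC -mxtrace2E B0.
have trXYZ : \tr (X *m Y *m Z) =
  - (X o0 o1 * (Y o0 o0 * Z o1 o0 - Y o1 o0 * Z o0 o0)
   + X o1 o0 * (Y o0 o1 * Z o0 o0 - Y o0 o0 * Z o0 o1)
   + X o0 o0 * (Y o1 o0 * Z o0 o1 - Y o0 o1 * Z o1 o0)).
  by rewrite mxtrace2E !mulmx2E (tr11 X) // (tr11 Y) // (tr11 Z) //; ring.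
have LE (B : 'M[K]_2) : \tr B = 0 -> L B =
    B o0 o1 *: L (sl2e K) + (B o1 o0 *: L (sl2f K) + B o0 o0 *: L (sl2h K)).
  by move=> B0; rewrite {1}(sl2_basis B0) !(lieD D) !(lieZ D).
have C := model_casimir M.
have -> : ((n * n.+2)%:R * \tr (X *m Y *m Z))%:M = \tr (X *m Y *m Z) *:
    ((n * n.+2)%:R%:M : 'M[K]_d) by rewrite scale_scalar_mx mulrC.
rewrite -C trXYZ (LE X) // (LE Y) // (LE Z) // (LE (Y *m Z - _)) //.
rewrite (LE (Z *m X - _)) // (LE (X *m Y - _)) // !mulmxDl !mulmxDr -!scalemxAl -!scalemxAr.
move: (L (sl2e K)) (L (sl2f K)) (L (sl2h K)) => E F H.
move: (E *m E) (E *m F) (E *m H) (F *m E) (F *m F) (F *m H) (H *m E) (H *m F) (H *m H).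
move=> EE EF EH FE FF FH HE HF HH.
by apply/matrixP => i j; rewrite !mxE !sum2 /= (tr11 X) // (tr11 Y) // (tr11 Z) //; ring.
Qed.

(** The trace of X_i X_j X_k is not among the given scalars; it is obtained from the
    matrices of the representation. *)
Lemma scalar_in_tr3 i j k :
  scalar_in (fun X => \tr (val (X i) *m val (X j) *m val (X k))).
Proof.
pose N := (n * n.+2)%:R : K.
have N0 : N != 0 by rewrite /N pnatr_eq0 muln_eq0 /= orbF -lt0n.
pose comm (F G : mxmap K m d) : mxmap K m d := fun X => F X *m G X + (-1) *: (G X *m F X).
have Acomm (F G : mxmap K m d) : A F -> A G -> A (comm F G).
  by move=> AF AG; apply: AD (AM AF AG) (AZ _ (AM AG AF)).
pose t i : mxmap K m d := fun X => L (val (X i)).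
have H := AD (AD (AM (At i) (Acomm _ _ (At j) (At k))) (AM (At j) (Acomm _ _ (At k) (At i))))
   (AM (At k) (Acomm _ _ (At i) (At j))).
apply: (Aext (AZ N^-1 H)) => X; rewrite /comm !scaleN1r triple_product ?val_sl2_tr //.
by rewrite scale_scalar_mx mulrA mulVf // mul1r.
Qed.

(** The maps with values in the 2 x 2 matrices obtained, over the scalars of the
    algebra, from the identity and the products of at most two of the [X i]; they
    form an algebra. *)
Inductive word : (T -> 'M[K]_2) -> Prop :=
| word_scalar f : scalar_in f -> word (fun X => (f X)%:M)
| word_gen i : word (fun X => val (X i))
| word_gen2 i j : word (fun X => val (X i) *m val (X j))
| word_add W W' : word W -> word W' -> word (fun X => W X + W' X)
| word_scale f W : scalar_in f -> word W -> word (fun X => f X *: W X).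

Lemma word_ext W W' : word W -> (forall X, W X = W' X) -> word W'.
Proof. by move=> wW /funext <-. Qed.

Lemma word_tr W : word W -> scalar_in (fun X => \tr (W X)).
Proof.
elim=> {W} [f If|i|i j|W W' _ IH _ IH'|f W If _ IH].
- by apply: (scalar_in_ext (scalar_inZ 2 If)) => X; rewrite mxtrace_scalar mulr_natl.
- by apply: (scalar_in_ext (scalar_inC 0)) => X; rewrite val_sl2_tr.
- exact: scalar_in_tr2.
- by apply: (scalar_in_ext (scalar_inD IH IH')) => X; rewrite mxtraceD.
- by apply: (scalar_in_ext (scalar_inM If IH)) => X; rewrite mxtraceZ.
Qed.

Lemma word_lie W : word W -> A (fun X => L (W X)).
Proof.
elim=> {W} [f If|i|i j|W W' _ IH _ IH'|f W If _ IH].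
- by apply: (Aext (AZ 0 A1)) => X; rewrite (diff_scalar D) scale0r.
- exact: At.
- have H := AZ 2^-1 (AD (AM (At i) (At j)) (AZ (-1) (AM (At j) (At i)))).
  apply: (Aext H) => X; rewrite scaleN1r (lie_bracket D) -(lieZ D).
  rewrite -(lie_traceless D) -[RHS](lie_traceless D); congr L.
  have := val_sl2_tr (X i); have := val_sl2_tr (X j); rewrite !mxtrace2E.
  move/eqP; rewrite addr_eq0 => /eqP e1; move/eqP; rewrite addr_eq0 => /eqP e2.
  apply: mx2P; rewrite /traceless !mxE ?mxtrace2E !mxE !sum2 ?mxE /= ?mulr1n ?mulr0n e1 e2; by field.
- by apply: (Aext (AD IH IH')) => X; rewrite (lieD D).
- by apply: (Aext (scalar_mulA If IH)) => X; rewrite (lieZ D).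
Qed.

Lemma word_mul_gen i W : word W -> word (fun X => val (X i) *m W X).
Proof.
elim=> {W} [f If|j|j k|W W' _ IH _ IH'|f W If _ IH].
- by apply: (word_ext (word_scale If (word_gen i))) => X; rewrite mul_mx_scalar.
- exact: word_gen2.
(* 2 P Q S = tr(P Q) S - tr(P S) Q + tr(Q S) P + tr(P Q S) for P, Q, S traceless. *)
- have H := word_add (word_add (word_scale (scalar_inZ 2^-1 (scalar_in_tr2 i j)) (word_gen k))
    (word_scale (scalar_inZ (- 2^-1) (scalar_in_tr2 i k)) (word_gen j)))
    (word_add (word_scale (scalar_inZ 2^-1 (scalar_in_tr2 j k)) (word_gen i))
      (word_scalar (scalar_inZ 2^-1 (scalar_in_tr3 i j k)))).
  apply: (word_ext H) => X.
  have := val_sl2_tr (X i); have := val_sl2_tr (X j); have := val_sl2_tr (X k).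
  move: (val (X i)) (val (X j)) (val (X k)) => P Q S; rewrite !mxtrace2E.
  move/eqP; rewrite addr_eq0 => /eqP e1; move/eqP; rewrite addr_eq0 => /eqP e2.
  move/eqP; rewrite addr_eq0 => /eqP e3.
  by apply: mx2P; rewrite /= !(mulmx2E, mxtrace2E, mxE) /= ?mulr1n ?mulr0n e1 e2 e3; field.
- by apply: (word_ext (word_add IH IH')) => X; rewrite mulmxDr.
- by apply: (word_ext (word_scale If IH)) => X; rewrite -scalemxAr.
Qed.

Lemma word_mul W W' : word W -> word W' -> word (fun X => W X *m W' X).
Proof.
move=> wW wW'; elim: wW => {W} [f If|i|i j|W1 W2 _ IH _ IH'|f W1 If _ IH].
- by apply: (word_ext (word_scale If wW')) => X; rewrite mul_scalar_mx.
- exact: word_mul_gen.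
- apply: (word_ext (word_mul_gen i (word_mul_gen j wW'))) => X.
  by rewrite mulmxA.
- by apply: (word_ext (word_add IH IH')) => X; rewrite mulmxDl.
- by apply: (word_ext (word_scale If IH)) => X; rewrite -scalemxAl.
Qed.

Lemma word1 : word (fun=> 1%:M).
Proof. exact: (word_scalar (scalar_inC 1)). Qed.

Lemma wordZ c W : word W -> word (fun X => c *: W X).
Proof. exact/word_scale/scalar_inC. Qed.

(** The adjugate. *)
Definition adj2 (B : 'M[K]_2) : 'M[K]_2 := (\tr B)%:M - B.

Lemma word_adj W : word W -> word (fun X => adj2 (W X)).
Proof.
move=> wW; have H := word_add (word_scalar (word_tr wW)) (wordZ (-1) wW).
by apply: (word_ext H) => X; rewrite scaleN1r.
Qed.

Lemma word_traceless W : word W -> word (fun X => traceless (W X)).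
Proof.
move=> wW; have H := word_add wW (word_scalar (scalar_inZ (- 2^-1) (word_tr wW))).
by apply: (word_ext H) => X; rewrite /traceless -raddfN /= mulNr mulrC.
Qed.

End InvariantsAndWords.

(** * Contraction of brackets *)

Section Contraction.
Variables (K : numClosedFieldType) (I : finType) (T : Type).
Variables (Inv : (T -> K) -> Prop) (Word : (T -> 'M[K]_2) -> Prop).
Hypothesis InvM : forall f g, Inv f -> Inv g -> Inv (fun X => f X * g X).
Hypothesis InvC : forall c, Inv (fun=> c).
Hypothesis WordM : forall W W', Word W -> Word W' -> Word (fun X => W X *m W' X).
Hypothesis WordZ : forall c W, Word W -> Word (fun X => c *: W X).
Hypothesis WordA : forall W, Word W -> Word (fun X => adj2 (W X)).
Hypothesis WordT : forall W, Word W -> Inv (fun X => \tr (W X)).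
Local Notation BC := (bracket_class Inv Word).

(** The adjugate is the adjoint for the bracket. *)
Lemma br_adj (W : 'M[K]_2) x y : br (W *m x) y = br x (adj2 W *m y).
Proof. by rewrite /br /adj2 !mulmx2E !mxE mxtrace2E /= mulr1n mulr0n; ring. Qed.

Lemma brZr c (x y : 'cV[K]_2) : br x (c *: y) = c * br x y.
Proof. by rewrite /br !mxE; ring. Qed.

Lemma bracket_class_local (J : {set I}) p : BC J p ->
  forall X v v', (forall i, i \in J -> v i = v' i) -> p X v = p X v'.
Proof.
elim=> {J p} [f If|J|J p q _ IHp _ IHq|i j J W p ij iJ jJ WW _ IHp] X v v' vv' //.
  by rewrite (IHp _ _ v') // (IHq _ _ v').
rewrite (vv' i) ?(vv' j) ?inE ?eqxx ?orbT // (IHp _ _ v') // => k kJ.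
by apply: vv'; rewrite !inE kJ !orbT.
Qed.

(** Combinations of products in which the index [i] occurs on the left of the
    first bracket. *)
Inductive headed (i : I) (J : {set I}) : (T -> (I -> 'cV[K]_2) -> K) -> Prop :=
| headed_zero : headed i J (fun _ _ => 0)
| headed_add p q : headed i J p -> headed i J q -> headed i J (fun X v => p X v + q X v)
| headed_edge k W p : k \in J -> k != i -> Word W -> BC (J :\ i :\ k) p ->
    headed i J (fun X v => br (v i) (W X *m v k) * p X v).

(** Any index can be moved to the left of a first bracket, as
    [x, W y] = - [y, adj(W) x]. *)
Lemma bracket_class_headed J p i : BC J p -> i \in J -> headed i J p.
Proof.
elim=> {J p} [f If|J|J p q _ IHp _ IHq|a b J W p ab aJ bJ WW cp IHp] iJ.
- by rewrite inE in iJ.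
- exact: headed_zero.
- exact: headed_add (IHp iJ) (IHq iJ).
have [ia|ia] := eqVneq i a.
  rewrite ia; apply: headed_edge => //; first by rewrite !inE eqxx orbT.
    by rewrite eq_sym.
  have -> : (a |: (b |: J)) :\ a :\ b = J; last by [].
  apply/setP => x; rewrite !inE.
  have [->|xb] := eqVneq x b; first by rewrite (negbTE bJ) ?andbF.
  by have [->|xa] := eqVneq x a; first by rewrite (negbTE aJ) ?andbF.
have [ib|ib] := eqVneq i b.
  have -> : (fun X v => br (v a) (W X *m v b) * p X v) =
      (fun X v => br (v i) ((-1 *: adj2 (W X)) *m v a) * p X v).
    apply/funext => X; apply/funext => v; congr (_ * _).
    by rewrite ib -scalemxAl brZr -br_adj [RHS]mulN1r -br_antisym.
  apply: (headed_edge (W := fun X => -1 *: adj2 (W X))) => //; first by rewrite !inE eqxx.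
  - by rewrite eq_sym.
  - exact/WordZ/WordA.
  have -> : (a |: (b |: J)) :\ i :\ a = J; last by [].
  apply/setP => x; rewrite !inE ib.
  have [->|xb] := eqVneq x b; first by rewrite (negbTE bJ) ?andbF.
  by have [->|xa] := eqVneq x a; first by rewrite (negbTE aJ) ?andbF.
have {}iJ : i \in J by move: iJ; rewrite !inE (negbTE ia) (negbTE ib).
elim: {IHp cp} (IHp iJ) => [|p1 p2 _ IH1 _ IH2|k W' q kJ ki WW' cq].
- have -> : (fun X (v : I -> 'cV[K]_2) => br (v a) (W X *m v b) * 0) = (fun _ _ => 0).
    by apply/funext => X; apply/funext => v; rewrite mulr0.
  exact: headed_zero.
- have -> : (fun X (v : I -> 'cV[K]_2) => br (v a) (W X *m v b) * (p1 X v + p2 X v)) =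
      (fun X v => br (v a) (W X *m v b) * p1 X v + br (v a) (W X *m v b) * p2 X v).
    by apply/funext => X; apply/funext => v; rewrite mulrDr.
  exact: headed_add.
have -> : (fun X (v : I -> 'cV[K]_2) => br (v a) (W X *m v b) * (br (v i) (W' X *m v k) * q X v)) =
    (fun X v => br (v i) (W' X *m v k) * (br (v a) (W X *m v b) * q X v)).
  by apply/funext => X; apply/funext => v; rewrite mulrCA.
have ka : k != a by apply: contraNneq aJ => <-.
have kb : k != b by apply: contraNneq bJ => <-.
apply: headed_edge => //; first by rewrite !inE kJ !orbT.
have -> : (a |: (b |: J)) :\ i :\ k = a |: (b |: (J :\ i :\ k)).
  apply/setP => x; rewrite !inE.
  have [->|xa] := eqVneq x a; first by rewrite ![a == _]eq_sym ka ia.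
  by have [->|xb] := eqVneq x b; first by rewrite ![b == _]eq_sym kb ib.
by apply: BC_edge => //; rewrite !inE ?(negbTE aJ) ?(negbTE bJ) ?andbF.
Qed.

(** Contraction of the arguments [i] and [j] by a map [Z]: the sum over a basis of
    K^2 of the values at [Z e] and at the dual vector of [e] for the bracket. *)
Definition contract (i j : I) (Z : T -> 'M[K]_2) (p : T -> (I -> 'cV[K]_2) -> K) :
    T -> (I -> 'cV[K]_2) -> K :=
  fun X v => p X (upd (upd v i (Z X *m e0 K)) j (- e1 K)) +
             p X (upd (upd v i (Z X *m e1 K)) j (e0 K)).

(** The class of brackets is stable under contraction. Either i and j are joined by a
    bracket, which becomes a trace, or the brackets [v_i, W v_k] and [v_j, W' v_l] merge
    into one bracket of v_l and v_k. *)
Lemma contract_class J p i j Z : Word Z -> BC J p -> i \in J -> j \in J -> i != j ->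
  BC (J :\ i :\ j) (contract i j Z p).
Proof.
move=> wZ cp iJ jJ ij; elim: (bracket_class_headed cp iJ) => [|p1 p2 _ IH1 _ IH2|k W q kJ ki wW cq].
- by apply: (bracket_class_ext (BC_zero Inv Word _)) => X v; rewrite /contract addr0.
- by apply: (bracket_class_ext (BC_add IH1 IH2)) => X v; rewrite /contract addrACA.
have loc X v z t (q' : T -> (I -> 'cV[K]_2) -> K) (J' : {set I}) :
    BC J' q' -> i \notin J' -> j \notin J' -> q' X (upd (upd v i z) j t) = q' X v.
  move=> cq' iJ' jJ'; apply: (bracket_class_local cq') => l lJ'.
  by rewrite !upd_other //; [apply: contraNneq iJ' => <-|apply: contraNneq jJ' => <-].
have [kj|kj] := eqVneq k j.
  rewrite kj in cq *.
  have I1 : Inv (fun X => -1 * \tr (adj2 (W X) *m Z X)).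
    by apply: InvM => //; apply: (WordT (WordM (WordA wW) wZ)).
  apply: (bracket_class_ext (bracket_class_scale InvM I1 cq)) => X v.
  rewrite /contract !(loc X v _ _ _ _ cq) ?inE ?eqxx ?andbF //.
  rewrite !(upd_other _ _ ij) ?upd_same // -mulrDl; congr (_ * _).
  rewrite /br /adj2 [\tr (_ *m _)]mxtrace2E !mulmx2E !mxE !mxtrace2E /= ?mulr1n ?mulr0n. ring.
have jJ' : j \in J :\ i :\ k by rewrite !inE eq_sym kj eq_sym ij.
elim: (bracket_class_headed cq jJ') => [|q1 q2 _ IH1 _ IH2|l W' r lJ lj wW' cr].
- apply: (bracket_class_ext (BC_zero Inv Word _)) => X v.
  by rewrite /contract !mulr0 addr0.
- apply: (bracket_class_ext (BC_add IH1 IH2)) => X v; rewrite /contract !mulrDr addrACA.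
  by [].
move: (lJ); rewrite !inE => /and3P[lk li lJ'].
pose W2 X := adj2 (W' X) *m adj2 (Z X) *m W X.
have wW2 : Word W2 by apply: WordM => //; apply: WordM; exact: WordA.
have JE : J :\ i :\ j = l |: (k |: (J :\ i :\ k :\ j :\ l)).
  apply/setP => x; rewrite !inE.
  have [->|xl] := eqVneq x l; first by rewrite li lj lJ'.
  by have [->|xk] := eqVneq x k; first by rewrite ki kj kJ.
rewrite JE; apply: (bracket_class_ext (BC_edge lk _ _ wW2 cr)); rewrite ?inE ?eqxx ?andbF //.
move=> X v; rewrite /contract !(loc X v _ _ _ _ cr) ?inE ?eqxx ?andbF //.
rewrite !(upd_other _ _ ij) !(upd_other _ _ kj) !(upd_other _ _ ki).
rewrite !(upd_other _ _ lj) !(upd_other _ _ li) !upd_same.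
rewrite !mulrA -mulrDl; congr (_ * _).
rewrite -mulmxA -mulmxA -!br_adj /br !mulmx2E !mxE /= ?mulr1n ?mulr0n; ring.
Qed.

End Contraction.

(** * Brackets of two vectors *)

Section TwoVectors.
Variables (K : numClosedFieldType) (T : Type).
Variables (Inv : (T -> K) -> Prop) (Word : (T -> 'M[K]_2) -> Prop).
Hypothesis Word1 : Word (fun=> 1%:M).
Hypothesis WordM : forall W W', Word W -> Word W' -> Word (fun X => W X *m W' X).
Hypothesis WordZ : forall c W, Word W -> Word (fun X => c *: W X).
Hypothesis WordA : forall W, Word W -> Word (fun X => adj2 (W X)).
Local Notation fn := (T -> 'cV[K]_2 -> 'cV[K]_2 -> K).

(** Combinations of products of brackets of two vectors, homogeneous of the given
    degrees in each of them. *)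
Inductive pair_class : nat -> nat -> fn -> Prop :=
| PC_inv f : Inv f -> pair_class 0 0 (fun X _ _ => f X)
| PC_zero a b : pair_class a b (fun _ _ _ => 0)
| PC_add a b p q : pair_class a b p -> pair_class a b q ->
    pair_class a b (fun X v w => p X v w + q X v w)
| PC_vv a b W p : Word W -> pair_class a b p ->
    pair_class a.+2 b (fun X v w => br v (W X *m v) * p X v w)
| PC_ww a b W p : Word W -> pair_class a b p ->
    pair_class a b.+2 (fun X v w => br w (W X *m w) * p X v w)
| PC_vw a b W p : Word W -> pair_class a b p ->
    pair_class a.+1 b.+1 (fun X v w => br v (W X *m w) * p X v w).

(** Combinations of products of [k] mixed brackets and of [c] brackets containing the
    first vector twice, the latter being placed in front; no bracket contains the
    second vector twice. *)
Inductive mixed_class : nat -> nat -> fn -> Prop :=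
| MC_inv f : Inv f -> mixed_class 0 0 (fun X _ _ => f X)
| MC_zero k c : mixed_class k c (fun _ _ _ => 0)
| MC_add k c p q : mixed_class k c p -> mixed_class k c q ->
    mixed_class k c (fun X v w => p X v w + q X v w)
| MC_vw k W p : Word W -> mixed_class k 0 p ->
    mixed_class k.+1 0 (fun X v w => br v (W X *m w) * p X v w)
| MC_vv k c W p : Word W -> mixed_class k c p ->
    mixed_class k c.+1 (fun X v w => br v (W X *m v) * p X v w).

Lemma mixed_class_ext k c p q : mixed_class k c p ->
  (forall X v w, p X v w = q X v w) -> mixed_class k c q.
Proof.
move=> cp pq; suff -> : q = p by [].
by apply/funext => X; apply/funext => v; apply/funext => w; rewrite pq.
Qed.

Lemma mixed_class_vw k c W p : Word W -> mixed_class k c p ->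
  mixed_class k.+1 c (fun X v w => br v (W X *m w) * p X v w).
Proof.
move=> wW cp; elim: cp => {k c p} [f If|k c|k c p q _ IHp _ IHq|k W' p wW' cp IHp|k c W' p wW' cp IHp].
- by apply: MC_vw => //; exact: MC_inv.
- by apply: (mixed_class_ext (MC_zero _ _)) => X v w; rewrite mulr0.
- by apply: (mixed_class_ext (MC_add IHp IHq)) => X v w; rewrite mulrDr.
- by apply: MC_vw => //; exact: MC_vw.
- by apply: (mixed_class_ext (MC_vv wW' IHp)) => X v w; rewrite mulrCA.
Qed.

(** A bracket in [v] alone and a bracket in [w] alone are traded for mixed ones by
    the Pluecker relation. *)
Lemma mixed_class_ww k c W p : Word W -> mixed_class k c.+1 p ->
  mixed_class k.+2 c (fun X v w => br w (W X *m w) * p X v w).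
Proof.
move=> wW; move Ec: c.+1 => c' cp; move: c Ec.
elim: cp => {k c' p} [f If|k c'|k c' p q _ IHp _ IHq|k W' p wW' cp IHp|k c' W' p wW' cp IHp] c //.
- by move=> _; apply: (mixed_class_ext (MC_zero _ _)) => X v w; rewrite mulr0.
- by move=> /[dup] /IHp cp /IHq cq; apply: (mixed_class_ext (MC_add cp cq)) => X v w; rewrite mulrDr.
case=> ->.
have H1 := mixed_class_vw Word1 (mixed_class_vw (WordM (WordA wW') wW) cp).
have H2 := mixed_class_vw (WordZ (-1) (WordA wW')) (mixed_class_vw wW cp).
apply: (mixed_class_ext (MC_add H1 H2)) => X v w.
rewrite !mulrA -mulrDl; congr (_ * _).
rewrite /br /adj2 !(mulmx2E, mxtrace2E, mxE) /= ?mulr1n ?mulr0n; ring.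
Qed.

(** If the degrees are equal, all the brackets can be made mixed; in general only the
    vector of larger degree is left in brackets with itself. *)
Lemma pair_class_mixed a b p : pair_class a b p ->
  (forall c, a = (b + c.*2)%N -> mixed_class b c p) /\
  (forall c, b = (a + c.*2)%N -> mixed_class a c (fun X v w => p X w v)).
Proof.
have flip k c W q : Word W -> mixed_class k c q ->
    mixed_class k.+1 c (fun X v w => br w (W X *m v) * q X v w).
  move=> wW cq; apply: (mixed_class_ext (mixed_class_vw (WordZ (-1) (WordA wW)) cq)).
  by move=> X v w; rewrite -scalemxAl brZr -br_adj mulN1r -br_antisym.
have swap k q : mixed_class k 0 q -> mixed_class k 0 (fun X v w => q X w v).
  suff gen k' c' p' : mixed_class k' c' p' -> c' = 0%N ->
      mixed_class k' c' (fun X v w => p' X w v) by move/gen; apply.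
  elim=> {k q k' c' p'} [f If|k c|k c p1 q _ IHp _ IHq|k W p1 wW _ IHp|k c W p1 wW _ IHp] //.
  - by move=> _; exact: MC_inv.
  - by move=> _; exact: MC_zero.
  - by move=> c0; exact: MC_add (IHp c0) (IHq c0).
  - by move=> _; exact: flip wW (IHp erefl).
elim=> {a b p} [f If|a b|a b p q _ [IH1 IH2] _ [IH3 IH4]|a b W p wW cp [IH1 IH2]
  |a b W p wW cp [IH1 IH2]|a b W p wW cp [IH1 IH2]]; split=> c E.
- by case: c E => // _; exact: MC_inv.
- by case: c E => // _; exact: MC_inv.
- exact: MC_zero.
- exact: MC_zero.
- exact: MC_add (IH1 _ E) (IH3 _ E).
- exact: MC_add (IH2 _ E) (IH4 _ E).
- case: c E => [|c] E.
    rewrite addn0 in E; rewrite -E.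
    apply: (swap a.+2 (fun X v w => br w (W X *m w) * p X w v)).
    by apply: mixed_class_ww => //; apply: IH2; rewrite -E addn2.
  by apply: MC_vv => //; apply: IH1; move: E; rewrite doubleS !addnS => -[].
- by apply/mixed_class_ww => //; apply: IH2; rewrite E doubleS !addnS !addSn.
- by apply/mixed_class_ww => //; apply: IH1; rewrite E doubleS !addnS !addSn.
- case: c E => [|c] E.
    rewrite addn0 in E; rewrite -E.
    apply: (swap b.+2 (fun X v w => br w (W X *m w) * p X v w)).
    by apply: mixed_class_ww => //; apply: IH1; rewrite -E addn2.
  by apply: MC_vv => //; apply: IH2; move: E; rewrite doubleS !addnS => -[].
- by apply: mixed_class_vw => //; apply: IH1; move: E; rewrite addSn => -[].
- by apply: flip => //; apply: IH2; move: E; rewrite addSn => -[].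
Qed.

End TwoVectors.

Section Evaluation.
Variables (K : numClosedFieldType) (I : finType) (T : Type).
Variables (Inv : (T -> K) -> Prop) (Word : (T -> 'M[K]_2) -> Prop).
Hypothesis WordZ : forall c W, Word W -> Word (fun X => c *: W X).
Hypothesis WordA : forall W, Word W -> Word (fun X => adj2 (W X)).
Variable side : I -> bool.

Lemma pair_class_ext a b p q : pair_class Inv Word a b p ->
  (forall X v w, p X v w = q X v w) -> pair_class Inv Word a b q.
Proof.
move=> cp pq; suff -> : q = p by [].
by apply/funext => X; apply/funext => v; apply/funext => w; rewrite pq.
Qed.

(** The vectors v_i take the value v for i on one side and w for i on the other one. *)
Lemma bracket_class_pair J p : bracket_class Inv Word J p ->
  pair_class Inv Word #|[set i in J | side i]| #|[set i in J | ~~ side i]|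
    (fun X v w => p X (fun i => if side i then v else w)).
Proof.
elim=> {J p} [f If|J|J p q _ IHp _ IHq|i j J W p ij iJ jJ wW _ IHp].
- have c0 (P : pred I) : #|[set i in finset.set0 | P i]| = 0%N.
    by apply: eq_card0 => i; rewrite !inE.
  by rewrite !c0; exact: PC_inv.
- exact: PC_zero.
- exact: (PC_add IHp IHq).
have cE (P : pred I) : #|[set k in i |: (j |: J) | P k]| = (P i + (P j + #|[set k in J | P k]|))%N.
  have E (k : I) (B : {set I}) : k \notin B ->
      #|[set l in k |: B | P l]| = (P k + #|[set l in B | P l]|)%N.
    move=> kB; rewrite (cardsD1 k) !inE eqxx /=; congr (_ + _)%N.
    apply: eq_card => l; rewrite !inE; have [->|lk] := eqVneq l k => //=.
    by rewrite (negbTE kB).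
  by rewrite E ?E // !inE negb_or ij iJ.
rewrite !cE; case si: (side i); case sj: (side j) => /=.
- exact: (PC_vv wW IHp).
- exact: (PC_vw wW IHp).
- apply: (pair_class_ext (PC_vw (WordZ (-1) (WordA wW)) IHp)) => X v w.
  by rewrite -scalemxAl brZr -br_adj mulN1r -br_antisym.
- exact: (PC_ww wW IHp).
Qed.

End Evaluation.

(** * Products of brackets realized in the algebra *)

Section MultilinearCovariants.
Variables (K : numClosedFieldType) (m d n : nat).
Variables (Psi : SL2 K -> 'M[K]_d) (L : 'M[K]_2 -> 'M[K]_d).
Hypothesis D : differentiated Psi L.
Variables (psi : ('I_n -> 'cV[K]_2) -> 'cV[K]_d) (phi : ('I_n -> 'cV[K]_2) -> 'rV[K]_d).
Hypothesis M : sym_model Psi L psi phi.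
Hypotheses (d0 : (0 < d)%N) (n0 : (0 < n)%N).
Local Notation T := ('I_m -> sl2 K).
Variable A : set (mxmap K m d).
Hypothesis algA : unital_subalgebra A.
Hypothesis At : forall i, A (fun X => L (val (X i))).
Hypothesis Au : forall i j : 'I_m, (i <= j)%N ->
  A (scalar_map d (fun X => \tr (L (val (X i)) *m L (val (X j))))).

Let A1 : A (fun=> 1%:M). Proof. by case: algA. Qed.
Let AZ c (F : mxmap K m d) : A F -> A (fun X => c *: F X).
Proof. by case: algA => _ + _ _; apply. Qed.
Let AD (F G : mxmap K m d) : A F -> A G -> A (fun X => F X + G X).
Proof. by case: algA => _ _ + _; apply. Qed.
Let AM (F G : mxmap K m d) : A F -> A G -> A (fun X => F X *m G X).
Proof. by case: algA => _ _ _; apply. Qed.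
Let Aext (F G : mxmap K m d) : A F -> (forall X, F X = G X) -> A G.
Proof. by move=> AF /funext <-. Qed.

Local Notation Inv := (scalar_in A).
Local Notation Word := (word A).
Let WM W W' := @word_mul K m d n Psi L D psi phi M d0 n0 A algA At Au W W'.
Let WA W := @word_adj K m d n Psi L D psi phi M d0 n0 A algA Au W.
Let WT W := @word_tr K m d n Psi L D psi phi M d0 n0 A algA Au W.
Let WZ c W := @wordZ K m d A algA c W.
Let W1 : Word (fun=> 1%:M) := word1 algA.
Let WL W := @word_lie K m d Psi L D A algA At W.
Let WTl W := @word_traceless K m d n Psi L D psi phi M d0 n0 A algA Au W.

Lemma algebra_sum (B : finType) (P : pred B) (F : B -> mxmap K m d) :
  (forall b, P b -> A (F b)) -> A (fun X => \sum_(b | P b) F b X).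
Proof.
move=> AF; have key (r : seq B) : A (fun X => \sum_(b <- r | P b) F b X).
  elim: r => [|b r IHr].
    by apply: (Aext (AZ 0 A1)) => X; rewrite big_nil scale0r.
  case Pb: (P b); first by apply: (Aext (AD (AF b Pb) IHr)) => X; rewrite big_cons Pb.
  by apply: (Aext IHr) => X; rewrite big_cons Pb.
exact: key.
Qed.

(** The bihomogeneous form attached to a matrix-valued map. *)
Let value (G : mxmap K m d) X v w : K := (phi (fun=> v) *m G X *m psi (fun=> w)) 0 0.

(** Every product of n mixed brackets with words comes from an element of the
    algebra; induction on the number [r] of brackets whose word is not 1, by
    multiplying on the right with the representation of the last word and applying
    the Leibniz rule. *)
Lemma realize_product r (Wf : 'I_n -> T -> 'M[K]_2) : (r <= n)%N ->
  (forall k, Word (Wf k)) -> (forall k : 'I_n, (r <= k)%N -> Wf k = (fun=> 1%:M)) ->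
  exists2 G, A G & forall X v w, value G X v w = \prod_k br v (Wf k X *m w).
Proof.
elim: r Wf => [|r IHr] Wf rn wW Wid.
  exists (fun=> 1%:M) => // X v w; rewrite /value mulmx1 (phi_psi M) mxE /= mulr1n.
  under eq_bigr => k _ do rewrite Wid // mul1mx.
  by rewrite prodr_const card_ord.
pose kr := Ordinal rn; pose W := Wf kr; pose Z X := traceless (W X).
pose Wf0 := upd Wf kr (fun=> 1%:M).
have wW0 k : Word (Wf0 k) by rewrite /Wf0 /upd; case: eqP.
have Wid0 (k : 'I_n) : (r <= k)%N -> Wf0 k = (fun=> 1%:M).
  rewrite /Wf0 /upd; case: eqP => // /eqP kkr rk; apply: Wid.
  by rewrite ltn_neqAle rk andbT; apply: contra kkr => /eqP e; apply/eqP/val_inj.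
have [G0 AG0 G0E] := IHr Wf0 (ltnW rn) wW0 Wid0.
have /choice[Gk GkP] : forall k : 'I_n, exists G, (k < r)%N -> A G /\
    forall X v w, value G X v w = br v (Wf0 k X *m (Z X *m w)) *
      \prod_(l | l != k) br v (Wf0 l X *m w).
  move=> k; have [kr'|_] := boolP (k < r)%N; last by exists (fun=> 0).
  have := IHr (upd Wf0 k (fun X => Wf0 k X *m Z X)) (ltnW rn).
  case=> [l|l rl|G AG GE].
  - by rewrite /upd; case: eqP => _; [exact: (WM (wW0 k) (WTl (wW kr)))|exact: wW0].
  - by rewrite upd_other ?Wid0 //; apply: contraTneq rl => ->; rewrite -ltnNge.
  exists G => _; split=> // X v w; rewrite GE (bigD1 k) //= upd_same mulmxA; congr (_ * _).
  by apply: eq_bigr => l lk; rewrite upd_other.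
pose P X v w := \prod_(l | l != kr) br v (Wf0 l X *m w).
have nr0 : ((n - r)%:R : K) != 0 by rewrite pnatr_eq0 -lt0n subn_gt0.
(* By the Leibniz rule, G0 L(W) is the sum over the slots k of the product with the
   traceless part Z of W inserted at k. The slots k < r are removed by G_k, and the
   n - r remaining ones, whose word is 1, all give the same product. The last term
   restores the scalar part of W. *)
exists (fun X => (n - r)%:R^-1 *: (G0 X *m L (W X) + (-1) *: \sum_(k : 'I_n | (k < r)%N) Gk k X)
    + (\tr (W X) * 2^-1) *: G0 X).
  apply: AD; last first.
    apply: scalar_mulA => //; apply: (scalar_inM algA) (WT (wW kr)) (scalar_inC algA _).
  apply/AZ/AD; first exact: AM AG0 (WL (wW kr)).
  by apply/AZ/algebra_sum => k kr'; case: (GkP k kr').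
move=> X v w; rewrite /value !(mulmxDl, mulmxDr) -!scalemxAr -!scalemxAl.
rewrite !(mulmxDl, mulmxDr) -!scalemxAr -!scalemxAl mulmx_sumr mulmx_suml.
have G0val : (phi (fun=> v) *m G0 X *m psi (fun=> w)) 0 0 = br v w * P X v w.
  by rewrite -/(value G0 X v w) G0E (bigD1 kr) //= Wid0 // mul1mx.
have Lval : (phi (fun=> v) *m (G0 X *m L (W X)) *m psi (fun=> w)) 0 0 =
   \sum_(k : 'I_n | (k < r)%N) value (Gk k) X v w + (n - r)%:R * (br v (Z X *m w) * P X v w).
  rewrite -!mulmxA -(lie_traceless D) (psi_lie M) ?traceless_tr //.
  rewrite !mulmx_sumr summxE.
  pose h (u : 'I_n -> 'cV[K]_2) : K^o := (phi (fun=> v) *m (G0 X *m psi u)) 0 0.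
  pose h' (u : 'I_n -> 'cV[K]_2) : K^o := \prod_k br v (Wf0 k X *m u k).
  have hml : multilinear h.
    move=> u i c x y; rewrite /h (psi_multilinear M) !mulmxDr -!scalemxAr mxE.
    by congr (_ + _); rewrite mxE.
  have h'upd u k z : h' (upd u k z) = br v (Wf0 k X *m z) *
      \prod_(l | l != k) br v (Wf0 l X *m u l).
    rewrite /h' (bigD1 k) //= upd_same; congr (_ * _).
    by apply: eq_bigr => l lk; rewrite upd_other.
  have h'ml : multilinear h'.
    move=> u i c x y; rewrite !h'upd -[X in _ = X + _]/(c * _) mulrA -mulrDl; congr (_ * _).
    by rewrite mulmxDr -scalemxAr /br !mxE; ring.
  have hh u : h (fun=> u) = h' (fun=> u).
    by rewrite /h mulmxA -/(value G0 X v u) G0E.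
  rewrite -/Z in hml h'ml *.
  transitivity (\sum_k h' (upd (fun=> w) k (Z X *m w))).
    exact: (diagonal_derivative hml h'ml hh).
  rewrite (bigID (fun k : 'I_n => (k < r)%N)) /=; congr (_ + _).
    by apply: eq_bigr => k kr'; rewrite h'upd; case: (GkP k kr') => _ ->.
  rewrite (eq_bigr (fun=> br v (Z X *m w) * P X v w)); last first.
    move=> k; rewrite -leqNgt => rk; rewrite h'upd Wid0 // mul1mx; congr (_ * _).
    have [->//|kkr] := eqVneq k kr.
    rewrite (bigD1 kr) 1?eq_sym //= /P [RHS](bigD1 k) //= !Wid0 // !mul1mx; congr (_ * _).
    by apply: eq_bigl => l; rewrite andbC.
  rewrite (eq_bigl (fun k : 'I_n => true && (r <= k)%N)); last by move=> k; rewrite -leqNgt.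
  rewrite -(big_geq_mkord r n xpredT (fun=> br v (Z X *m w) * P X v w)).
  by rewrite sumr_const_nat mulr_natl.
have sumE : (\sum_(k : 'I_n | (k < r)%N) phi (fun=> v) *m Gk k X *m psi (fun=> w)) 0 0 =
    \sum_(k : 'I_n | (k < r)%N) value (Gk k) X v w by rewrite summxE.
move: Lval sumE G0val.
move: (phi _ *m (G0 X *m _) *m _) (\sum_(i | _) phi _ *m _ *m _) (phi _ *m G0 X *m _).
move=> m1 m2 m3 Lval sumE G0val; rewrite !mxE Lval sumE G0val.
rewrite mulN1r addrAC subrr add0r mulrA mulVf // mul1r.
rewrite (bigD1 kr) //= -/W.
have -> : \prod_(l < n | l != kr) br v (Wf l X *m w) = P X v w.
  by apply: eq_bigr => l lk; rewrite /Wf0 upd_other.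
rewrite /Z mulrA -mulrDl; congr (_ * _).
by rewrite /traceless mulmxBl mul_scalar_mx /br !mxE; ring.
Qed.

(** The n - k slots which the k brackets of [p] do not fill are left to arbitrary
    words, so that the brackets of [p] can be moved there one by one. *)
Lemma realize_mixed k p : mixed_class Inv Word k 0 p -> (k <= n)%N ->
  forall Wf : 'I_n -> T -> 'M[K]_2, (forall l, Word (Wf l)) ->
  exists2 G, A G & forall X v w, value G X v w =
    p X v w * \prod_(l : 'I_n | (k <= l)%N) br v (Wf l X *m w).
Proof.
suff gen k' c' p' : mixed_class Inv Word k' c' p' -> c' = 0%N -> (k' <= n)%N ->
  forall Wf : 'I_n -> T -> 'M[K]_2, (forall l, Word (Wf l)) ->
  exists2 G, A G & forall X v w, value G X v w =
    p' X v w * \prod_(l : 'I_n | (k' <= l)%N) br v (Wf l X *m w).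
  by move/gen; apply.
elim=> {k p k' c' p'} [f If|k c|k c p q _ IHp _ IHq|k W p wW _ IHp|//] c0 kn Wf wWf.
- have [l|G AG GE] := realize_product (leqnn n) wWf.
    by rewrite leqNgt ltn_ord.
  exists (fun X => f X *: G X); first exact: scalar_mulA.
  by move=> X v w; rewrite /value -scalemxAr -scalemxAl mxE -/(value G X v w) GE.
- exists (fun=> 0); first by apply: (Aext (AZ 0 A1)) => X; rewrite scale0r.
  by move=> X v w; rewrite /value mulmx0 mul0mx mxE mul0r.
- have [G1 AG1 G1E] := IHp c0 kn Wf wWf; have [G2 AG2 G2E] := IHq c0 kn Wf wWf.
  exists (fun X => G1 X + G2 X); first exact: AD.
  move=> X v w; rewrite /value mulmxDr mulmxDl mxE -/(value G1 X v w) -/(value G2 X v w).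
  by rewrite G1E G2E mulrDl.
have wWf' l : Word (upd Wf (Ordinal kn) W l) by rewrite /upd; case: eqP.
have [G AG GE] := IHp erefl (ltnW kn) _ wWf'.
exists G => // X v w; rewrite GE (bigD1 (Ordinal kn)) //= upd_same mulrCA mulrA; congr (_ * _).
apply: eq_big => [l|l /andP[_ lk]]; last by rewrite upd_other.
by rewrite ltn_neqAle andbC eq_sym.
Qed.

End MultilinearCovariants.

(** * Multilinear covariants *)

Section MultilinearEquivariant.
Variables (K : numClosedFieldType) (m d n : nat).
Variables (Psi : SL2 K -> 'M[K]_d) (L : 'M[K]_2 -> 'M[K]_d).
Hypothesis D : differentiated Psi L.
Variables (psi : ('I_n -> 'cV[K]_2) -> 'cV[K]_d) (phi : ('I_n -> 'cV[K]_2) -> 'rV[K]_d).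
Hypothesis M : sym_model Psi L psi phi.
Hypotheses (d0 : (0 < d)%N) (n0 : (0 < n)%N).
Variable A : set (mxmap K m d).
Hypothesis algA : unital_subalgebra A.
Hypothesis At : forall i, A (fun X => L (val (X i))).
Hypothesis Au : forall i j : 'I_m, (i <= j)%N ->
  A (scalar_map d (fun X => \tr (L (val (X i)) *m L (val (X j))))).

Let WM W W' := @word_mul K m d n Psi L D psi phi M d0 n0 A algA At Au W W'.
Let WA W := @word_adj K m d n Psi L D psi phi M d0 n0 A algA Au W.
Let WT W := @word_tr K m d n Psi L D psi phi M d0 n0 A algA Au W.
Let WZ c W := @wordZ K m d A algA c W.
Let W1 : word A (fun=> 1%:M) := word1 algA.
Let IM f g := @scalar_inM K m d A algA f g.
Let IC c := @scalar_inC K m d A algA c.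

(** The endomorphism u |-> [y, u] x of K^2. *)
Definition outer (x y : 'cV[K]_2) : 'M[K]_2 :=
  mat2 (- x o0 0 * y o1 0) (x o0 0 * y o0 0) (- x o1 0 * y o1 0) (x o1 0 * y o0 0).

Lemma outer_conj (g : SL2 K) x y :
  outer (val g *m x) (val g *m y) = val g *m outer x y *m invmx (val g).
Proof.
apply: (canRL (mulmxK (SL2_unitmx g))).
have := valP g; rewrite det2E => /eqP dg.
have Z (z : 'M[K]_2) : z = (val g o0 o0 * val g o1 o1 - val g o0 o1 * val g o1 o0) *: z.
  by rewrite dg scale1r.
rewrite [RHS]Z /outer; apply: mx2P; rewrite !(mulmx2E, mxE) /=; ring.
Qed.

Lemma outer_linearl c x x' y : outer (c *: x + x') y = c *: outer x y + outer x' y.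
Proof. by apply: mx2P; rewrite !mxE /=; ring. Qed.

Lemma outer_linearr c x y y' : outer x (c *: y + y') = c *: outer x y + outer x y'.
Proof. by apply: mx2P; rewrite !mxE /=; ring. Qed.

Lemma outer_resolution (Z : 'M[K]_2) :
  outer (Z *m e0 K) (- e1 K) + outer (Z *m e1 K) (e0 K) = Z.
Proof. by apply: mx2P; rewrite !(mulmx2E, mxE) /=; ring. Qed.

Variables (N : nat) (Tm : ('I_N -> 'M[K]_2) -> 'M[K]_d).
Hypothesis Tml : multilinear Tm.
Hypothesis Teq : forall g Z, Tm (fun k => val g *m Z k *m invmx (val g)) =
  Psi g *m Tm Z *m invmx (Psi g).
Variable c : 'I_N -> 'I_m.

(** Labels: two vectors for each matrix argument of [Tm], and the arguments of
    [phi] and of [psi]. *)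
Let I : finType := (('I_N + 'I_N) + ('I_n + 'I_n))%type.
Let lx (k : 'I_N) : I := inl (inl k).
Let ly (k : 'I_N) : I := inl (inr k).
Let lv (k : 'I_n) : I := inr (inl k).
Let lw (k : 'I_n) : I := inr (inr k).

(** The pairing of [phi], [Tm] and [psi], the matrix arguments of [Tm] in [s] being
    the X (c k) and the other ones being of rank one. *)
Let partial (s : seq 'I_N) (X : 'I_m -> sl2 K) (v : I -> 'cV[K]_2) : K :=
  (phi (fun l => v (lv l)) *m
   Tm (fun k => if k \in s then val (X (c k)) else outer (v (lx k)) (v (ly k))) *m
   psi (fun l => v (lw l))) 0 0.

(** The vectors on which [partial s] depends. *)
Let rest (s : seq 'I_N) : {set I} :=
  [set i : I | match i with inl (inl k) => k \notin s | inl (inr k) => k \notin s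
               | _ => true end].

Let full_form (v : I -> 'cV[K]_2) : K :=
  (phi (fun l => v (lv l)) *m Tm (fun k => outer (v (lx k)) (v (ly k))) *m
   psi (fun l => v (lw l))) 0 0.

Let full_multilinear : multilinear_on (rest [::]) full_form.
Proof.
split=> [v i a x y _|v v' vv']; last first.
  rewrite /full_form; congr ((_ *m _ *m _) 0 0).
  - by congr phi; apply/funext => l; apply: vv'; rewrite inE.
  - by congr Tm; apply/funext => k; rewrite !vv' // inE.
  - by congr psi; apply/funext => l; apply: vv'; rewrite inE.
case: i => [[k|k]|[k|k]].
- have E z : full_form (upd v (inl (inl k)) z) = (phi (fun l => v (lv l)) *m
     Tm (upd (fun l => outer (v (lx l)) (v (ly l))) k (outer z (v (ly k)))) *m
     psi (fun l => v (lw l))) 0 0.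
    rewrite /full_form; congr ((_ *m Tm _ *m _) 0 0).
    apply/funext => l; rewrite /upd /lx /ly /=.
    have -> : (inl (inl l) == inl (inl k) :> I) = (l == k) by [].
    by case: eqP => [->|].
  rewrite !E outer_linearl Tml mulmxDr mulmxDl -scalemxAr -scalemxAl mxE.
  by congr (_ + _); rewrite mxE.
- have E z : full_form (upd v (inl (inr k)) z) = (phi (fun l => v (lv l)) *m
     Tm (upd (fun l => outer (v (lx l)) (v (ly l))) k (outer (v (lx k)) z)) *m
     psi (fun l => v (lw l))) 0 0.
    rewrite /full_form; congr ((_ *m Tm _ *m _) 0 0).
    apply/funext => l; rewrite /upd /lx /ly /=.
    have -> : (inl (inr l) == inl (inr k) :> I) = (l == k) by [].
    by case: eqP => [->|].
  rewrite !E outer_linearr Tml mulmxDr mulmxDl -scalemxAr -scalemxAl mxE.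
  by congr (_ + _); rewrite mxE.
- have E z : full_form (upd v (inr (inl k)) z) = (phi (upd (fun l => v (lv l)) k z) *m
     Tm (fun l => outer (v (lx l)) (v (ly l))) *m psi (fun l => v (lw l))) 0 0.
    by rewrite /full_form; congr ((phi _ *m _ *m _) 0 0); apply/funext.
  rewrite !E (phi_multilinear M) !mulmxDl -!scalemxAl mxE.
  by congr (_ + _); rewrite mxE.
have E z : full_form (upd v (inr (inr k)) z) = (phi (fun l => v (lv l)) *m
     Tm (fun l => outer (v (lx l)) (v (ly l))) *m psi (upd (fun l => v (lw l)) k z)) 0 0.
  by rewrite /full_form; congr ((_ *m _ *m psi _) 0 0); apply/funext.
rewrite !E (psi_multilinear M) !mulmxDr -!scalemxAr mxE.
by congr (_ + _); rewrite mxE.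
Qed.

Let full_invariant : SL2_invariant full_form.
Proof.
move=> g v; rewrite /full_form -(phi_equivariant M) -(psi_equivariant M).
under [X in Tm X]eq_fun => k do rewrite outer_conj.
rewrite (Teq g (fun k => outer (v (lx k)) (v (ly k)))) (invmx_Psi D).
have PV : Psi g^-1%g *m Psi g = 1%:M by rewrite -(diff_repr D).2 mulVg (diff_repr D).1.
congr (_ 0 0); rewrite !mulmxA -(mulmxA (phi _)) PV mulmx1.
by rewrite -(mulmxA _ (Psi g^-1%g)) PV mulmx1.
Qed.

(** All the vectors are free at first and the first fundamental theorem applies;
    each argument X (c k) is then obtained by contraction of the vectors of label k. *)
Let partial_class s : uniq s -> bracket_class (scalar_in A) (word A) (rest s) (partial s).
Proof.
elim: s => [_|k s IHs /= /andP[ks us]].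
  apply: bracket_class_ext (SL2_first_fundamental IC IM W1 full_multilinear full_invariant) _.
  by move=> X v.
have lxr : lx k \in rest s by rewrite inE.
have lyr : ly k \in rest s by rewrite inE.
have wX : word A (fun X => val (X (c k))) by exact: word_gen.
have -> : rest (k :: s) = rest s :\ lx k :\ ly k.
  apply/setP; case=> [[l|l]|[l|l]]; rewrite !inE ?andbT //.
  - by rewrite negb_or.
  - by rewrite negb_or.
apply: bracket_class_ext (contract_class IM IC WM WZ WA WT wX (IHs us) lxr lyr _) _ => //.
move=> X v; pose u l := if l \in k :: s then val (X (c l)) else outer (v (lx l)) (v (ly l)).
have E x y : partial s X (upd (upd v (lx k) x) (ly k) y) =
    (phi (fun l => v (lv l)) *m Tm (upd u k (outer x y)) *m psi (fun l => v (lw l))) 0 0.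
  rewrite /partial; congr ((_ *m Tm _ *m _) 0 0).
  apply/funext => l; rewrite /upd /u inE.
  have -> : (lx l == ly k) = false by [].
  have -> : (lx l == lx k) = (l == k) by [].
  have -> : (ly l == ly k) = (l == k) by [].
  have -> : (ly l == lx k) = false by [].
  by case: eqP => [->|] //; rewrite (negbTE ks).
rewrite /contract !E /partial.
transitivity ((phi (fun l => v (lv l)) *m Tm (upd u k (val (X (c k)))) *m
   psi (fun l => v (lw l))) 0 0).
  rewrite -[in RHS](outer_resolution (val (X (c k)))) (multilinearD Tml).
  by rewrite mulmxDr mulmxDl [RHS]mxE.
congr ((_ *m Tm _ *m _) 0 0); apply/funext => l; rewrite /upd /u.
by case: eqP => [->|] //; rewrite inE eqxx.
Qed.

(** An equivariant multilinear map of the X_i lies in the algebra: paired with the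
    diagonal values of [phi] and [psi], it is a combination of products of n mixed
    brackets, which are realized in the algebra, and these pairings determine it. *)
Lemma multilinear_covariant : A (fun X => Tm (fun k => val (X (c k)))).
Proof.
have uniqN : uniq (enum 'I_N) := enum_uniq _.
pose side (i : I) := if i is inr (inl _) then true else false.
have := bracket_class_pair WZ WA side (partial_class uniqN).
have -> : #|[set i in rest (enum 'I_N) | side i]| = n.
  have lv_inj : injective lv by move=> a b [].
  rewrite -[RHS]card_ord -(card_codom lv_inj); apply: eq_card => i; rewrite !inE.
  apply/andP/codomP => [|[l ->] //].
  by case: i => [[l|l]|[l|l]] [] //; exists l.
have -> : #|[set i in rest (enum 'I_N) | ~~ side i]| = n.
  have lw_inj : injective lw by move=> a b [].
  rewrite -[RHS]card_ord -(card_codom lw_inj); apply: eq_card => i; rewrite !inE.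
  apply/andP/codomP => [|[l ->] //].
  by case: i => [[l|l]|[l|l]] []; rewrite ?mem_enum //; exists l.
move/(pair_class_mixed W1 WM WZ WA) => [/(_ 0%N) + _]; rewrite addn0 => /(_ erefl) mc.
have [G AG GE] := realize_mixed D M d0 n0 algA At Au mc (leqnn n) (fun=> W1).
have -> // : (fun X => Tm (fun k => val (X (c k)))) = G.
apply/funext => X; apply/eqP; rewrite -subr_eq0; apply/eqP/(phi_psi_separating M) => v w.
rewrite mulmxBr mulmxBl; apply/eqP; rewrite subr_eq0; apply/eqP/matrixP => i j.
rewrite !ord1 [RHS](GE X v w) [X in _ = _ * X]big1 ?mulr1 => [|l nl]; last first.
  by rewrite leqNgt ltn_ord in nl.
rewrite /partial /=; congr ((_ *m Tm _ *m _) 0 0).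
by apply/funext => k; rewrite mem_enum.
Qed.

End MultilinearEquivariant.

(** * Polynomial covariants *)

Section HomogeneousForms.
Variables (K : numFieldType) (U : lmodType K).

(** [F] is a homogeneous polynomial map of degree N: the diagonal of an N-linear map. *)
Definition form (V : lmodType K) (N : nat) (F : U -> V) :=
  exists2 tau : ('I_N -> U) -> V, multilinear tau & forall Z, F Z = tau (fun=> Z).

Lemma form_ext (V : lmodType K) N (F G : U -> V) :
  form N F -> (forall Z, F Z = G Z) -> form N G.
Proof. by move=> fF /funext <-. Qed.

Lemma form_const (V : lmodType K) (c : V) : form 0 (fun=> c).
Proof. by exists (fun=> c) => // v []. Qed.

Lemma form0 (V : lmodType K) N : form N (fun=> 0 : V).
Proof. by exists (fun=> 0) => // v i c x y; rewrite scaler0 addr0. Qed.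

Lemma formD (V : lmodType K) N (F G : U -> V) :
  form N F -> form N G -> form N (fun Z => F Z + G Z).
Proof.
move=> [t tml tE] [u uml uE]; exists (fun v => t v + u v).
  by move=> v i c x y; rewrite tml uml scalerDr addrACA.
by move=> Z; rewrite tE uE.
Qed.

Lemma form_linear (f : U -> K) : (forall c x y, f (c *: x + y) = c * f x + f y) ->
  @form K^o 1 f.
Proof.
move=> fl; exists (fun u => f (u ord0)) => // v i c x y.
by rewrite (ord1 i) !upd_same fl.
Qed.

Lemma formM N1 N2 (f g : U -> K) : @form K^o N1 f -> @form K^o N2 g ->
  @form K^o (N1 + N2) (fun Z => f Z * g Z).
Proof.
move=> [t tml tE] [u uml uE].
exists (fun v => t (fun k => v (lshift N2 k)) * u (fun k => v (rshift N1 k))); last first.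
  by move=> Z; rewrite tE uE.
move=> v i c x y; case: (split_ordP i) => k ->.
- have El z : (fun l => upd v (lshift N2 k) z (lshift N2 l)) = upd (fun l => v (lshift N2 l)) k z.
    by apply/funext => l; rewrite /upd eq_lshift.
  have Er z : (fun l => upd v (lshift N2 k) z (rshift N1 l)) = (fun l => v (rshift N1 l)).
    by apply/funext => l; rewrite /upd eq_rlshift.
  by rewrite !El !Er tml mulrDl -[c *: _]/(c * _) -mulrA.
have El z : (fun l => upd v (rshift N1 k) z (rshift N1 l)) = upd (fun l => v (rshift N1 l)) k z.
  by apply/funext => l; rewrite /upd eq_rshift.
have Er z : (fun l => upd v (rshift N1 k) z (lshift N2 l)) = (fun l => v (lshift N2 l)).
  by apply/funext => l; rewrite /upd eq_lrshift.
by rewrite !El !Er uml mulrDr -[c *: _]/(c * _) mulrCA.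
Qed.

Lemma form_exp (f : U -> K) e : @form K^o 1 f -> @form K^o e (fun Z => f Z ^+ e).
Proof.
move=> ff; elim: e => [|e IHe]; first exact: (form_const (V := K^o) 1).
by apply: form_ext (formM ff IHe) _ => Z; rewrite exprS.
Qed.

Lemma form_prod (B : Type) (r : seq B) (e : B -> nat) (f : B -> U -> K) :
  (forall b, @form K^o 1 (f b)) ->
  @form K^o (\sum_(b <- r) e b) (fun Z => \prod_(b <- r) f b Z ^+ e b).
Proof.
move=> ff; elim: r => [|b r IHr].
  rewrite big_nil; apply: form_ext (form_const (V := K^o) 1) _ => Z.
  by rewrite big_nil.
rewrite big_cons; apply: form_ext (formM (form_exp (e b) (ff b)) IHr) _ => Z.
by rewrite big_cons.
Qed.

Lemma form_scale (V : lmodType K) N (f : U -> K) (v : V) :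
  @form K^o N f -> form N (fun Z => f Z *: v).
Proof.
move=> [t tml tE]; exists (fun u => t u *: v); last by move=> Z; rewrite tE.
by move=> u i c x y; rewrite tml scalerDl scalerA.
Qed.

Lemma form_homogeneous (V : lmodType K) N (F : U -> V) s Z :
  form N F -> F (s *: Z) = s ^+ N *: F Z.
Proof.
move=> [t tml tE]; rewrite !tE (multilinear_scale tml (fun=> s) (fun=> Z)).
by rewrite prodr_const card_ord.
Qed.

(** [F] is a finite sum of homogeneous polynomial maps, one in each degree. *)
Definition graded (V : lmodType K) (F : U -> V) :=
  exists D : nat, exists2 fs : nat -> U -> V, (forall N, form N (fs N)) &
    forall D', (D <= D')%N -> forall Z, F Z = \sum_(N < D') fs N Z.

Lemma graded_ext (V : lmodType K) (F G : U -> V) :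
  graded F -> (forall Z, F Z = G Z) -> graded G.
Proof. by move=> gF /funext <-. Qed.

Lemma graded_form (V : lmodType K) N (F : U -> V) : form N F -> graded F.
Proof.
move=> fF; exists N.+1; exists (fun k Z => if k == N then F Z else 0).
  move=> k; case: eqP => [->|_]; [exact: fF|exact: form0].
move=> D' ND' Z; rewrite (bigD1 (Ordinal ND')) //= eqxx big1 ?addr0 // => i iN.
by rewrite ifN.
Qed.

Lemma gradedD (V : lmodType K) (F G : U -> V) :
  graded F -> graded G -> graded (fun Z => F Z + G Z).
Proof.
move=> [D1 [f ff fE]] [D2 [g gg gE]]; exists (maxn D1 D2).
exists (fun N Z => f N Z + g N Z) => [N|D']; first exact: formD.
rewrite geq_max => /andP[D1' D2'] Z.
by rewrite big_split /= -(fE _ D1') -(gE _ D2').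
Qed.

Lemma graded_sum (V : lmodType K) (B : Type) (r : seq B) (F : B -> U -> V) :
  (forall b, graded (F b)) -> graded (fun Z => \sum_(b <- r) F b Z).
Proof.
move=> gF; elim: r => [|b r IHr].
  by apply: graded_ext (graded_form (form0 V 0)) _ => Z; rewrite big_nil.
by apply: graded_ext (gradedD (gF b) IHr) _ => Z; rewrite big_cons.
Qed.

End HomogeneousForms.

Section Symmetrization.
Variables (K : numFieldType) (U V : lmodType K) (N : nat).
Variable tau : ('I_N -> U) -> V.
Hypothesis tauml : multilinear tau.

(** The sum of [tau] over the rearrangements of its arguments. *)
Definition symmetrize (u : 'I_N -> U) : V :=
  \sum_(f : {ffun 'I_N -> 'I_N} | injectiveb f) tau (fun k => u (f k)).

Lemma symmetrize_multilinear : multilinear symmetrize.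
Proof.
move=> u i c x y; rewrite /symmetrize scaler_sumr -big_split /=.
apply: eq_bigr => f /injectiveP injf.
have [g fK gK] := injF_bij injf.
have E z : (fun k => upd u i z (f k)) = upd (fun k => u (f k)) (g i) z.
  by apply/funext => k; rewrite /upd -[k == _](inj_eq injf) gK.
by rewrite !E tauml.
Qed.

Lemma symmetrize_polarization (u : 'I_N -> U) : symmetrize u =
  \sum_(B : {set 'I_N}) (-1) ^+ #|~: B| *: tau (fun=> \sum_(a in B) u a).
Proof. by rewrite (polarization tauml). Qed.

Lemma symmetrize_diagonal : exists2 c : K, c != 0 &
  forall Z, symmetrize (fun=> Z) = c *: tau (fun=> Z).
Proof.
exists #|[pred f : {ffun 'I_N -> 'I_N} | injectiveb f]|%:R.
  rewrite pnatr_eq0 -lt0n; apply/card_gt0P; exists [ffun k => k].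
  by rewrite inE; apply/injectiveP => a b; rewrite !ffunE.
by move=> Z; rewrite /symmetrize sumr_const scaler_nat.
Qed.

End Symmetrization.

Section PolynomialCovariants.
Variables (K : numClosedFieldType) (m d n : nat).
Variables (Psi : SL2 K -> 'M[K]_d) (L : 'M[K]_2 -> 'M[K]_d).
Hypothesis D : differentiated Psi L.
Variables (psi : ('I_n -> 'cV[K]_2) -> 'cV[K]_d) (phi : ('I_n -> 'cV[K]_2) -> 'rV[K]_d).
Hypothesis M : sym_model Psi L psi phi.
Hypotheses (d0 : (0 < d)%N) (n0 : (0 < n)%N).
Variable A : set (mxmap K m d).
Hypothesis algA : unital_subalgebra A.
Hypothesis At : forall i, A (fun X => L (val (X i))).
Hypothesis Au : forall i j : 'I_m, (i <= j)%N ->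
  A (scalar_map d (fun X => \tr (L (val (X i)) *m L (val (X j))))).
Local Notation U := {ffun 'I_m -> 'M[K]_2}.

(** Extension of maps on the m-fold sum of sl_2 to tuples of 2 x 2 matrices. *)
Let hat (F : mxmap K m d) (Z : U) : 'M[K]_d := F (fun i => sl2_of (Z i)).

Lemma hat_graded F : polynomial_map F -> graded (hat F).
Proof.
move=> polF.
have E Z : hat F Z = \sum_(p : 'I_d * 'I_d) hat F Z p.1 p.2 *: delta_mx p.1 p.2.
  by rewrite {1}[hat F Z]matrix_sum_delta pair_bigA.
apply: graded_ext (fun Z => esym (E Z)); apply: graded_sum => -[a b] /=.
have [p pE] := polF a b.
have lin k : @form K U K^o 1 (fun Z => entries (fun i => sl2_of (Z i)) k).
  apply: form_linear => c x y; rewrite /entries; case: (enum_val k) => [[i r] s] /=.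
  by rewrite !ffunE traceless_linear !mxE.
have eE Z : hat F Z a b *: delta_mx a b = \sum_(u <- mpoly.msupp p)
    (mpoly.mcoeff u p * \prod_k entries (fun i => sl2_of (Z i)) k ^+ mpoly.fun_of_multinom u k) *: delta_mx a b
    :> 'M[K]_d.
  by rewrite /hat pE mpoly.mevalE scaler_suml.
apply: graded_ext (fun Z => esym (eE Z)); apply: graded_sum => u.
have f0 : @form K U K^o 0 (fun=> mpoly.mcoeff u p) by exact: form_const.
have f1 := form_prod (index_enum _) (fun k => mpoly.fun_of_multinom u k) lin.
exact: (graded_form (form_scale (delta_mx a b) (formM f0 f1))).
Qed.

(** The adjoint action on tuples. *)
Let conj_tuple (g : SL2 K) (Z : U) : U := [ffun i => val g *m Z i *m invmx (val g)].

Lemma hat_equivariant F g Z : equivariant Psi F ->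
  hat F (conj_tuple g Z) = Psi g *m hat F Z *m invmx (Psi g).
Proof.
move=> eqF; rewrite /hat -eqF; congr F; apply/funext => i.
by rewrite Ad_sl2_of ffunE.
Qed.

(** The homogeneous components of an equivariant map are equivariant: coefficients of
    the powers of s in the equivariance at s Z. *)
Lemma component_equivariant (F : U -> 'M[K]_d) (fs : nat -> U -> 'M[K]_d) D' g :
  (forall N, form N (fs N)) -> (forall Z, F Z = \sum_(N < D') fs N Z) ->
  (forall Z, F (conj_tuple g Z) = Psi g *m F Z *m invmx (Psi g)) ->
  forall N Z, (N < D')%N -> fs N (conj_tuple g Z) = Psi g *m fs N Z *m invmx (Psi g).
Proof.
move=> ffs FE eqF N Z ND; apply/eqP; rewrite -subr_eq0; apply/eqP/matrixP => a b.
pose E k := fs k (conj_tuple g Z) - Psi g *m fs k Z *m invmx (Psi g).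
pose P : {poly K} := \poly_(k < D') E k a b.
have P0 : P = 0.
  apply: poly_eval0 => s; rewrite horner_poly.
  have cZ : conj_tuple g (s *: Z) = s *: conj_tuple g Z.
    by apply/ffunP => i; rewrite !ffunE -scalemxAr -scalemxAl.
  have := eqF (s *: Z); rewrite cZ !FE.
  under eq_bigr => k _ do rewrite (form_homogeneous _ _ (ffs k)).
  under [in RHS]eq_bigr => k _ do rewrite (form_homogeneous _ _ (ffs k)).
  rewrite mulmx_sumr mulmx_suml => /eqP; rewrite -subr_eq0 -sumrB => /eqP/matrixP/(_ a b).
  rewrite summxE [X in _ = X]mxE => Hs; rewrite -[RHS]Hs; apply: eq_bigr => k _.
  rewrite -scalemxAr -scalemxAl -scalerBr [in RHS]mxE mulrC; congr (_ * _).
have := congr1 (fun p : {poly K} => p`_N) P0.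
by rewrite /= coef_poly ND coef0 => E0; rewrite [RHS]mxE -E0.
Qed.

(** The tuple with [z] at the place i and 0 elsewhere. *)
Let single (i : 'I_m) (z : 'M[K]_2) : U := [ffun j => if j == i then z else 0].

Lemma multilinear_covariant_diag N (t : ('I_N -> U) -> 'M[K]_d) : multilinear t ->
  (forall g u, t (fun k => conj_tuple g (u k)) = Psi g *m t u *m invmx (Psi g)) ->
  A (fun X => t (fun=> [ffun i => val (X i)])).
Proof.
move=> tml teq.
have Ac (c : {ffun 'I_N -> 'I_m}) : A (fun X => t (fun k => single (c k) (val (X (c k))))).
  apply: (multilinear_covariant D M d0 n0 algA At Au (Tm := fun Z => t (fun k => single (c k) (Z k)))).
    move=> Z k a x y.
    have E z : (fun l => single (c l) (upd Z k z l)) = upd (fun l => single (c l) (Z l)) k (single (c k) z).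
      by apply/funext => l; rewrite /upd; case: eqP => [->|].
    rewrite !E -tml; congr (t (upd _ _ _)); apply/ffunP => j; rewrite !ffunE.
    by case: eqP; rewrite ?scaler0 ?addr0.
  move=> g Z; rewrite -teq; congr t; apply/funext => k; apply/ffunP => j; rewrite !ffunE.
  by case: eqP; rewrite ?mulmx0 ?mul0mx.
have AS := algebra_sum (A := A) algA (P := xpredT) (fun c _ => Ac c).
have tE (X : 'I_m -> sl2 K) : t (fun=> [ffun i => val (X i)]) =
    \sum_(c : {ffun 'I_N -> 'I_m}) t (fun k => single (c k) (val (X (c k)))); last first.
  by rewrite (funext tE).
rewrite -(multilinear_expand tml (fun _ i => single i (val (X i)))).
congr t; apply/funext => _; apply/ffunP => i; rewrite sum_ffunE ffunE (bigD1 i) //=.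
rewrite ffunE eqxx big1 ?addr0 // => j ji; rewrite ffunE eq_sym; by rewrite (negbTE ji).
Qed.

(** Every covariant lies in the algebra. *)
Theorem covariant_in_algebra F : covariants m Psi F -> A F.
Proof.
case=> polF eqF.
have [D' [fs ffs FE]] := hat_graded polF.
have {}FE Z : hat F Z = \sum_(N < D') fs N Z by exact: FE.
have -> : F = (fun X => \sum_(N < D') fs N [ffun i => val (X i)]).
  apply/funext => X; rewrite -FE /hat; congr F; apply/funext => i.
  by rewrite ffunE sl2_of_val.
apply: (algebra_sum algA (P := xpredT)
  (F := fun (N : 'I_D') X => fs N [ffun i => val (X i)])) => N _.
have [t tml tE] := ffs N.
have [c c0 cE] := symmetrize_diagonal t.
have fsE g Z := component_equivariant (g := g) ffs FE (fun Z => hat_equivariant g Z eqF) Z (ltn_ord N).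
have H : A (fun X => symmetrize t (fun=> [ffun i => val (X i)])).
  apply: multilinear_covariant_diag; first exact: symmetrize_multilinear.
  move=> g u; rewrite !symmetrize_polarization // mulmx_sumr mulmx_suml.
  apply: eq_bigr => B _; rewrite -scalemxAr -scalemxAl; congr (_ *: _).
  rewrite -!tE -fsE; congr (fs N _); apply/ffunP => i.
  rewrite sum_ffunE !ffunE sum_ffunE mulmx_sumr mulmx_suml.
  by apply: eq_bigr => k _; rewrite ffunE.
have fE (X : 'I_m -> sl2 K) : fs N [ffun i => val (X i)] =
    c^-1 *: symmetrize t (fun=> [ffun i => val (X i)]).
  by rewrite cE scalerA mulVf // scale1r -tE.
by rewrite (funext fE); case: algA => _ AZ _ _; apply: AZ.
Qed.

End PolynomialCovariants.

(* The ring of multivariate polynomials, without its notations. *)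
Import (canonicals) mpoly.

(** * The generators are covariants *)

Section PolynomialFunctions.
Variables (K : numClosedFieldType) (m : nat).
Implicit Types f g : ('I_m -> sl2 K) -> K.

Lemma polynomial_const c : polynomial_function (fun _ : 'I_m -> sl2 K => c).
Proof. by exists (mpoly.mpolyC _ c) => X; rewrite mpoly.mevalC. Qed.

Lemma polynomialD f g : polynomial_function f -> polynomial_function g ->
  polynomial_function (fun X => f X + g X).
Proof. by case=> p pE [q qE]; exists (p + q) => X; rewrite mpoly.mevalD pE qE. Qed.

Lemma polynomialM f g : polynomial_function f -> polynomial_function g ->
  polynomial_function (fun X => f X * g X).
Proof. by case=> p pE [q qE]; exists (p * q) => X; rewrite mpoly.mevalM pE qE. Qed.

Lemma polynomial_sum (I : Type) (r : seq I) (F : I -> ('I_m -> sl2 K) -> K) :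
  (forall i, polynomial_function (F i)) ->
  polynomial_function (fun X => \sum_(i <- r) F i X).
Proof.
move=> polF; elim: r => [|i r IH].
  by case: (polynomial_const 0) => p pE; exists p => X; rewrite big_nil -pE.
case: (polynomialD (polF i) IH) => p pE.
by exists p => X; rewrite big_cons -pE.
Qed.

Lemma polynomial_entry i a b :
  polynomial_function (fun X : 'I_m -> sl2 K => val (X i) a b).
Proof.
exists (mpoly.mpolyX K (mpoly.mnm1 (enum_rank (i, a, b)))) => X.
by rewrite mpoly.mevalXU /entries enum_rankK.
Qed.

End PolynomialFunctions.

Section CovariantAlgebra.
Variables (K : numClosedFieldType) (m d : nat).
Variables (Psi : SL2 K -> 'M[K]_d) (rho : sl2 K -> 'M[K]_d).
Hypothesis D : differentiated Psi (fun Z => rho (sl2_of Z)).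

Let Psi_unit g : Psi g \in unitmx.
Proof. exact: (Psi_unitmx D). Qed.

Lemma covariants_subalgebra : unital_subalgebra (covariants m Psi).
Proof.
split.
- split=> [a b|g X]; first exact: polynomial_const.
  by rewrite mulmx1 mulmxV.
- move=> c F [polF eqF]; split=> [a b|g X]; last first.
    by rewrite eqF -scalemxAr -scalemxAl.
  case: (polynomialM (polynomial_const m c) (polF a b)) => p pE.
  by exists p => X; rewrite mxE pE.
- move=> F G [polF eqF] [polG eqG]; split=> [a b|g X]; last first.
    by rewrite eqF eqG mulmxDr mulmxDl.
  case: (polynomialD (polF a b) (polG a b)) => p pE.
  by exists p => X; rewrite mxE pE.
- move=> F G [polF eqF] [polG eqG]; split=> [a b|g X]; last first.
    by rewrite eqF eqG !mulmxA mulmxKV.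
  case: (polynomial_sum (index_enum _) (fun k => polynomialM (polF a k) (polG k b))) => p pE.
  by exists p => X; rewrite mxE pE.
Qed.

Lemma t_elt_polynomial i : polynomial_map (@t_elt K m d rho i).
Proof.
move=> a b.
pose F k l (X : 'I_m -> sl2 K) := val (X i) k l * rho (sl2_of (delta_mx k l)) a b.
have polF k l : polynomial_function (F k l).
  exact: (polynomialM (polynomial_entry K i k l)
    (polynomial_const m (rho (sl2_of (delta_mx k l)) a b))).
case: (polynomial_sum (index_enum _) (fun k => polynomial_sum (index_enum _) (polF k))) => p pE.
exists p => X; rewrite -pE /t_elt -[in LHS](sl2_of_val (X i)).
rewrite [in LHS](matrix_sum_delta (val (X i))) (lie_sum D) summxE.
apply: eq_bigr => k _; rewrite (lie_sum D) summxE; apply: eq_bigr => l _.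
by rewrite (lieZ D) mxE.
Qed.

Lemma t_elt_equivariant i : equivariant Psi (@t_elt K m d rho i).
Proof.
move=> g X; rewrite /t_elt.
have := lie_equivariant D g (val (X i)); rewrite -Ad_sl2_of sl2_of_val => ->.
by rewrite mulmxK.
Qed.

Lemma u_elt_covariant i j : covariants m Psi (scalar_map d (u_elt rho i j)).
Proof.
split=> [a b|g X].
  pose F k l (X : 'I_m -> sl2 K) := rho (X i) k l * rho (X j) l k.
  have polF k l : polynomial_function (F k l).
    case: (polynomialM (t_elt_polynomial i k l) (t_elt_polynomial j l k)) => p pE.
    by exists p => Y; rewrite -pE.
  case: (polynomialM (polynomial_sum (index_enum _)
    (fun k => polynomial_sum (index_enum _) (polF k))) (polynomial_const m (a == b)%:R)) => p pE.
  exists p => X; rewrite -pE /scalar_map mxE mulr_natr; congr (_ *+ _).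
  by apply: eq_bigr => k _; rewrite mxE.
rewrite /scalar_map.
have -> : u_elt rho i j (fun k => Ad g (X k)) = u_elt rho i j X.
  rewrite /u_elt; have := t_elt_equivariant j g X; have := t_elt_equivariant i g X.
  rewrite /t_elt => -> ->; rewrite !mulmxA mulmxKV // mxtrace_mulC.
  by rewrite !mulmxA mulVmx // mul1mx.
by rewrite scalar_mxC -mulmxA mulmxV ?mulmx1.
Qed.

End CovariantAlgebra.

(** * Minimality *)

Section TestAlgebra.
Variables (K : numClosedFieldType) (m d : nat).
Variables (q : 'I_m -> {poly K}) (V : nat -> 'M[K]_d -> Prop).

(** The curve s |-> (q_1(s) h, ..., q_m(s) h), with h the diagonal matrix (1, -1). *)
Definition curve (s : K) : 'I_m -> sl2 K :=
  fun k => sl2_of ((q k).[s] *: sl2h K).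

(** The maps whose restriction to the curve is polynomial in s, with coefficient of s^r
    in V_r for all r. *)
Definition test_algebra : set (mxmap K m d) := fun F =>
  exists2 P : 'M[{poly K}]_d,
    forall s, F (curve s) = map_mx (horner^~ s) P &
    forall r, V r (map_mx (coefp r) P).

Hypothesis V1 : V 0 1%:M.
Hypothesis V0 : forall r, V r 0.
Hypothesis VD : forall r A B, V r A -> V r B -> V r (A + B).
Hypothesis VZ : forall r c A, V r A -> V r (c *: A).
Hypothesis VM : forall j l A B, V j A -> V l B -> V (j + l)%N (A *m B).

Lemma test_algebra_subalgebra : unital_subalgebra test_algebra.
Proof.
split.
- exists 1%:M => [s|r].
    by apply/matrixP => a b; rewrite !mxE -polyC1 -polyCMn hornerC.
  have -> : map_mx (coefp r) (1%:M : 'M[{poly K}]_d) = (r == 0)%:R%:M.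
    by apply/matrixP => a b; rewrite !mxE /= coefMn coef1.
  by case: r => //= r; rewrite raddf0; apply: V0.
- move=> c F [P FP VP]; exists (map_mx (fun p => c *: p) P) => [s|r].
    by rewrite FP; apply/matrixP => a b; rewrite !mxE hornerZ.
  have -> : map_mx (coefp r) (map_mx (fun p => c *: p) P) = c *: map_mx (coefp r) P.
    by apply/matrixP => a b; rewrite !mxE /= coefZ.
  exact: VZ.
- move=> F G [P FP VP] [Q GQ VQ]; exists (P + Q) => [s|r].
    by rewrite FP GQ; apply/matrixP => a b; rewrite !mxE hornerD.
  have -> : map_mx (coefp r) (P + Q) = map_mx (coefp r) P + map_mx (coefp r) Q.
    by apply/matrixP => a b; rewrite !mxE /= coefD.
  exact: VD.
- move=> F G [P FP VP] [Q GQ VQ]; exists (P *m Q) => [s|r].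
    rewrite FP GQ; apply/matrixP => a b; rewrite !mxE horner_sum.
    by apply: eq_bigr => k _; rewrite !mxE hornerM.
  have -> : map_mx (coefp r) (P *m Q) =
      \sum_(j < r.+1) map_mx (coefp j) P *m map_mx (coefp (r - j)%N) Q.
    apply/matrixP => a b; rewrite summxE !mxE /= coef_sum.
    rewrite (eq_bigr _ (fun k _ => coefM (P a k) (Q k b) r)).
    rewrite exchange_big; apply: eq_bigr => j _; rewrite mxE.
    by apply: eq_bigr => k _; rewrite !mxE.
  elim/big_ind: _ => [|A B|j _]; [exact: V0|exact: VD|].
  by have := VM (VP j) (VQ (r - j)%N); rewrite subnKC // -ltnS.
Qed.

Lemma test_algebraP F (p : {poly K}) A : (forall s, F (curve s) = p.[s] *: A) ->
  test_algebra F <-> forall r, V r (p`_r *: A).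
Proof.
move=> FE; split=> [[P FP VP] r|VA].
  suff -> : p`_r *: A = map_mx (coefp r) P by [].
  apply/matrixP => a b; rewrite !mxE /=.
  have -> : P a b = p * (A a b)%:P.
    apply: poly_eval_inj => s; rewrite hornerM hornerC.
    by have := FP s; rewrite FE => /matrixP/(_ a b); rewrite !mxE.
  by rewrite coefMC.
exists (map_mx (fun c => p * c%:P) A) => [s|r].
  by rewrite FE; apply/matrixP => a b; rewrite !mxE hornerM hornerC.
have -> // : map_mx (coefp r) (map_mx (fun c => p * c%:P) A) = p`_r *: A.
by apply/matrixP => a b; rewrite !mxE /= coefMC.
Qed.

Variables (Psi : SL2 K -> 'M[K]_d) (rho : sl2 K -> 'M[K]_d).
Hypothesis D : differentiated Psi (fun Z => rho (sl2_of Z)).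
Let h := rho (sl2_of (sl2h K)).

Lemma test_algebra_t i :
  test_algebra (t_elt rho i) <-> forall r, V r ((q i)`_r *: h).
Proof. by apply: test_algebraP => s; rewrite /t_elt /curve (lieZ D). Qed.

Lemma test_algebra_u i j : test_algebra (scalar_map d (u_elt rho i j)) <->
  forall r, V r ((q i * q j)`_r *: (\tr (h *m h))%:M).
Proof.
apply: test_algebraP => s; rewrite /scalar_map /u_elt /curve !(lieZ D).
by rewrite -scalemxAr -scalemxAl !mxtraceZ hornerM scale_scalar_mx mulrA [_.[s] * _]mulrC.
Qed.

End TestAlgebra.

Section Minimality.
Variables (K : numClosedFieldType) (m d n : nat).
Variables (Psi : SL2 K -> 'M[K]_d) (rho : sl2 K -> 'M[K]_d).
Hypothesis D : differentiated Psi (fun Z => rho (sl2_of Z)).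
Variables (psi : ('I_n -> 'cV[K]_2) -> 'cV[K]_d) (phi : ('I_n -> 'cV[K]_2) -> 'rV[K]_d).
Hypothesis M : sym_model Psi (fun Z => rho (sl2_of Z)) psi phi.
Hypotheses (d0 : (0 < d)%N) (n1 : (1 < n)%N).

Let h := rho (sl2_of (sl2h K)).

Lemma weight_not_scalar a : h <> a%:M.
Proof.
move=> ha; apply: (model_weights M n1 (a := a * a)).
by rewrite -/h ha -scalar_mxM.
Qed.

Lemma weight_square_trace : \tr (h *m h) != 0.
Proof.
have [kappa k0 kE] := trace_form D M d0 (ltnW n1).
rewrite kE ?sl2h_tr // mulf_neq0 //.
suff -> : \tr (sl2h K *m sl2h K) = 2 by rewrite pnatr_eq0.
by rewrite mxtrace2E !mulmx2E /sl2h !mat2E; ring.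
Qed.

(** The condition that the coefficients of s^0 and s^1 be scalar. *)
Definition low_scalar (r : nat) (A : 'M[K]_d) := (r <= 1)%N -> is_scalar_mx A.

(** The curve X_i = s h, X_k = 0 for k != i. *)
Definition t_curve (i k : 'I_m) : {poly K} := if k == i then 'X else 0.

(** A subalgebra that omits t_i and contains all the other generators: t_i is s h on
    the curve, and the others are scalar. *)
Definition t_test i : set (mxmap K m d) := test_algebra (t_curve i) low_scalar.

Lemma t_test_subalgebra i : unital_subalgebra (t_test i).
Proof.
have S0 : is_scalar_mx (0 : 'M[K]_d) by apply/is_scalar_mxP; exists 0; rewrite raddf0.
apply: test_algebra_subalgebra.
- by move=> _; apply: scalar_mx_is_scalar.
- by move=> r _.
- move=> r A B VA VB r1.
  have /is_scalar_mxP[a ->] := VA r1; have /is_scalar_mxP[b ->] := VB r1.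
  by rewrite -raddfD; apply: scalar_mx_is_scalar.
- move=> r c A VA r1; have /is_scalar_mxP[a ->] := VA r1.
  by rewrite scale_scalar_mx; apply: scalar_mx_is_scalar.
- move=> j l A B VA VB jl.
  have /is_scalar_mxP[a ->] := VA (leq_trans (leq_addr _ _) jl).
  have /is_scalar_mxP[b ->] := VB (leq_trans (leq_addl _ _) jl).
  by rewrite -scalar_mxM; apply: scalar_mx_is_scalar.
Qed.

Lemma t_test_t i k : t_test i (t_elt rho k) <-> k <> i.
Proof.
rewrite /t_test (test_algebra_t _ _ D) /t_curve -/h; split=> [V ki|/eqP/negbTE-> r _].
  have /is_scalar_mxP[a] := V 1%N isT.
  by rewrite ki eqxx coefX scale1r; apply: weight_not_scalar.
by rewrite coef0 scale0r; apply/is_scalar_mxP; exists 0; rewrite raddf0.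
Qed.

Lemma t_test_u i k l : t_test i (scalar_map d (u_elt rho k l)).
Proof.
by apply/(test_algebra_u _ _ D) => r _; rewrite scale_scalar_mx scalar_mx_is_scalar.
Qed.

(** Condition on the coefficient of s^r: scalar for r = 0, zero for r = 1, 2, 5, a
    multiple of h for r = 3, 4, a multiple of h^2 for r = 7, and none for the other r.
    It is compatible with products, since 3 + 4 and 0 + 7 are the only ways of writing 7
    as a sum of two of the exponents 0, 3, 4, 6, 7, ... *)
Definition gap (r : nat) (A : 'M[K]_d) : Prop :=
  match r with
  | 0 => is_scalar_mx A
  | 1 | 2 | 5 => A = 0
  | 3 | 4 => exists c, A = c *: h
  | 7 => exists c, A = c *: (h *m h)
  | _ => True
  end.

(** The curve X_i = s^3 h, X_j = s^4 h (X_i = (s^3 + s^4) h if i = j), and X_k = 0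
    otherwise. *)
Definition u_curve (i j k : 'I_m) : {poly K} :=
  (k == i)%:R *: 'X^3 + (k == j)%:R *: 'X^4.

(** A subalgebra that omits u_ij I and contains all the other generators: on the curve,
    u_ij I has a nonzero scalar coefficient of s^7, which is not a multiple of h^2, while
    the other u_kl I only involve s^6 and s^8. *)
Definition u_test i j : set (mxmap K m d) := test_algebra (u_curve i j) gap.

Lemma gap0 r : gap r 0.
Proof.
do 8?[case: r => [|r] //=]; try by exists 0; rewrite scale0r.
by apply/is_scalar_mxP; exists 0; rewrite raddf0.
Qed.

Lemma gapD r A B : gap r A -> gap r B -> gap r (A + B).
Proof.
do 8?[case: r => [|r] //=]; try by move=> -> ->; rewrite addr0.
- move=> /is_scalar_mxP[a ->] /is_scalar_mxP[b ->].
  by rewrite -raddfD scalar_mx_is_scalar.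
- by case=> a -> [b ->]; exists (a + b); rewrite scalerDl.
- by case=> a -> [b ->]; exists (a + b); rewrite scalerDl.
- by case=> a -> [b ->]; exists (a + b); rewrite scalerDl.
Qed.

Lemma gapZ r c A : gap r A -> gap r (c *: A).
Proof.
do 8?[case: r => [|r] //=]; try by move=> ->; rewrite scaler0.
- by move=> /is_scalar_mxP[a ->]; rewrite scale_scalar_mx scalar_mx_is_scalar.
- by case=> a ->; exists (c * a); rewrite scalerA.
- by case=> a ->; exists (c * a); rewrite scalerA.
- by case=> a ->; exists (c * a); rewrite scalerA.
Qed.

Lemma gapM j l A B : gap j A -> gap l B -> gap (j + l)%N (A *m B).
Proof.
case: j => [/is_scalar_mxP[a ->]|j gA]; first by rewrite mul_scalar_mx; apply: gapZ.
case: l => [/is_scalar_mxP[b ->]|l gB]; first by rewrite mul_mx_scalar addn0; apply: gapZ.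
have zeroA : A = 0 -> gap (j.+1 + l.+1)%N (A *m B) by move=> ->; rewrite mul0mx; apply: gap0.
have zeroB : B = 0 -> gap (j.+1 + l.+1)%N (A *m B) by move=> ->; rewrite mulmx0; apply: gap0.
have large r (C : 'M[K]_d) : (7 < r)%N -> gap r C by do 8?[case: r => [|r] //].
have [big|small] := ltnP 7 (j.+1 + l.+1); first exact: large.
do 7?[case: j gA zeroA zeroB small => [|j] gA zeroA zeroB small];
  do 7?[case: l gB zeroA zeroB small => [|l] gB zeroA zeroB small];
  try (by []); try (exact: zeroA); try (exact: zeroB).
- by case: gA gB => a -> [b ->]; exists (a * b); rewrite -scalemxAl -scalemxAr scalerA.
- by case: gA gB => a -> [b ->]; exists (a * b); rewrite -scalemxAl -scalemxAr scalerA.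
Qed.

Lemma u_test_subalgebra i j : unital_subalgebra (u_test i j).
Proof.
apply: test_algebra_subalgebra; [|exact: gap0|exact: gapD|exact: gapZ|exact: gapM].
exact: scalar_mx_is_scalar.
Qed.

Lemma u_test_t i j k : u_test i j (t_elt rho k).
Proof.
apply/(test_algebra_t _ _ D) => r; rewrite /u_curve coefD !coefZ !coefXn -/h.
do 8?[case: r => [|r]]; rewrite /= ?(mulr0, addr0, add0r, scale0r) //; try by eexists.
- by apply/is_scalar_mxP; exists 0; rewrite raddf0.
- by exists 0; rewrite scale0r.
Qed.

Lemma u_curveM i j k l (c := fun x y : 'I_m => (x == y)%:R : K) :
  u_curve i j k * u_curve i j l =
  (c k i * c l i) *: 'X^6 + (c k i * c l j + c k j * c l i) *: 'X^7 +
  (c k j * c l j) *: 'X^8.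
Proof. by rewrite /u_curve -/(c _ _) -!mul_polyC !rmorphD !rmorphM; ring. Qed.

Lemma u_test_u (i j k l : 'I_m) : (i <= j)%N -> (k <= l)%N ->
  u_test i j (scalar_map d (u_elt rho k l)) <-> (k, l) <> (i, j).
Proof.
move=> ij kl; rewrite /u_test (test_algebra_u _ _ D) -/h u_curveM.
split=> [V E|ne r].
  case: E V => -> -> /(_ 7%N); rewrite !coefD !coefZ !coefXn /= !eqxx.
  set c := (X in X *: _); rewrite scale_scalar_mx => -[b bE].
  have c0 : c != 0.
    rewrite /c !mulr0 add0r addr0 mulr1 -!natrM -natrD pnatr_eq0.
    by rewrite eq_sym; case: (j == i).
  have cT : c * \tr (h *m h) != 0 by rewrite mulf_neq0 // weight_square_trace.
  have b0 : b != 0.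
    apply: contra_neq cT => b0; move: bE; rewrite b0 scale0r => /matrixP.
    by move/(_ (Ordinal d0) (Ordinal d0)); rewrite !mxE eqxx.
  apply: (model_weights M n1 (a := b^-1 * (c * \tr (h *m h)))).
  by rewrite -/h -scale_scalar_mx bE scalerA mulVf // scale1r.
rewrite !coefD !coefZ !coefXn.
do 8?[case: r => [|r]]; rewrite /= ?(mulr0, addr0, add0r, scale0r) //;
  try by exists 0; rewrite scale0r.
- by apply/is_scalar_mxP; exists 0; rewrite raddf0.
- suff -> : (k == i)%:R * (l == j)%:R + (k == j)%:R * (l == i)%:R = 0 :> K.
    by rewrite mul0r scale0r; exists 0; rewrite scale0r.
  rewrite -!natrM !mulnb -natrD; apply/eqP; rewrite pnatr_eq0 addn_eq0 !eqb0.
  apply/andP; split; apply/negP => /andP[/eqP ki /eqP lj]; apply: ne.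
    by rewrite ki lj.
  have ji : i = j by apply/val_inj/eqP; rewrite eqn_leq ij -ki -lj kl.
  by rewrite ki lj ji.
Qed.

(** The m + m(m+1)/2 labels of the generators: i for t_i, and a pair i <= j
    for u_ij I. *)
Definition gen_index := ('I_m + {p : 'I_m * 'I_m | (p.1 <= p.2)%N})%type.

Definition gen (x : gen_index) : mxmap K m d :=
  match x with
  | inl i => t_elt rho i
  | inr p => scalar_map d (u_elt rho (val p).1 (val p).2)
  end.

(** Each generator is missed by a subalgebra containing all the other ones; in
    particular the generators are distinct. *)
Lemma gen_avoidable x : exists B : set (mxmap K m d),
  [/\ unital_subalgebra B, ~ B (gen x) & forall y, y <> x -> B (gen y)].
Proof.
case: x => [i|[[i j] /= ij]].
- exists (t_test i); split; first exact: t_test_subalgebra.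
    by move/t_test_t; apply.
  case=> [k ki|p _]; last exact: t_test_u.
  by apply/t_test_t => E; apply: ki; rewrite E.
- exists (u_test i j); split; first exact: u_test_subalgebra.
    by move/(u_test_u ij ij); apply.
  case=> [k _|[[k l] kl] ne]; first exact: u_test_t.
  by apply/(u_test_u ij kl) => E; apply: ne; congr inr; apply: val_inj.
Qed.

Lemma gen_inj : injective gen.
Proof.
move=> x y E; apply: contrapT => ne; have [B [_ nBx BH]] := gen_avoidable x.
by apply: nBx; rewrite E; apply: BH => yx; apply: ne.
Qed.

Lemma generatorsP F : generators m rho F <-> exists x, gen x = F.
Proof.
split=> [[[i _ <-]|[[i j] ij <-]]|[[i|[[i j] ij]] <-]].
- by exists (inl i).
- by exists (inr (exist _ (i, j) ij)).
- by left; exists i.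
- by right; exists (i, j).
Qed.

Lemma sum_succ k : (\sum_(j < k) j.+1 * 2 = k * k.+1)%N.
Proof.
elim: k => [|k IH]; first by rewrite big_ord0.
by rewrite big_ord_recr /= IH mulnC -mulnDr addn2.
Qed.

Lemma card_gen_index : #|{: gen_index}| = ((m * (m + 3)) %/ 2)%N.
Proof.
rewrite card_sum card_ord card_sig.
have -> : #|[pred p : 'I_m * 'I_m | (p.1 <= p.2)%N]| = (\sum_(j < m) j.+1)%N.
  rewrite -sum1_card /= (reindex_inj (h := fun p : 'I_m * 'I_m => (p.2, p.1))); last first.
    by case=> a b [a' b'] /= [-> ->].
  rewrite -(pair_big_dep xpredT (fun j i : 'I_m => i <= j)%N (fun _ _ => 1)%N) /=.
  apply: eq_bigr => j _.
  by rewrite -(big_ord_widen m (fun=> 1)%N (ltn_ord j)) sum_nat_const card_ord muln1.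
have -> : (m * (m + 3) = (m + \sum_(j < m) j.+1) * 2)%N.
  by rewrite mulnDl big_distrl /= sum_succ -mulnDr [(m + 3)%N]addnC.
by rewrite mulnK.
Qed.

Lemma card_generators : card_eq (generators m rho) (`I_((m * (m + 3)) %/ 2))%classic.
Proof.
rewrite -card_gen_index; apply: card_eq_trans _ (card_esym card_II).
have -> : generators m rho = range (fun k : 'I_#|{: gen_index}| => gen (enum_val k)).
  apply/seteqP; split=> F.
    by case/generatorsP=> x <-; exists (enum_rank x) => //=; rewrite enum_rankK.
  by case=> k _ <-; apply/generatorsP; exists (enum_val k).
by apply: inj_card_eq => k l _ _ /gen_inj/enum_val_inj.
Qed.

Lemma generated_covariants : generated_algebra (generators m rho) = covariants m Psi.
Proof.
apply/seteqP; split=> [|F covF B [algB genB]].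
  apply: smallest_sub; first exact: (covariants_subalgebra m D).
  move=> _ [[i _ <-]|[[i j] _ <-]]; last exact: (u_elt_covariant D).
  by split; [exact: (t_elt_polynomial D)|exact: (t_elt_equivariant D)].
apply: (covariant_in_algebra D M d0 (ltnW n1) algB) covF => [i|i j ij].
  have E (X : 'I_m -> sl2 K) : rho (sl2_of (val (X i))) = rho (X i).
    by rewrite sl2_of_val.
  by rewrite (funext E); apply: genB; left; exists i.
have E (X : 'I_m -> sl2 K) :
    \tr (rho (sl2_of (val (X i))) *m rho (sl2_of (val (X j)))) = u_elt rho i j X.
  by rewrite !sl2_of_val.
by rewrite (funext E); apply: genB; right; exists (i, j).
Qed.

Lemma covariants_minimally_generated :
  minimally_generated (covariants m Psi) (generators m rho).
Proof.
split; first exact: generated_covariants.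
move=> S' [S'S /existsNP[F /not_implyP[genF S'F]]] eqS.
have /generatorsP[x xF] := genF.
have [B [algB nBx BH]] := gen_avoidable x.
apply: nBx; have : generated_algebra S' (gen x).
  by rewrite eqS -generated_covariants xF; apply: sub_gen_smallest.
apply: smallest_sub => // G S'G; have /generatorsP[y yG] := S'S _ S'G.
by rewrite -yG; apply: BH => yx; apply: S'F; rewrite -xF -yx yG.
Qed.

End Minimality.

(** * Generators of the algebra of covariants *)

Unset Implicit Arguments.
Local Close Scope ring_scope.
Local Open Scope classical_set_scope.
Local Open Scope card_scope.

Theorem theorem3p3 (R : realType) (m d : nat) (hm : (1 <= m)%N) (hd : (3 <= d)%N)
    (Psi : SL2 R[i] -> 'M[R[i]]_d) (rho : sl2 R[i] -> 'M[R[i]]_d)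
    (hPsi : is_representation Psi) (holPsi : holomorphic Psi)
    (irrPsi : irreducible Psi) (hrho : is_tangent_representation Psi rho) :
  generators m rho #= `I_((m * (m + 3)) %/ 2) /\
  minimally_generated (covariants m Psi) (generators m rho).
Proof.
have D := tangent_differentiated hPsi hrho.
have [n [psi [phi M]]] := exists_sym_model (@complex_archi R) D irrPsi.
have n1 : (1 < n)%N by rewrite -ltnS; exact: leq_trans hd (model_dim M).
have d0 : (0 < d)%N by exact: leq_trans hd.
split; first exact: (card_generators m D M d0 n1).
exact: (covariants_minimally_generated m D M d0 n1).
Qed.
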